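(* Let $\mathcal{H}_1$, $K$ and $L$ be as in the context, and let $\gamma>0$. Let $(X,Y)$ be a pair of random variables with $Y\in\{-1,1\}$, and assume: (A1) $X$ is a bounded random variable taking its values in $\mathcal{H}_1$ (i.e. $\|X\|_1\le M$ almost surely for some constant $M$); (A2) $(\tau_d)_{d\ge1}$ is a sequence of sets of discretization points in $[0,1]$ such that, for all $d\ge1$, $\tau_d=\{t_k\}_{k=1,\ldots,d}$ and the matrix $\mathbf{K}_d=(K(t_i,t_j))_{i,j=1,\ldots,d}$ is positive definite, and $\mathrm{Span}\{K(t,\cdot):\ t\in\cup_{d\ge1}\tau_d\}$ is dense in $\mathcal{H}_1$; (A3) for each $d\ge 1$, $(C_n^d)_n$ is a sequence such that $C_n^d=\mathcal{O}(n^{1-\beta_d})$ as $n\to\infty$ for some $0<\beta_d<1/d$. Let $\phi_h^{n,d}$ be the SVM classifier on the derivatives of the $L$-spline interpolants at $t_1,\ldots,t_d$, built from $n$ observations of $(X,Y)$ with Gaussian kernel of parameter $\gamma$ and with regularization parameter $C=C_n^d$ (see context). Then $$\lim_{d\to+\infty}\ \lim_{n\to+\infty}Err\,\phi_h^{n,d}=Err^*,$$ where $Err^*=\inf_{\phi:\mathcal{H}_1\to\{-1,1\}}\mathbb{P}(\phi(X)\ne Y)$ is the Bayes error and $Err\,\phi=\mathbb{P}(\phi(X)\neq Y)$ is the error of a classifier $\phi$.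
   Context: Setting. $m\ge 1$ is an integer, $\mathcal{H}^m=\mathcal{H}^m([0,1])$ is the Sobolev space of $h\in L^2([0,1])$ whose weak derivatives $D^jh$, $j=1,\ldots,m$, exist and lie in $L^2([0,1])$. $L=D^m+\sum_{j=0}^{m-1}a_jD^j$ is a differential operator such that $\mathcal{H}_0=\mathrm{Ker}\,L$ is an $m$-dimensional subspace of $\mathcal{H}^m$ and $\mathcal{H}^m=\mathcal{H}_0\oplus\mathcal{H}_1$, where $\mathcal{H}_1$ is the subspace of $\mathcal{H}^m$ defined by $m$ linear boundary conditions $B^jh=0$, $j=1,\ldots,m$. $\mathcal{H}_1$ is equipped with the inner product $\langle u,v\rangle_1=\int_{[0,1]}Lu(t)\,Lv(t)\,dt$, for which it is a reproducing kernel Hilbert space (of functions on $[0,1]$) with reproducing kernel $K$; its norm is $\|\cdot\|_1$. $L$-spline interpolation. When $\mathbf{K}_d$ is positive definite and $x\in\mathcal{H}_1$, the $L$-spline interpolating $x$ at $t_1,\ldots,t_d$ is the unique element $h\in\mathcal{H}_1$ of minimal norm $\|h\|_1$ with $h(t_k)=x(t_k)$ for all $k=1,\ldots,d$. Classifier $\phi_h^{n,d}$. Let $(x_1,y_1),\ldots,(x_n,y_n)$ be $n$ i.i.d. observations of $(X,Y)$ and let $h_i$ be the $L$-spline interpolating $x_i$ at $t_1,\ldots,t_d$. Let $G_\gamma^\infty(u,v)=e^{-\gamma\|u-v\|^2_{L^2}}$ on $L^2([0,1])$. Given $C>0$, let $\alpha^*$ be a solution of $$\max_\alpha\ \sum_{i=1}^n\alpha_i-\sum_{i,j=1}^n\alpha_i\alpha_jy_iy_jG_\gamma^\infty(Lh_i,Lh_j)\quad\text{subject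 to}\quad\sum_{i=1}^n\alpha_iy_i=0,\ 0\le\alpha_i\le C,\ 1\le i\le n.$$ For $x\in\mathcal{H}_1$ with interpolating $L$-spline $h$ at $t_1,\ldots,t_d$, $\phi_h^{n,d}(x)=\mathrm{sign}\big(2\sum_i\alpha_i^*y_iG_\gamma^\infty(Lh_i,Lh)+b^*\big)$ (with $\mathrm{sign}(0)=1$), where $b^*$ minimizes $b\mapsto\sum_{l}\max\big(0,1-y_l(2\sum_i\alpha_i^*y_iG_\gamma^\infty(Lh_i,Lh_l)+b)\big)$. Any non-uniqueness in $(\alpha^*,b^* )$ is resolved by a fixed measurable rule depending only on the Gram matrix, the labels and $C$. Conventions. Infima over classifiers $\phi$ are over measurable maps. In $Err\,\phi_h^{n,d}=\mathbb{P}(\phi_h^{n,d}(X)\ne Y)$, the pair $(X,Y)$ is independent of the training sample and the probability is taken over both.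
   Formalization: The formal theorem adds to (A3) that n·C_n^d → ∞ for each d ≥ 1; with only the upper bound O(n^{1-β_d}) the claim fails, e.g. C_n^d = (n+1)^{-2}, X two-valued with probabilities 2/3 and 1/3, and Y determined by X. *)

(* Defs.v *)
From mathcomp Require Import all_boot all_order all_algebra.
From mathcomp Require Import all_classical all_reals all_analysis.
Set Implicit Arguments.
Unset Strict Implicit.
Unset Printing Implicit Defensive.
Import Order.TTheory GRing.Theory Num.Theory.
Import numFieldNormedType.Exports.
Local Open Scope classical_set_scope.
Local Open Scope ring_scope.

(* A real function on [0,1] is represented by a function R -> R; the elements
   of the Sobolev space are normalised to vanish outside [0,1], so that
   Leibniz equality of representatives is equality of functions on [0,1]. *)

Definition I01 {R : realType} : set R := `[0, 1].

Section Sobolev.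
Variable R : realType.
Local Notation mu := (@lebesgue_measure R).
Implicit Types f g h u v psi : R -> R.

Definition L2 f : Prop :=
  measurable_fun I01 f /\ mu.-integrable I01 (fun t => (f t ^+ 2)%:E).

(* C^oo functions with compact support in the open interval ]0,1[ *)
Definition test_function psi : Prop :=
  (forall n x, derivable (derive1n n psi) x 1) /\
  exists a b : R, 0 < a /\ b < 1 /\ forall x, ~ (a <= x <= b) -> psi x = 0.

Definition is_weak_deriv (j : nat) h g : Prop :=
  L2 g /\
  forall psi, test_function psi ->
    (\int[mu]_(x in I01) (h x * derive1n j psi x)
     = (-1) ^+ j * \int[mu]_(x in I01) (g x * psi x))%R.

(* For m >= 1 every class in H^m has exactly one continuous representative;
   it is the one used here, since H_1 is a space of functions. *)
Definition sobolev (m : nat) : set (R -> R) :=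
  [set h | (forall x, ~ I01 x -> h x = 0) /\
           {within I01, continuous h} /\ L2 h /\
           forall j, (1 <= j <= m)%N -> exists g, is_weak_deriv j h g].

(* Some representative of the L^2 class D^j h: it only occurs under integrals
   and in almost everywhere statements. *)
Definition wderiv (j : nat) h : R -> R :=
  xget (fun=> 0) [set g | is_weak_deriv j h g].

(* The continuous representative of D^j h, which exists for h in H^m and j < m
   and is unique on [0,1]; needed for boundary values. *)
Definition cderiv (j : nat) h : R -> R :=
  xget (fun=> 0) [set g | is_weak_deriv j h g /\ {within I01, continuous g}].

Definition diff_op (m : nat) (a : 'I_m -> R -> R) h : R -> R :=
  fun t => wderiv m h t + \sum_(j < m) a j t * wderiv j h t.

Definition ker_op (m : nat) (a : 'I_m -> R -> R) : set (R -> R) :=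
  [set h | sobolev m h /\
           {ae mu, forall t, I01 t -> diff_op a h t = 0}].

(* The general linear form in the boundary values at 0 and 1 of
   h, Dh, ..., D^(m-1) h. *)
Definition boundary_form (m : nat) (b0 b1 : 'M[R]_m) (j : 'I_m) h : R :=
  \sum_(i < m) (b0 j i * cderiv i h 0 + b1 j i * cderiv i h 1).

Definition H1_space (m : nat) (b0 b1 : 'M[R]_m) : set (R -> R) :=
  [set h | sobolev m h /\ forall j, boundary_form b0 b1 j h = 0].

Definition ip1 (m : nat) (a : 'I_m -> R -> R) u v : R :=
  (\int[mu]_(t in I01) (diff_op a u t * diff_op a v t))%R.

Definition has_dim (m : nat) (V : set (R -> R)) : Prop :=
  exists e : 'I_m -> R -> R,
    (forall c : 'I_m -> R,
       (fun t => \sum_i c i * e i t) = (fun=> 0) -> forall i, c i = 0) /\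
    V = [set u | exists c : 'I_m -> R, u = (fun t => \sum_i c i * e i t)].

Definition is_direct_sum (V V0 V1 : set (R -> R)) : Prop :=
  V0 `<=` V /\ V1 `<=` V /\ V0 `&` V1 = [set (fun=> 0)] /\
  forall h, V h ->
    exists h0 h1, V0 h0 /\ V1 h1 /\ h = (fun t => h0 t + h1 t).

Definition Lspline_setting (m : nat) (a : 'I_m -> R -> R) (b0 b1 : 'M[R]_m) :
    Prop :=
  (forall j, L2 (a j)) /\
  has_dim m (ker_op a) /\
  is_direct_sum (sobolev m) (ker_op a) (H1_space b0 b1).

End Sobolev.

Section RKHS.
Variable R : realType.
Variables (H : set (R -> R)) (ip : (R -> R) -> (R -> R) -> R).
Implicit Types u v : R -> R.

Definition ip_norm u : R := Num.sqrt (ip u u).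

Definition ip_dist u v : R := ip_norm (fun t => u t - v t).

Definition is_rkhs (K : R -> R -> R) : Prop :=
  H (fun=> 0) /\
  (forall c u v, H u -> H v -> H (fun t => c * u t + v t)) /\
  (forall u v, H u -> H v -> ip u v = ip v u) /\
  (forall c u v w, H u -> H v -> H w ->
     ip (fun t => c * u t + v t) w = c * ip u w + ip v w) /\
  (forall u, H u -> 0 <= ip u u) /\
  (forall u, H u -> ip u u = 0 -> u = (fun=> 0)) /\
  (forall f : nat -> R -> R, (forall n, H (f n)) ->
     (forall e, 0 < e -> exists N, forall p q, (N <= p)%N -> (N <= q)%N ->
        ip_dist (f p) (f q) < e) ->
     exists u, H u /\ (fun n => ip_dist (f n) u) @ \oo --> (0 : R)) /\
  (forall t, I01 t -> H (K t) /\ forall u, H u -> u t = ip u (K t)).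

(* The open sets of the normed space H, as subsets of R -> R: the sigma-algebra
   they generate traces the Borel sigma-algebra on H, and contains H. *)
Definition ip_open : set (set (R -> R)) :=
  [set U | U `<=` H /\
     forall u, U u -> exists r, 0 < r /\
       forall v, H v -> ip_dist u v < r -> U v].

Definition kernel_span (K : R -> R -> R) (T : set R) : set (R -> R) :=
  [set u | exists (n : nat) (c s : 'I_n -> R), (forall i, T (s i)) /\
             u = (fun t => \sum_i c i * K (s i) t)].

Definition dense_in (V : set (R -> R)) : Prop :=
  forall u, H u -> forall e, 0 < e -> exists v, V v /\ ip_dist u v < e.

(* tau_d consists of the first d terms of a sequence, indexed from 0 *)
Definition tau (t : nat -> R) (d : nat) : set R := t @` `I_d.

Definition kernel_mx (K : R -> R -> R) (t : nat -> R) (d : nat) : 'M[R]_d :=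
  \matrix_(i < d, j < d) K (t i) (t j).

Definition pos_def (d : nat) (A : 'M[R]_d) : Prop :=
  A^T = A /\ forall v : 'cV[R]_d, v != 0 -> 0 < (v^T *m A *m v) 0 0.

Definition interpolates (t : nat -> R) (d : nat) (x h : R -> R) : Prop :=
  H h /\ forall k, (k < d)%N -> h (t k) = x (t k).

Definition is_Lspline (t : nat -> R) (d : nat) (x h : R -> R) : Prop :=
  interpolates t d x h /\
  forall g, interpolates t d x g -> ip_norm h <= ip_norm g.

Definition Lspline (t : nat -> R) (d : nat) (x : R -> R) : R -> R :=
  xget (fun=> 0) [set h | is_Lspline t d x h].

End RKHS.

Section SVM.
Variable R : realType.

Definition is_label (y : R) : Prop := y = -1 \/ y = 1.

Definition gauss (gamma : R) (u v : R -> R) : R :=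
  expR (- gamma *
    (\int[@lebesgue_measure R]_(t in I01) ((u t - v t) ^+ 2))%R).

Definition gram (gamma : R) (n : nat) (u : n.-tuple (R -> R)) :
    n.-tuple (n.-tuple R) :=
  [tuple [tuple gauss gamma (tnth u i) (tnth u j) | j < n] | i < n].

Variable n : nat.
Implicit Types (G : n.-tuple (n.-tuple R)) (y alpha : n.-tuple R).

Definition svm_dual G y alpha : R :=
  \sum_(i < n) tnth alpha i -
  \sum_(i < n) \sum_(j < n)
    tnth alpha i * tnth alpha j * tnth y i * tnth y j * tnth (tnth G i) j.

Definition svm_feasible (C : R) y alpha : Prop :=
  \sum_(i < n) tnth alpha i * tnth y i = 0 /\
  forall i, 0 <= tnth alpha i <= C.

Definition svm_dual_solution (C : R) G y alpha : Prop :=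
  svm_feasible C y alpha /\
  forall alpha', svm_feasible C y alpha' ->
    svm_dual G y alpha' <= svm_dual G y alpha.

Definition svm_hinge G y alpha (b : R) : R :=
  \sum_(l < n) Num.max 0
    (1 - tnth y l *
      (2 * \sum_(i < n) tnth alpha i * tnth y i * tnth (tnth G i) l + b)).

Definition svm_bias G y alpha (b : R) : Prop :=
  forall b', svm_hinge G y alpha b <= svm_hinge G y alpha b'.

End SVM.

Section Classifier.
Variable R : realType.

Definition svm_rule : Type :=
  forall n : nat, n.-tuple (n.-tuple R) -> n.-tuple R -> R -> n.-tuple R * R.

(* Validity is only required on Gram matrices of the Gaussian kernel on L^2. *)
Definition svm_rule_ok (gamma : R) (sel : svm_rule) : Prop :=
  (forall n : nat,
     measurable_fun setT
       (fun z : (n.-tuple (n.-tuple R) * n.-tuple R * R)%type =>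
          sel n z.1.1 z.1.2 z.2 : (n.-tuple R * R)%type)) /\
  forall (n : nat) (u : n.-tuple (R -> R)) (y : n.-tuple R) (C : R),
    (forall i, L2 (tnth u i)) -> (forall i, is_label (tnth y i)) -> 0 < C ->
    let G := gram gamma u in
    svm_dual_solution C G y (sel n G y C).1 /\
    svm_bias G y (sel n G y C).1 (sel n G y C).2.

Definition sgn1 (r : R) : R := if 0 <= r then 1 else -1.

(* H, ip, Lop stand for H_1, <.,.>_1 and L; (xs, ys) is the training sample *)
Definition svm_classifier (H : set (R -> R)) (ip : (R -> R) -> (R -> R) -> R)
    (Lop : (R -> R) -> R -> R) (gamma : R) (sel : svm_rule) (t : nat -> R)
    (d n : nat) (C : R) (xs : n.-tuple (R -> R)) (ys : n.-tuple R)
    (x : R -> R) : R :=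
  let Ls z := Lop (Lspline H ip t d z) in
  let ab := sel n (gram gamma [tuple Ls (tnth xs i) | i < n]) ys C in
  sgn1 (2 * \sum_(i < n) tnth ab.1 i * tnth ys i *
              gauss gamma (Ls (tnth xs i)) (Ls x) + ab.2).

End Classifier.

Section Probability.
Context {d : measure_display} {Omega : measurableType d} {R : realType}.
Variable P : probability Omega R.

Definition mutually_independent {d' : measure_display} {E : measurableType d'}
    {I : eqType} (Z : I -> Omega -> E) : Prop :=
  forall (s : seq I) (A : I -> set E), uniq s ->
    (forall i, measurable (A i)) ->
    P (\bigcap_(i in [set` s]) (Z i @^-1` A i)) =
    (\prod_(i <- s) fine (P (Z i @^-1` A i)))%:E.

Definition identically_distributed {d' : measure_display}
    {E : measurableType d'} {I : Type} (Z : I -> Omega -> E) : Prop :=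
  forall (i j : I) (A : set E), measurable A ->
    P (Z i @^-1` A) = P (Z j @^-1` A).

(* The pair (X, Y) (index None) together with the sample (indices Some i). *)
Definition pair_and_sample (H : set (R -> R))
    (ip : (R -> R) -> (R -> R) -> R) (X : Omega -> R -> R) (Y : Omega -> R)
    (xs : nat -> Omega -> R -> R) (ys : nat -> Omega -> R) (k : option nat) :
    Omega -> g_sigma_algebraType (ip_open H ip) * R :=
  fun w => if k is Some i then (xs i w, ys i w) else (X w, Y w).

Definition H_valued_rv (H : set (R -> R)) (ip : (R -> R) -> (R -> R) -> R)
    (X : Omega -> R -> R) : Prop :=
  measurable_fun setT (X : Omega -> g_sigma_algebraType (ip_open H ip)) /\
  forall w, H (X w).

Definition label_rv (Y : Omega -> R) : Prop :=
  measurable_fun setT Y /\ forall w, is_label (Y w).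

Definition bayes_error (H : set (R -> R)) (ip : (R -> R) -> (R -> R) -> R)
    (X : Omega -> R -> R) (Y : Omega -> R) : \bar R :=
  ereal_inf [set P [set w | phi (X w) <> Y w] |
    phi in [set phi : (R -> R) -> R |
      measurable_fun (H : set (g_sigma_algebraType (ip_open H ip))) phi /\
      forall x, H x -> is_label (phi x)]].

Definition svm_error (H : set (R -> R)) (ip : (R -> R) -> (R -> R) -> R)
    (Lop : (R -> R) -> R -> R) (gamma : R) (sel : svm_rule R) (t : nat -> R)
    (X : Omega -> R -> R) (Y : Omega -> R)
    (xs : nat -> Omega -> R -> R) (ys : nat -> Omega -> R)
    (dd n : nat) (C : R) : \bar R :=
  P [set w | svm_classifier H ip Lop gamma sel t dd C
               [tuple xs i w | i < n] [tuple ys i w | i < n] (X w) <> Y w].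

End Probability.

(* Main.v *)
(* For fixed d, Gram-Schmidt applied to the kernels K(t_1), K(t_2), ... gives coordinates
   c_k on H_1, the L-spline of x is its projection sum_{k <= d} c_k(x) g_k, and since <.,.>_1
   is the L^2 product of images under L, the kernel of the classifier is the Gaussian kernel
   on R^d evaluated at the first d coordinates, which are almost surely bounded.

   A solution of the SVM dual minimises the regularised hinge loss, the intercept being a
   Lagrange multiplier.  The score is thus compared with a Gaussian combination whose hinge
   risk is nearly optimal (universality); the penalty of the latter vanishes because
   n C_n -> oo.  Replacing the kernel by a Taylor polynomial and rounding coefficients, which
   are O(n^2) because C_n = O(n), puts every clipped score close to a net of exp(o(n))
   functions, on which exponential deviation bounds hold uniformly.  Hence the error tends to
   the best error among classifiers measurable in c_1, ..., c_d.

   The density assumption makes every Borel subset of H_1 a member of the sigma-algebra of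
   all the c_k, so it is approximated in probability by sets depending on finitely many of
   them, and the best error in d coordinates tends to the Bayes error. *)

Require Import Defs.
From mathcomp Require Import all_boot all_order all_algebra.
From mathcomp Require Import all_classical all_reals all_analysis.
From mathcomp Require Import measurable_realfun ring lra.
Import Order.TTheory GRing.Theory Num.Theory.
Import numFieldNormedType.Exports.
Set Implicit Arguments.
Unset Strict Implicit.
Unset Printing Implicit Defensive.
Local Open Scope classical_set_scope.
Local Open Scope ring_scope.

(** * Bounded expectations and deviation inequalities *)

Section Expectation.
Context d (T : measurableType d) (R : realType) (P : probability T R).
Implicit Types f g : T -> R.

(** Two obstacles shape the proof. The intercept has no a priori bound, so the scores form no
    bounded class; they are therefore clipped to [-1,1], after which an intercept exceeding the
    kernel part by more than 1 can be truncated without any effect. Nor does the conditional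
    probability of the label given the coordinates ever appear: a function g is judged by its margin
    E[Y g], which is linear in g, and the best error comes from a supremum of margins over the sets
    of a sigma-algebra. A function with values in [-1,1] is nearly an average of classifiers, and
    this replaces the usual pointwise comparison of hinge risk and error. Every classifier built
    from a sample is measurable in the coordinates, so its conditional error is never below the best
    one, whatever the sample; only an upper bound on a large set of samples has to be found. *)

Definition ae_bounded f :=
  measurable_fun setT f /\ exists M : R, {ae P, forall x, `|f x| <= M}.

Definition Ex f : R := (\int[P]_x f x)%R.

Lemma measure_setT_probability :
  (P : {measure set T -> \bar R}) [set: T] = 1%E.
Proof. exact: probability_setT. Qed.

Lemma bounded_ae M f : measurable_fun setT f -> (forall x, `|f x| <= M) ->
  ae_bounded f.
Proof. by move=> mf fM; split=> //; exists M; exact: aeW. Qed.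

Lemma ae_bounded_integrable f : ae_bounded f -> P.-integrable setT (EFin \o f).
Proof.
move=> [mf [M fM]]; apply/integrableP; split; first exact/measurable_EFinP.
apply: (@le_lt_trans _ _ (\int[P]_x `|M|%:E)%E).
  apply: ae_ge0_le_integral => //.
  - by apply: measurableT_comp => //; exact/measurable_EFinP.
  - apply: filterS fM => x fxM _ /=; rewrite lee_fin.
    exact: le_trans fxM (ler_norm _).
by rewrite integral_cst// measure_setT_probability mule1 ltry.
Qed.

Lemma ae_bounded_cst c : ae_bounded (cst c).
Proof. exact: (@bounded_ae `|c|). Qed.

Lemma ae_boundedD f g : ae_bounded f -> ae_bounded g ->
  ae_bounded (fun x => f x + g x).
Proof.
move=> [mf [M fM]] [mg [N gN]]; split; first exact: measurable_funD.
exists (M + N); apply: filterS2 fM gN => x fM gN.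
by rewrite (le_trans (ler_normD _ _))// lerD.
Qed.

Lemma ae_boundedM f g : ae_bounded f -> ae_bounded g ->
  ae_bounded (fun x => f x * g x).
Proof.
move=> [mf [M fM]] [mg [N gN]]; split; first exact: measurable_funM.
exists (M * N); apply: filterS2 fM gN => x fM gN.
by rewrite normrM ler_pM.
Qed.

Lemma ae_boundedZ c f : ae_bounded f -> ae_bounded (fun x => c * f x).
Proof. by move=> bf; apply: ae_boundedM => //; exact: ae_bounded_cst. Qed.

Lemma ae_boundedN f : ae_bounded f -> ae_bounded (fun x => - f x).
Proof.
move=> bf; have := ae_boundedZ (-1) bf.
by congr ae_bounded; apply/funext => x; rewrite mulN1r.
Qed.

Lemma ae_boundedB f g : ae_bounded f -> ae_bounded g ->
  ae_bounded (fun x => f x - g x).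
Proof. by move=> bf bg; apply: ae_boundedD => //; exact: ae_boundedN. Qed.

Lemma ae_bounded_norm f : ae_bounded f -> ae_bounded (fun x => `|f x|).
Proof.
move=> [mf [M fM]]; split; first exact: measurableT_comp.
by exists M; apply: filterS fM => x; rewrite normr_id.
Qed.

Lemma ae_bounded_sum (I : Type) (r : seq I) (f : I -> T -> R) :
  (forall i, ae_bounded (f i)) -> ae_bounded (fun x => \sum_(i <- r) f i x).
Proof.
move=> bf; elim: r => [|i r IH].
  under eq_fun do rewrite big_nil; exact: ae_bounded_cst.
under eq_fun do rewrite big_cons; exact: ae_boundedD.
Qed.

Lemma ae_bounded_indic (A : set T) : measurable A -> ae_bounded \1_A.
Proof.
move=> mA; apply: (@bounded_ae 1); first exact: measurable_indic.
by move=> x; rewrite indicE; case: (_ \in _); rewrite ?normr1 ?normr0.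
Qed.

Lemma Ex_cst c : Ex (cst c) = c.
Proof.
rewrite /Ex Rintegral_cst//.
by rewrite measure_setT_probability mulr1.
Qed.

Lemma ExD f g : ae_bounded f -> ae_bounded g ->
  Ex (fun x => f x + g x) = Ex f + Ex g.
Proof. by move=> bf bg; apply: RintegralD => //; exact: ae_bounded_integrable. Qed.

Lemma ExB f g : ae_bounded f -> ae_bounded g ->
  Ex (fun x => f x - g x) = Ex f - Ex g.
Proof. by move=> bf bg; apply: RintegralB => //; exact: ae_bounded_integrable. Qed.

Lemma ExZ c f : ae_bounded f -> Ex (fun x => c * f x) = c * Ex f.
Proof. by move=> bf; apply: RintegralZl => //; exact: ae_bounded_integrable. Qed.

Lemma Ex_sum (I : Type) (r : seq I) (f : I -> T -> R) :
  (forall i, ae_bounded (f i)) ->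
  Ex (fun x => \sum_(i <- r) f i x) = \sum_(i <- r) Ex (f i).
Proof.
move=> bf; elim: r => [|i r IH].
  by under eq_fun do rewrite big_nil; rewrite big_nil; exact: Ex_cst.
under eq_fun do rewrite big_cons.
by rewrite big_cons ExD// ?IH//; exact: ae_bounded_sum.
Qed.

Lemma Ex_le f g : ae_bounded f -> ae_bounded g ->
  {ae P, forall x, f x <= g x} -> Ex f <= Ex g.
Proof.
move=> bf bg fg.
have ifi := ae_bounded_integrable bf; have igi := ae_bounded_integrable bg.
rewrite -lee_fin /Ex /Rintegral !fineK; try exact: integrable_fin_num.
have idi := integrableB measurableT igi ifi.
have : (0 <= \int[P]_x ((EFin \o g) \- (EFin \o f)) x)%E.
  (* The positive part changes the integrand on a null set only, and makes the inequality hold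
     everywhere. *)
  have -> : (\int[P]_x ((EFin \o g) \- (EFin \o f)) x =
      \int[P]_x (Num.max 0 (g x - f x))%:E)%E.
    apply: ae_eq_integral => //.
    - by case/integrableP: idi.
    - apply/measurable_EFinP; apply: measurable_maxr => //.
      by apply: measurable_funB; [case: bg|case: bf].
    - apply: filterS fg => x fgx _ /=; rewrite -EFinB; congr EFin.
      by apply/esym/max_idPr; rewrite subr_ge0.
  by apply: integral_ge0 => x _; rewrite lee_fin le_max lexx.
by rewrite integralB// sube_ge0 ?(integrable_fin_num measurableT igi) ?orbT.
Qed.

Lemma Ex_ge0 f : (forall x, 0 <= f x) -> 0 <= Ex f.
Proof. by move=> f0; apply: Rintegral_ge0. Qed.

Lemma Ex_norm f : ae_bounded f -> `|Ex f| <= Ex (fun x => `|f x|).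
Proof. by move=> bf; apply: le_normr_Rintegral => //; exact: ae_bounded_integrable. Qed.

Lemma Ex_indic (A : set T) : measurable A -> Ex \1_A = fine (P A).
Proof. by move=> mA; rewrite /Ex /Rintegral integral_indic// setIT. Qed.

Lemma EFin_Ex f : ae_bounded f -> (Ex f)%:E = (\int[P]_x (f x)%:E)%E.
Proof.
by move=> /ae_bounded_integrable fi; apply: fineK; exact: integrable_fin_num.
Qed.

Lemma Ex_dominated (f_ : nat -> T -> R) f (M : R) :
  (forall n, measurable_fun setT (f_ n)) -> measurable_fun setT f ->
  {ae P, forall x, (f_ n x @[n --> \oo] --> f x) /\ forall n, `|f_ n x| <= M} ->
  Ex (fun x => `|f_ n x - f x|) @[n --> \oo] --> (0:R).
Proof.
move=> mf_ mf fM.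
have [] := @dominated_convergence _ T R P setT measurableT
  (fun n x => (f_ n x)%:E) (EFin \o f) (EFin \o cst M).
- by move=> n; exact/measurable_EFinP.
- exact/measurable_EFinP.
- apply: filterS fM => x [fx _] _ /=; exact: cvg_EFin (nearW _ _) fx.
- by apply: ae_bounded_integrable; exact: ae_bounded_cst.
- by apply: filterS fM => x [_ fx] n _ /=; rewrite lee_fin.
move=> _ + _ => /fine_cvg /=.
by [].
Qed.

End Expectation.

(** [expR (- x) >= 1 - x] gives [expR x <= 1 / (1 - x)], and the quadratic dominates this inverse as
    long as [1 - 2 * x >= 0]. No lower bound on [x] is involved. *)
Lemma expR_le_quad (R : realType) (x : R) : x <= 2^-1 -> expR x <= 1 + x + 2 * x ^+ 2.
Proof.
move=> x2.
have p : 0 < 1 - x by lra.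
have e1 : expR x <= (1 - x)^-1.
  rewrite -[expR x]invrK lef_pV2 ?posrE ?invr_gt0 ?expR_gt0//.
  by rewrite -expRN expR_ge1Dx.
apply: (le_trans e1); rewrite -[_^-1]mul1r ler_pdivrMr//.
have -> : (1 + x + 2 * x ^+ 2) * (1 - x) = 1 + x ^+ 2 * (1 - 2 * x) by ring.
by rewrite lerDl mulr_ge0 ?sqr_ge0//; lra.
Qed.

Definition pushforward_measure d d' (T1 : measurableType d)
    (T2 : measurableType d') (R : realFieldType)
    (m : {measure set T1 -> \bar R}) (f : T1 -> T2)
    (mf : measurable_fun setT f) : {measure set T2 -> \bar R} :=
  measure_function_pushforward__canonical__measure_function_Measure m mf.

(** * Finite samples of independent, identically distributed variables *)

Section Independence.
Context {d d' : measure_display} {Om : measurableType d} {E : measurableType d'}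
  {R : realType} (P : probability Om R) {I : eqType} (Z : I -> Om -> E).
Hypothesis mZ : forall i, measurable_fun setT (Z i).
Hypothesis indZ : mutually_independent P Z.

Definition sample n (s : n.-tuple I) (w : Om) : n.-tuple E :=
  [tuple Z (tnth s i) w | i < n].

Lemma measurable_sample n (s : n.-tuple I) : measurable_fun setT (sample s).
Proof.
apply/measurable_fun_tnthP => i.
by rewrite (_ : _ \o _ = Z (tnth s i))//; apply/funext => w /=; rewrite tnth_mktuple.
Qed.

Definition tuple_box n (A : 'I_n -> set E) : set (n.-tuple E) :=
  [set x | forall i, A i (tnth x i)].

Lemma measurable_tuple_box n (A : 'I_n -> set E) :
  (forall i, measurable (A i)) -> measurable (tuple_box A).
Proof.
move=> mA.
rewrite (_ : tuple_box A = \bigcap_(i in [set: 'I_n]) ((@tnth n E)^~ i @^-1` A i)).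
  apply: fin_bigcap_measurable => [|i _]; first exact: finite_finset.
  by rewrite -[_ @^-1` _]setTI; exact: measurable_tnth.
by apply/seteqP; split=> x /= xA i; [move=> _; exact: xA|exact: xA].
Qed.

Lemma probability_sample_box n (s : n.-tuple I) (A : 'I_n -> set E) :
  uniq s -> (forall i, measurable (A i)) ->
  P (sample s @^-1` tuple_box A) =
  (\prod_(i < n) fine (P (Z (tnth s i) @^-1` A i)))%:E.
Proof.
move=> us mA.
(* Mutual independence speaks of families indexed by all of [I]: the sides of the box are carried
   over to the indices in [s], which are distinct, and completed by the full set. *)
pose A' k := if insub (index k s) is Some i then A i else setT.
have A'E i : A' (tnth s i) = A i.
  rewrite /A' (_ : index _ _ = i) ?valK//.
  by rewrite (tnth_nth (tnth s i)) index_uniq ?size_tuple.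
have := indZ us (A := A').
rewrite [X in P X](_ : _ = sample s @^-1` tuple_box A).
  move=> ->; first by rewrite big_tuple; under eq_bigr do rewrite A'E.
  by move=> k; rewrite /A'; case: insubP => [i _ _|_]; [exact: mA|exact: measurableT].
apply/seteqP; split => w /= wA.
  by move=> i; rewrite tnth_mktuple -A'E; apply: wA; exact: mem_tnth.
by move=> k /= /tnthP[i ->]; rewrite A'E; have := wA i; rewrite tnth_mktuple.
Qed.

Lemma measurable_preimage_rv i B : measurable B -> measurable (Z i @^-1` B).
Proof. by move=> mB; rewrite -[_ @^-1` _]setTI; exact: mZ. Qed.

Lemma tuple_box_generates n : @measurable _ (n.-tuple E) =
  <<s [set tuple_box A | A in [set A | forall i, measurable (A i)]] >>.
Proof.
apply/seteqP; split; last first.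
  apply: smallest_sub; first exact: sigma_algebra_measurable.
  by move=> _ [A mA <-]; exact: measurable_tuple_box.
apply: smallest_sub; first exact: smallest_sigma_algebra.
move=> X; rewrite -bigcup_seq => -[i /= _] [B mB <-].
apply: sub_sigma_algebra; exists (fun k => if k == i then B else setT).
  by move=> k; case: ifP.
apply/seteqP; split => x /=.
  by move=> /(_ i); rewrite eqxx.
by move=> [_ xB] k; case: eqP => [->|].
Qed.

(** As functions of [A], both sides are finite measures. They agree on boxes, a generating class
    stable under intersection, where the identity is mutual independence along [j :: s]. *)
Lemma sample_indep n (s : n.-tuple I) j A B : uniq (j :: s) ->
  measurable A -> measurable B ->
  P ((sample s @^-1` A) `&` (Z j @^-1` B)) =
  (P (sample s @^-1` A) * P (Z j @^-1` B))%E.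
Proof.
move=> us mA mB.
have mZB := measurable_preimage_rv j mB.
pose c : {nonneg R} := NngNum (fine_ge0 (measure_ge0 P (Z j @^-1` B))).
pose m1 : {measure set (n.-tuple E) -> \bar R} :=
  pushforward_measure (mrestr P mZB) (measurable_sample s).
pose m2 : {measure set (n.-tuple E) -> \bar R} :=
  mscale c (pushforward_measure P (measurable_sample s)).
suff : m1 A = m2 A.
  rewrite /m1 /m2 /= /pushforward /mrestr /mscale /= => ->.
  by rewrite fineK ?fin_num_measure// muleC.
apply: (@g_sigma_algebra_measure_unique _ _ _
  [set tuple_box A | A in [set A | forall i, measurable (A i)]] _ (fun=> setT)).
- by move=> _ [A' mA' <-]; exact: measurable_tuple_box.
- move=> _; exists (fun=> setT) => //; apply/seteqP; split => // x _ i //.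
- by rewrite bigcup_const.
- move=> _ _ [A1 mA1 <-] [A2 mA2 <-].
  exists (fun i => A1 i `&` A2 i); first by move=> i; exact: measurableI.
  apply/seteqP; split => x /=.
    by move=> xA; split => i; case: (xA i).
  by move=> [xA1 xA2] i; split.
- move=> _ [A' mA' <-].
  rewrite /m1 /m2 /= /pushforward /mrestr /mscale /=.
  have := @probability_sample_box _ [tuple of j :: s]
    (fun i => if unlift ord0 i is Some k then A' k else B) us.
  rewrite [X in P X](_ : _ = (sample s @^-1` tuple_box A') `&` (Z j @^-1` B)).
    move=> ->; last by move=> i; case: unliftP.
    rewrite big_ord_recl unlift_none (tnth_nth j)/=.
    under eq_bigr do rewrite liftK tnthS.
    have [js us'] : j \notin s /\ uniq s by move: us => /= /andP.
    by rewrite EFinM -probability_sample_box.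
  apply/seteqP; split => w /=.
    move=> wA; split.
      by move=> i; have := wA (lift ord0 i); rewrite liftK !tnth_mktuple tnthS.
    by have := wA ord0; rewrite unlift_none tnth_mktuple (tnth_nth j).
  move=> [wA wB] i; case: unliftP => [k ->|->]; rewrite tnth_mktuple.
    by rewrite tnthS; have := wA k; rewrite tnth_mktuple.
  by rewrite (tnth_nth j).
- move=> _; rewrite /m1 /= /pushforward /mrestr /=.
  by rewrite preimage_setT setTI ltey_eq fin_num_measure.
- by rewrite -tuple_box_generates.
Qed.

(** The joint law of the sample and of a fresh variable is the product of their laws. This serves
    twice: to peel off one observation in the exponential moment bound, and to condition the test
    error on the training sample. *)
Lemma sample_fubini n (s : n.-tuple I) j (F : n.-tuple E * E -> \bar R) :
  uniq (j :: s) -> measurable_fun setT F -> (forall x, 0 <= F x)%E ->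
  (\int[P]_w F (sample s w, Z j w) =
   \int[P]_w \int[P]_w' F (sample s w, Z j w'))%E.
Proof.
move=> us mF F0.
pose S : {mfun Om >-> n.-tuple E} := mfun_Sub (mem_set (measurable_sample s)).
pose Zj : {mfun Om >-> E} := mfun_Sub (mem_set (mZ j)).
have mSZ : measurable_fun setT (fun w => (sample s w, Z j w)).
  by apply/measurable_fun_pairP; split; [exact: measurable_sample|exact: mZ].
have mFx x : measurable_fun setT (fun z => F (x, z)).
  by apply: measurableT_comp => //; exact: measurable_pair1.
transitivity (\int[pushforward_measure P mSZ]_x F x)%E.
  by rewrite ge0_integral_pushforward.
transitivity (\int[(distribution P S \x distribution P Zj)%E]_x F x)%E.
  apply: eq_measure_integral => A mA _; apply/esym/product_measure_unique => //.
  move=> B C mB mC; exact: sample_indep.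
rewrite fubini_tonelli1// /fubini_F.
under eq_integral do rewrite ge0_integral_distribution//.
rewrite ge0_integral_distribution//; last first.
  by move=> y; apply: integral_ge0 => w _; exact: F0.
have := measurable_fun_fubini_tonelli_F (m2 := distribution P Zj) F mF F0.
rewrite /fubini_F.
by under eq_fun do rewrite ge0_integral_distribution//.
Qed.

Hypothesis idZ : identically_distributed P Z.

Lemma ident_Ex i j (h : E -> R) : measurable_fun setT h -> (forall x, 0 <= h x) ->
  Ex P (h \o Z i) = Ex P (h \o Z j).
Proof.
move=> mh h0; rewrite /Ex /Rintegral; congr fine.
have law k : (\int[P]_w ((h \o Z k) w)%:E =
    \int[pushforward_measure P (mZ k)]_x (h x)%:E)%E.
  rewrite ge0_integral_pushforward//; first exact/measurable_EFinP.
  by move=> y _; rewrite lee_fin.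
rewrite !law; apply: eq_measure_integral => A mA _; exact: idZ.
Qed.

(** The centred variable is at most 2 in absolute value, so [l <= 1/4] keeps the exponent in the
    range of [expR_le_quad]. The linear term has expectation 0 and the quadratic one is at most
    [2 * l ^+ 2 * 4]. *)
Lemma mgf_le (h : E -> R) (l : R) i : measurable_fun setT h ->
  (forall x, `|h x| <= 1) -> 0 <= l <= 4^-1 ->
  Ex P (fun w => expR (l * (h (Z i w) - Ex P (h \o Z i)))) <= expR (8 * l ^+ 2).
Proof.
move=> mh h1 /andP[l0 l4].
have mhZ : measurable_fun setT (h \o Z i) by exact: measurableT_comp.
have bh : ae_bounded P (h \o Z i) by apply: (@bounded_ae _ _ _ _ 1) => // x; exact: h1.
set m := Ex P (h \o Z i).
have m1 : `|m| <= 1.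
  apply: (le_trans (Ex_norm bh)); rewrite -[leRHS](Ex_cst P).
  apply: Ex_le; [exact: ae_bounded_norm|exact: ae_bounded_cst|].
  by apply: aeW => x; exact: h1.
have hm x : `|l * (h x - m)| <= 2^-1.
  rewrite normrM (ger0_norm l0) (_ : 2^-1 = 4^-1 * 2); last by lra.
  apply: ler_pM => //; apply: (le_trans (ler_normB _ _)).
  by have := h1 x; lra.
have bd : ae_bounded P (fun w => l * (h (Z i w) - m)).
  apply: ae_boundedZ; apply: ae_boundedB => //; exact: ae_bounded_cst.
apply: (@le_trans _ _ (Ex P (fun w => 1 + l * (h (Z i w) - m) + 8 * l ^+ 2))).
  apply: Ex_le.
  - apply: (@bounded_ae _ _ _ _ (expR 2^-1)).
      by apply: measurableT_comp => //; case: bd.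
    move=> x; rewrite ger0_norm ?expR_ge0// ler_expR.
    exact: le_trans (ler_norm _) (hm _).
  - by apply: ae_boundedD; [apply: ae_boundedD|]; [exact: ae_bounded_cst| |exact: ae_bounded_cst].
  - apply: aeW => w; apply: (le_trans (expR_le_quad _)).
      exact: le_trans (ler_norm _) (hm _).
    rewrite lerD2l exprMn -mulrCA.
    have : (h (Z i w) - m) ^+ 2 <= 4.
      rewrite -real_normK ?num_real// (_ : 4 = 2 ^+ 2); last by ring.
      rewrite ler_sqr ?nnegrE//.
      apply: (le_trans (ler_normB _ _)); have := h1 (Z i w); lra.
    have := sqr_ge0 l; nra.
rewrite ExD; [|by apply: ae_boundedD => //; exact: ae_bounded_cst|exact: ae_bounded_cst].
rewrite ExD//; last exact: ae_bounded_cst.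
rewrite !Ex_cst ExZ; last by apply: ae_boundedB => //; exact: ae_bounded_cst.
rewrite ExB//; last exact: ae_bounded_cst.
rewrite Ex_cst subrr mulr0 addr0; exact: expR_ge1Dx.
Qed.

(* Exponential Markov inequality, with [l = eps / 16] in [mgf_le]. *)
Lemma sample_deviation n (s : n.-tuple I) i0 (h : E -> R) (eps : R) : uniq s ->
  measurable_fun setT h -> (forall x, `|h x| <= 1) -> 0 <= eps <= 4 ->
  fine (P [set w | n%:R * (Ex P (h \o Z i0) + eps) <=
                   \sum_(i < n) h (tnth (sample s w) i)])
  <= expR (- (n%:R * eps ^+ 2 / 32)).
Proof.
move=> us mh h1 /andP[e0 e4]; set m := Ex P _.
(* The minimiser of [8 * l ^+ 2 - l * eps], whose minimum is [- eps ^+ 2 / 32]; [eps <= 4] ensures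
   [l <= 1/4]. *)
pose l := eps / 16.
pose G k (x : k.-tuple E) := expR (l * \sum_(i < k) (h (tnth x i) - m)).
have mG k : measurable_fun setT (@G k).
  apply: measurableT_comp => //; apply: measurable_funM => //.
  apply: measurable_sum => i; apply: measurable_funB => //.
  by apply: measurableT_comp => //; exact: measurable_tnth.
have hbd (x : E) : `|h x - m| <= 1 + `|m|.
  by apply: (le_trans (ler_normB _ _)); rewrite lerD2r.
have bG k (t : k.-tuple I) : ae_bounded P (fun w => G k (sample t w)).
  apply: (@bounded_ae _ _ _ _ (expR (l * \sum_(i < k) (1 + `|m|)))).
    exact: (measurableT_comp (mG k) (measurable_sample t)).
  move=> w; rewrite ger0_norm ?expR_ge0// ler_expR ler_wpM2l ?divr_ge0//.
  by apply: ler_sum => i _; exact: le_trans (ler_norm _) (hbd _).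
have mX : measurable_fun setT (fun x => expR (l * (h x - m))).
  by apply: measurableT_comp => //; apply: measurable_funM => //; exact: measurable_funB.
have mEm j : Ex P (h \o Z j) = m.
  (* [ident_Ex] is stated for non-negative functions, hence the shift by 1. *)
  have : Ex P ((fun x => 1 + h x) \o Z j) = Ex P ((fun x => 1 + h x) \o Z i0).
    apply: ident_Ex; first exact: measurable_funD.
    by move=> x; have := h1 x; rewrite ler_norml => /andP[]; lra.
  have bh k : ae_bounded P (h \o Z k).
    by apply: (@bounded_ae _ _ _ _ 1) => [|x]; [exact: measurableT_comp|exact: h1].
  rewrite (ExD (ae_bounded_cst P 1) (bh j)) (ExD (ae_bounded_cst P 1) (bh i0)).
  by move/addrI.
(* Induction on the list of indices: the head is independent of the tail and contributes one
   factor. *)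
have key k (t : k.-tuple I) : uniq t ->
    Ex P (fun w => G k (sample t w)) <= expR (8 * l ^+ 2) ^+ k.
  elim: k t => [|k IH] t ut.
    rewrite expr0 (_ : (fun _ => _) = cst 1) ?Ex_cst//.
    by apply/funext => w; rewrite /G big_ord0 mulr0 expR0.
  have tE : t = [tuple of thead t :: behead t] by exact: tuple_eta.
  set j := thead t in tE; set t' := [tuple of behead t] : k.-tuple I.
  have ut' : uniq (j :: t') by rewrite tE in ut.
  pose F (p : k.-tuple E * E) := (G k p.1 * expR (l * (h p.2 - m)))%:E.
  have -> : Ex P (fun w => G k.+1 (sample t w)) =
      fine (\int[P]_w F (sample t' w, Z j w))%E.
    rewrite /Ex /Rintegral; congr fine; apply: eq_integral => w _; congr EFin.
    have e1 i : tnth (sample t w) (lift ord0 i) = tnth (sample t' w) i.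
      by rewrite !tnth_mktuple {1}tE tnthS.
    have e2 : tnth (sample t w) ord0 = Z j w by rewrite tnth_mktuple.
    rewrite /= /G big_ord_recl e2; under eq_bigr do rewrite e1.
    by rewrite mulrDr expRD mulrC.
  rewrite sample_fubini//; last 2 first.
  - apply/measurable_EFinP; apply: measurable_funM.
      exact: (measurableT_comp (mG k) measurable_fst).
    exact: (measurableT_comp mX measurable_snd).
  - by move=> x; rewrite lee_fin mulr_ge0 ?expR_ge0.
  have bZ : ae_bounded P (fun w => expR (l * (h (Z j w) - m))).
    apply: (@bounded_ae _ _ _ _ (expR (l * (1 + `|m|)))).
      exact: (measurableT_comp mX (mZ j)).
    move=> w; rewrite ger0_norm ?expR_ge0// ler_expR ler_wpM2l ?divr_ge0//.
    exact: le_trans (ler_norm _) (hbd _).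
  have -> : fine (\int[P]_w \int[P]_w' F (sample t' w, Z j w'))%E =
      Ex P (fun w => Ex P (fun w' => expR (l * (h (Z j w') - m))) * G k (sample t' w)).
    rewrite /Ex /Rintegral; congr fine; apply: eq_integral => w _ /=.
    rewrite -[in RHS]mulrC EFinM (EFin_Ex bZ) -integralZl//.
    exact: ae_bounded_integrable.
  rewrite ExZ//.
  rewrite exprS; apply: ler_pM => //.
  - by apply: Ex_ge0 => w; exact: expR_ge0.
  - by apply: Ex_ge0 => w; exact: expR_ge0.
  - rewrite -(mEm j); apply: mgf_le => //; rewrite /l; lra.
  - by apply: IH; move: ut' => /= /andP[].
have mA : measurable [set w | n%:R * (m + eps) <=
    \sum_(i < n) h (tnth (sample s w) i)].
  rewrite -[X in measurable X]setTI; apply: measurable_fun_le => //.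
  apply: measurable_sum => i; apply: measurableT_comp => //.
  exact: (measurableT_comp (measurable_tnth i) (measurable_sample s)).
rewrite -Ex_indic//.
apply: (@le_trans _ _ (Ex P (fun w => expR (- (l * n%:R * eps)) * G n (sample s w)))).
  apply: Ex_le; [exact: ae_bounded_indic|exact: ae_boundedZ|].
  apply: aeW => w; rewrite indicE; case: (boolP (w \in _)) => [|_]; last first.
    by rewrite mulr_ge0// expR_ge0.
  rewrite inE /= => hw; rewrite -expRD -[leLHS]expR0 ler_expR.
  rewrite sumrB sumr_const card_ord -mulr_natl addrC subr_ge0 -mulrA.
  by rewrite ler_wpM2l ?divr_ge0//; lra.
rewrite ExZ//; apply: le_trans (ler_wpM2l (expR_ge0 _) (key _ _ us)) _.
rewrite -expRM_natl -expRD ler_expR /l.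
by rewrite le_eqVlt; apply/orP; left; apply/eqP; field.
Qed.

End Independence.

(** * The SVM dual problem *)

Section Duality.
Context {R : realType}.

(* Linear programming duality for a box with one equality constraint: mass can
   be moved from j to i exactly when [up i] and [down j], so optimality puts
   some [b] between the values [y i * g i] over [up] and those over [down]. *)
Lemma box_lp_duality n (C : R) (g y al : 'I_n -> R) : 0 < C ->
  (forall i, is_label (y i)) ->
  \sum_i al i * y i = 0 -> (forall i, 0 <= al i <= C) ->
  (forall al', \sum_i al' i * y i = 0 -> (forall i, 0 <= al' i <= C) ->
     \sum_i al' i * g i <= \sum_i al i * g i) ->
  exists b, C * (\sum_i Num.max 0 (g i - b * y i)) = \sum_i al i * g i.
Proof.
move=> C0 ylab aly alC alopt.
have yy i : y i * y i = 1 by case: (ylab i) => ->; ring.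
pose up i := if 0 < y i then al i < C else 0 < al i.
pose down i := if 0 < y i then 0 < al i else al i < C.
have exch i j : up i -> down j -> y i * g i <= y j * g j.
  move=> ui dj; have [<-//|ij] := eqVneq i j.
  pose ri := if 0 < y i then C - al i else al i.
  pose rj := if 0 < y j then al j else C - al j.
  have ri0 : 0 < ri by move: ui; rewrite /up /ri; case: ifP; lra.
  have rj0 : 0 < rj by move: dj; rewrite /down /rj; case: ifP; lra.
  (* The largest transfer that stays in the box; it changes the objective by
     [e * (y i * g i - y j * g j)], which optimality makes non-positive. *)
  pose e := Num.min ri rj.
  have e0 : 0 < e by rewrite lt_min ri0.
  have ei : e <= ri by rewrite ge_min lexx.
  have ej : e <= rj by rewrite ge_min lexx orbT.
  pose al' k := al k + (if k == i then e * y i else if k == j then - (e * y j) else 0).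
  have S (c : 'I_n -> R) : \sum_k al' k * c k =
      \sum_k al k * c k + e * (y i * c i) - e * (y j * c j).
    under eq_bigr do rewrite mulrDl; rewrite big_split/= -addrA; congr (_ + _).
    rewrite (bigD1 i)//= eqxx (bigD1 j) 1?eq_sym//= (negPf ij) eqxx.
    rewrite big1 => [|k /andP[/negPf -> /negPf ->]]; last by rewrite mul0r.
    ring.
  have := alopt al'; rewrite !S aly !yy; rewrite add0r subrr => /(_ erefl).
  have al'C k : 0 <= al' k <= C.
    rewrite /al'; case: eqP => [->|_].
      move: ei (alC i) ui; rewrite /ri /up.
      by case: (ylab i) => ->; rewrite ?ltr01 ?ltr0N1 /= => ? /andP[? ?] ?; apply/andP; split; lra.
    case: eqP => [->|_]; last by rewrite addr0.
    move: ej (alC j) dj; rewrite /rj /down.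
    by case: (ylab j) => ->; rewrite ?ltr01 ?ltr0N1 /= => ? /andP[? ?] ?; apply/andP; split; lra.
  by move=> /(_ al'C); rewrite -addrA gerDl -mulrBr pmulr_rle0// subr_le0.
have [b [bu bd]] : exists b, (forall i, up i -> y i * g i <= b) /\
    (forall i, down i -> b <= y i * g i).
  case: (pickP up) => [i0 ui0|nup].
    case: (@arg_maxP _ _ _ i0 up (fun i => y i * g i) ui0) => i ui imax.
    by exists (y i * g i); split => j; [exact: imax|exact: exch].
  case: (pickP down) => [i0 di0|ndown].
    case: (@arg_minP _ _ _ i0 down (fun i => y i * g i) di0) => i di imin.
    by exists (y i * g i); split => j; [rewrite nup|exact: imin].
  by exists 0; split => j; [rewrite nup|rewrite ndown].
exists b.
(* Complementary slackness, one coordinate at a time; in the sum over [i] the term in [b] disappears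
   by the equality constraint. *)
suff E i : C * Num.max 0 (g i - b * y i) = al i * g i - b * (al i * y i).
  rewrite mulr_sumr (eq_bigr _ (fun i _ => E i)) sumrB -mulr_sumr aly; ring.
have := bu i; have := bd i; rewrite /up /down.
have := alC i; case: (ylab i) => ->; rewrite ?ltr01 ?ltr0N1 /= => /andP[a0 aC] d u.
  have -> : g i - b * -1 = g i + b by ring.
  have [ai|ai] := ltrP 0 (al i); have [bi|bi] := ltrP (al i) C.
  - have -> : g i + b = 0 by move: (d bi) (u ai); lra.
    by rewrite maxxx; nra.
  - have -> : al i = C by lra.
    by rewrite max_r; [ring|move: (u ai); lra].
  - have -> : al i = 0 by lra.
    by rewrite max_l; [ring|move: (d bi); lra].
  - lra.
have [ai|ai] := ltrP 0 (al i); have [bi|bi] := ltrP (al i) C.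
- have -> : g i - b * 1 = 0 by move: (d ai) (u bi); lra.
  by rewrite maxxx; move: (d ai) (u bi); rewrite !mul1r mulr0; nra.
- have -> : al i = C by lra.
  by rewrite max_r; [ring|move: (d ai); lra].
- have -> : al i = 0 by lra.
  by rewrite max_l; [ring|move: (u bi); lra].
- lra.
Qed.

(** First-order condition at the end of a segment: after division by [t], let [t] tend to 0. The
    contradiction uses a [t] with [t * (|b| + 1) <= a / 2]. *)
Lemma linear_le0_of_quadratic (a b : R) :
  (forall t, 0 < t <= 1 -> t * a <= t ^+ 2 * b) -> a <= 0.
Proof.
move=> h; rewrite leNgt; apply/negP => a0.
pose t := Num.min 1 (a / (2 * (`|b| + 1))).
have b1 : 0 < 2 * (`|b| + 1) by rewrite mulr_gt0// ltr_wpDl.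
have t0 : 0 < t by rewrite lt_min ltr01 divr_gt0.
have t1 : t <= 1 by rewrite ge_min lexx.
have ta : t * (2 * (`|b| + 1)) <= a.
  by rewrite -ler_pdivlMr// ge_min lexx orbT.
have := h t; rewrite t0 t1 => /(_ isT).
rewrite expr2 -mulrA ler_pM2l// => tb.
have bb : t * b <= t * `|b| by rewrite ler_pM2l// ler_norm.
have : t * (`|b| + 1) <= a / 2 by lra.
nra.
Qed.

Context (n : nat) (G : n.-tuple (n.-tuple R)) (y : n.-tuple R).
Local Notation g i j := (tnth (tnth G i) j).

Definition svm_value (alpha : n.-tuple R) (l : 'I_n) : R :=
  2 * \sum_(i < n) tnth alpha i * tnth y i * g i l.

(** [1 - y_i * svm_value alpha i] is a partial derivative of the dual objective, the factor 2 in
    [svm_value] coming from the quadratic form. A maximiser over a convex set also maximises the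
    linearisation at that point, and this linear problem is the one [box_lp_duality] handles. *)
Lemma svm_dual_linearised (C : R) alpha :
  (forall i j, g i j = g j i) ->
  svm_dual_solution C G y alpha ->
  forall alpha' : 'I_n -> R, \sum_i alpha' i * tnth y i = 0 ->
    (forall i, 0 <= alpha' i <= C) ->
  \sum_i alpha' i * (1 - tnth y i * svm_value alpha i) <=
  \sum_i tnth alpha i * (1 - tnth y i * svm_value alpha i).
Proof.
move=> Gs [[ay aC] aopt] a' a'y a'C.
rewrite -subr_le0 -sumrB.
pose dl i := a' i - tnth alpha i.
pose Q := \sum_(i < n) \sum_(j < n) dl i * dl j * tnth y i * tnth y j * g i j.
apply: (@linear_le0_of_quadratic _ Q) => t /andP[t0 t1].
have := aopt [tuple tnth alpha i + t * dl i | i < n].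
have ft : svm_feasible C y [tuple tnth alpha i + t * dl i | i < n].
  split; last first.
    move=> i; rewrite tnth_mktuple /dl.
    by move: (aC i) (a'C i) => /andP[? ?] /andP[? ?]; nra.
  under eq_bigr do rewrite tnth_mktuple mulrDl -mulrA mulrBl.
  by rewrite big_split/= ay -mulr_sumr sumrB a'y ay; ring.
move=> /(_ ft); rewrite /svm_dual.
under eq_bigr do rewrite tnth_mktuple.
under [X in _ - X <= _]eq_bigr do under eq_bigr do rewrite !tnth_mktuple.
pose B (u v : 'I_n -> R) :=
  \sum_(i < n) \sum_(j < n) u i * v j * tnth y i * tnth y j * g i j.
have -> : \sum_(i < n) \sum_(j < n) (tnth alpha i + t * dl i) *
   (tnth alpha j + t * dl j) * tnth y i * tnth y j * g i j =
   B (tnth alpha) (tnth alpha) + t * (2 * B (tnth alpha) dl) + t ^+ 2 * Q.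
  have -> : 2 * B (tnth alpha) dl = B (tnth alpha) dl + B dl (tnth alpha).
    rewrite mulr_natl mulr2n; congr (_ + _); rewrite /B exchange_big/=.
    by apply: eq_bigr => i _; apply: eq_bigr => j _; rewrite Gs; ring.
  rewrite /B /Q mulrDr !mulr_sumr -!big_split/=; apply: eq_bigr => i _.
  rewrite !mulr_sumr -!big_split/=; apply: eq_bigr => j _; ring.
rewrite big_split/= -mulr_sumr.
have -> : \sum_(i < n) (a' i * (1 - tnth y i * svm_value alpha i) -
      tnth alpha i * (1 - tnth y i * svm_value alpha i)) =
    \sum_i dl i - 2 * B (tnth alpha) dl.
  rewrite /B exchange_big/= mulr_sumr -sumrB; apply: eq_bigr => i _.
  rewrite /svm_value -/(dl i) -mulrBl -/(dl i).
  rewrite mulrBr mulr1; congr (_ - _).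
  by rewrite !mulr_sumr; apply: eq_bigr => j _; ring.
rewrite /B => h; lra.
Qed.

(* [N] and [F l] stand for the squared norm of a competitor in the reproducing
   kernel space and its values; the two last hypotheses are the positivity of
   the kernel, the second one saying [0 <= |w - f|^2]. *)
Lemma svm_primal_optimal (C : R) alpha b (F : 'I_n -> R) (N : R) : 0 < C ->
  (forall i, is_label (tnth y i)) -> (forall i j, g i j = g j i) ->
  svm_dual_solution C G y alpha -> svm_bias G y alpha b ->
  let a i := tnth alpha i * tnth y i in
  let q := \sum_i \sum_j a i * a j * g i j in
  0 <= q -> 0 <= N - 4 * (\sum_i a i * F i) + 4 * q ->
  C * \sum_(l < n) Num.max 0 (1 - tnth y l * (svm_value alpha l + b)) <=
  N / 4 + C * \sum_(l < n) Num.max 0 (1 - tnth y l * F l).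
Proof.
move=> C0 ylab Gs sol bias a q q0 qN.
have [[ay aC] _] := sol.
have [b0 b0E] := box_lp_duality C0 ylab ay aC (svm_dual_linearised Gs sol).
have qE : \sum_i tnth alpha i * (1 - tnth y i * svm_value alpha i) =
    \sum_i tnth alpha i - 2 * q.
  rewrite /q exchange_big/= mulr_sumr -sumrB; apply: eq_bigr => i _.
  rewrite mulrBr mulr1; congr (_ - _).
  by rewrite /svm_value /a !mulr_sumr; apply: eq_bigr => j _; ring.
(* The chosen intercept is compared with the multiplier [b0], for which duality is an equality. *)
have h1 : C * \sum_(l < n) Num.max 0 (1 - tnth y l * (svm_value alpha l + b)) <=
    \sum_i tnth alpha i - 2 * q.
  rewrite -qE -b0E ler_pM2l//; apply: (le_trans (bias b0)).
  rewrite /svm_hinge le_eqVlt; apply/orP; left; apply/eqP.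
  apply: eq_bigr => l _; congr Num.max; rewrite /svm_value; ring.
(* Weak duality: [0 <= alpha i <= C] gives [alpha i * z <= C * max(0, z)]. Combined with [h1] and
   the positivity of [|w - f|^2], this leaves a term [- q], which is dropped. *)
have h2 : \sum_i tnth alpha i - \sum_i a i * F i <=
    C * \sum_(l < n) Num.max 0 (1 - tnth y l * F l).
  rewrite -sumrB mulr_sumr; apply: ler_sum => i _.
  have := aC i; rewrite /a; move: (tnth alpha i) (tnth y i) => u v.
  case: (lerP 0 (1 - v * F i)) => [h|h] /andP[u0 uC].
    by have := ler_wpM2r h uC; lra.
  by have := ler_wpM2l u0 (ltW h); lra.
lra.
Qed.

End Duality.

Lemma cvg_norm_le (R : realType) (u : nat -> R) (l M : R) :
  u n @[n --> \oo] --> l -> (forall n, `|u n| <= M) -> `|l| <= M.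
Proof.
move=> /cvg_norm ul uM; rewrite -(cvg_lim _ ul)//; apply: limr_le.
  by apply/cvg_ex; exists `|l|.
exact: nearW.
Qed.

Lemma measurable_lt_cst d (T : measurableType d) (R : realType) (f : T -> R) c :
  measurable_fun setT f -> measurable [set x | f x < c].
Proof.
move=> mf; rewrite -[X in measurable X]setTI.
exact: (measurable_fun_ltr mf (measurable_cst c) measurableT (Y := [set true])).
Qed.

(** * Universality of the Gaussian kernel *)

Section Universality.
Context d (T : measurableType d) (R : realType) (P : probability T R).
Context (dd : nat) (v : 'I_dd -> T -> R) (gamma B : R).
Hypothesis mv : forall k, measurable_fun setT (v k).
Hypothesis gamma0 : 0 < gamma.
Hypothesis B0 : 0 <= B.

Definition in_box (x : T) : Prop := forall k, `|v k x| <= B.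

Hypothesis ae_box : {ae P, forall x, in_box x}.

Definition gauss_comb (l : seq (R * ('I_dd -> R))) (u : 'I_dd -> R) : R :=
  \sum_(p <- l) p.1 * expR (- gamma * \sum_k (p.2 k - u k) ^+ 2).

Definition gcomb l (x : T) := gauss_comb l (v ^~ x).

Definition box_bounded (g : T -> R) := exists M : R, forall x, in_box x -> `|g x| <= M.

(** Approximation in L^1 of the law, and not uniform, so that the class is closed under bounded
    pointwise limits and can reach discontinuous functions. L^1 is enough because the hinge loss is
    1-Lipschitz. *)
Definition approx (g : T -> R) := [/\ measurable_fun setT g, box_bounded g &
  forall e, 0 < e -> exists l, Ex P (fun x => `|g x - gcomb l x|) <= e].

Lemma box_ae_bounded g : measurable_fun setT g -> box_bounded g -> ae_bounded P g.
Proof.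
by move=> mg [M gM]; split=> //; exists M; apply: filterS ae_box => x; exact: gM.
Qed.

Lemma measurable_gcomb l : measurable_fun setT (gcomb l).
Proof.
apply: measurable_sum => p; apply: measurable_funM => //.
apply: measurableT_comp => //; apply: measurable_funM => //.
apply: measurable_sum => k; apply: measurable_funX.
exact: measurable_funB.
Qed.

Lemma gcomb_bounded l x : `|gcomb l x| <= \sum_(p <- l) `|p.1|.
Proof.
apply: (le_trans (ler_norm_sum _ _ _)); apply: ler_sum => p _.
rewrite normrM (ger0_norm (expR_ge0 _)) ler_piMr// -[leRHS]expR0 ler_expR.
rewrite mulNr oppr_le0 mulr_ge0 ?(ltW gamma0)//.
by apply: sumr_ge0 => k _; exact: sqr_ge0.
Qed.

Lemma gcomb_ae_bounded l : ae_bounded P (gcomb l).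
Proof. exact: bounded_ae (measurable_gcomb l) (gcomb_bounded l). Qed.

Lemma approx_gcomb l : approx (gcomb l).
Proof.
split; [exact: measurable_gcomb| |].
  by exists (\sum_(p <- l) `|p.1|) => x _; exact: gcomb_bounded.
move=> e e0; exists l; under eq_fun do rewrite subrr normr0.
by rewrite Ex_cst ltW.
Qed.

Lemma approx_ae_bounded g : approx g -> ae_bounded P g.
Proof. by case=> mg bg _; exact: box_ae_bounded. Qed.

Lemma Ex_norm_triangle f g h : ae_bounded P f -> ae_bounded P g -> ae_bounded P h ->
  Ex P (fun x => `|f x - h x|) <=
  Ex P (fun x => `|f x - g x|) + Ex P (fun x => `|g x - h x|).
Proof.
move=> bf bg bh.
have [b1 b2 b3] : [/\ ae_bounded P (fun x => `|f x - h x|),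
    ae_bounded P (fun x => `|f x - g x|) & ae_bounded P (fun x => `|g x - h x|)].
  by split; apply: ae_bounded_norm; exact: ae_boundedB.
rewrite -ExD//; apply: Ex_le => //; first exact: ae_boundedD.
by apply: aeW => x; exact: ler_distD.
Qed.

Lemma approxD g h : approx g -> approx h -> approx (fun x => g x + h x).
Proof.
move=> ag ah; have [mg [M gM] ge] := ag; have [mh [N hN] he] := ah.
split; first exact: measurable_funD.
  exists (M + N) => x bx; apply: (le_trans (ler_normD _ _)).
  by apply: lerD; [exact: gM|exact: hN].
move=> e e0; have e2 : 0 < e / 2 by lra.
have [l le] := ge _ e2; have [l' le'] := he _ e2; exists (l ++ l').
have bg := approx_ae_bounded ag; have bh := approx_ae_bounded ah.
have b1 := ae_bounded_norm (ae_boundedB bg (gcomb_ae_bounded l)).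
have b2 := ae_bounded_norm (ae_boundedB bh (gcomb_ae_bounded l')).
apply: (@le_trans _ _ (Ex P (fun x => `|g x - gcomb l x| + `|h x - gcomb l' x|))).
  apply: Ex_le; last 1 first.
  - apply: aeW => x; rewrite /gcomb /gauss_comb big_cat/= opprD addrACA.
    exact: ler_normD.
  - apply: ae_bounded_norm; apply: ae_boundedB; last exact: gcomb_ae_bounded.
    exact: ae_boundedD.
  - exact: ae_boundedD.
by rewrite ExD//; lra.
Qed.

Lemma approx_lim (g_ : nat -> T -> R) (g : T -> R) (M : R) :
  (forall n, approx (g_ n)) -> measurable_fun setT g ->
  (forall n x, in_box x -> `|g_ n x| <= M) ->
  (forall x, in_box x -> g_ n x @[n --> \oo] --> g x) -> approx g.
Proof.
move=> ag mg gM gl; split=> //.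
  exists M => x bx.
  by apply: cvg_norm_le (gl x bx) _ => n; exact: gM.
move=> e e0; have e2 : 0 < e / 2 by lra.
have : Ex P (fun x => `|g_ n x - g x|) @[n --> \oo] --> (0:R).
  apply: (@Ex_dominated _ _ _ _ _ _ M) => //; first by move=> n; case: (ag n).
  by apply: filterS ae_box => x bx; split; [exact: gl|move=> n; exact: gM].
move=> /cvgrPdist_le /(_ _ e2) [n _ /(_ n (leqnn n))]; rewrite sub0r normrN => hn.
have [_ _ /(_ _ e2) [l hl]] := ag n; exists l.
have bg : ae_bounded P g.
  split=> //; exists M; apply: filterS ae_box => x bx.
  by apply: cvg_norm_le (gl x bx) _ => k; exact: gM.
apply: (le_trans (Ex_norm_triangle bg (approx_ae_bounded (ag n)) (gcomb_ae_bounded l))).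
under [X in Ex P X + _]eq_fun do rewrite distrC.
by have := ler_norm (Ex P (fun x => `|g_ n x - g x|)); lra.
Qed.

(** The product of two Gaussians of parameter [gamma] has parameter [2 * gamma], so Gaussian
    combinations are not an algebra. The functions that multiply [approx] into itself do form one,
    closed under bounded limits; it is enlarged step by step from exponentials to indicators. *)
Definition multiplier (phi : T -> R) :=
  measurable_fun setT phi /\ forall g, approx g -> approx (fun x => phi x * g x).

Lemma multiplier_cst c : multiplier (cst c).
Proof.
split=> // g [mg [M gM] ge]; split; first exact: measurable_funM.
  by exists (`|c| * M) => x bx; rewrite normrM ler_wpM2l// gM.
move=> e e0; have c1 : 0 < `|c| + 1 by rewrite ltr_wpDl.
have [l le] := ge _ (divr_gt0 e0 c1).
exists [seq (c * p.1, p.2) | p <- l].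
have -> : (fun x => `|c * g x - gcomb [seq (c * p.1, p.2) | p <- l] x|) =
    (fun x => `|c| * `|g x - gcomb l x|).
  apply/funext => x; rewrite -normrM mulrBr; congr `|_ - _|.
  rewrite /gcomb /gauss_comb big_map mulr_sumr.
  by apply: eq_bigr => p _; rewrite mulrA.
rewrite ExZ; last first.
  apply: ae_bounded_norm; apply: ae_boundedB; last exact: gcomb_ae_bounded.
  by apply: box_ae_bounded => //; exists M.
apply: (le_trans (ler_wpM2l (normr_ge0 c) le)).
rewrite mulrCA ler_piMr ?(ltW e0)// ler_pdivrMr// mul1r; lra.
Qed.

Lemma multiplierD phi psi : multiplier phi -> multiplier psi ->
  multiplier (fun x => phi x + psi x).
Proof.
move=> [mp hp] [mq hq]; split; first exact: measurable_funD.
move=> g ag; under eq_fun do rewrite mulrDl.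
by apply: approxD; [exact: hp|exact: hq].
Qed.

Lemma multiplierM phi psi : multiplier phi -> multiplier psi ->
  multiplier (fun x => phi x * psi x).
Proof.
move=> [mp hp] [mq hq]; split; first exact: measurable_funM.
by move=> g ag; under eq_fun do rewrite -mulrA; apply: hp; exact: hq.
Qed.

Lemma multiplierB phi psi : multiplier phi -> multiplier psi ->
  multiplier (fun x => phi x - psi x).
Proof.
move=> hp hq; under eq_fun do rewrite -[psi _]mul1r -mulNr.
by apply: multiplierD => //; apply: multiplierM => //; exact: multiplier_cst.
Qed.

Lemma multiplierX phi n : multiplier phi -> multiplier (fun x => phi x ^+ n).
Proof.
move=> hp; elim: n => [|n IH]; first exact: multiplier_cst.
by under eq_fun do rewrite exprS; exact: multiplierM.
Qed.

Lemma multiplier_sum (I : Type) (r : seq I) (phi : I -> T -> R) :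
  (forall i, multiplier (phi i)) -> multiplier (fun x => \sum_(i <- r) phi i x).
Proof.
move=> hp; elim: r => [|i r IH].
  by under eq_fun do rewrite big_nil; exact: multiplier_cst.
by under eq_fun do rewrite big_cons; exact: multiplierD.
Qed.

Lemma multiplier_prod (I : Type) (r : seq I) (phi : I -> T -> R) :
  (forall i, multiplier (phi i)) -> multiplier (fun x => \prod_(i <- r) phi i x).
Proof.
move=> hp; elim: r => [|i r IH].
  by under eq_fun do rewrite big_nil; exact: multiplier_cst.
by under eq_fun do rewrite big_cons; exact: multiplierM.
Qed.

Lemma multiplier_lim (phi_ : nat -> T -> R) (phi : T -> R) (M : R) :
  (forall n, multiplier (phi_ n)) -> measurable_fun setT phi ->
  (forall n x, in_box x -> `|phi_ n x| <= M) ->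
  (forall x, in_box x -> phi_ n x @[n --> \oo] --> phi x) -> multiplier phi.
Proof.
move=> hp mp pM pl; split=> // g ag; have [mg [N gN] _] := ag.
apply: (@approx_lim (fun n x => phi_ n x * g x) _ (M * N)).
- by move=> n; apply: (hp n).2.
- exact: measurable_funM.
- by move=> n x bx; rewrite normrM; apply: ler_pM => //; [exact: pM|exact: gN].
- by move=> x bx; apply: cvgM; [exact: pl|exact: cvg_cst].
Qed.

(* Multiplying a Gaussian by an exponential moves its centre. *)
Lemma multiplier_expR k (s : R) : multiplier (fun x => expR (s * v k x)).
Proof.
have ms : measurable_fun setT (fun x => expR (s * v k x)).
  by apply: measurableT_comp => //; exact: measurable_funM.
have be x : in_box x -> `|expR (s * v k x)| <= expR (`|s| * B).
  move=> bx; rewrite ger0_norm ?expR_ge0// ler_expR.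
  by apply: (le_trans (ler_norm _)); rewrite normrM ler_wpM2l.
split=> // g [mg [M gM] ge]; split; first exact: measurable_funM.
  by exists (expR (`|s| * B) * M) => x bx; rewrite normrM ler_pM ?be ?gM.
move=> e e0.
have [l le] := ge _ (divr_gt0 e0 (expR_gt0 (`|s| * B))).
(* Completing the square in coordinate [k]: the centre moves by [s / (2 * gamma)] and the weight
   absorbs the remaining constant. *)
pose sh (p : R * ('I_dd -> R)) : R * ('I_dd -> R) :=
  (p.1 * expR (s * p.2 k + s ^+ 2 / (4 * gamma)),
   fun j => p.2 j + (if j == k then s / (2 * gamma) else 0)).
exists [seq sh p | p <- l].
have bgl : ae_bounded P (fun x => g x - gcomb l x).
  apply: ae_boundedB; last exact: gcomb_ae_bounded.
  by apply: box_ae_bounded => //; exists M.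
have -> : (fun x => `|expR (s * v k x) * g x - gcomb [seq sh p | p <- l] x|) =
    (fun x => `|expR (s * v k x) * (g x - gcomb l x)|).
  apply/funext => x; rewrite mulrBr; congr `|_ - _|.
  rewrite /gcomb /gauss_comb big_map mulr_sumr; apply: eq_bigr => p _.
  rewrite /sh/= [RHS]mulrCA -[LHS]mulrA; congr (_ * _); rewrite -!expRD; congr expR.
  rewrite (bigD1 k)//= eqxx (bigD1 k (P := xpredT))//=.
  rewrite (eq_bigr (fun j => (p.2 j - v j x) ^+ 2)); last first.
    by move=> j /negPf ->; rewrite addr0.
  by field; rewrite gt_eqF.
have bev : ae_bounded P (fun x => expR (s * v k x)).
  by apply: box_ae_bounded => //; exists (expR (`|s| * B)).
apply: (@le_trans _ _ (Ex P (fun x => expR (`|s| * B) * `|g x - gcomb l x|))).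
  apply: Ex_le.
  - by apply: ae_bounded_norm; exact: ae_boundedM.
  - by apply: ae_boundedZ; exact: ae_bounded_norm.
  - by apply: filterS ae_box => x bx; rewrite normrM ler_wpM2r// be.
rewrite ExZ; last exact: ae_bounded_norm.
by rewrite mulrC -ler_pdivlMr ?expR_gt0.
Qed.

(** A coordinate is the derivative at [s = 0] of [expR (s * v k x)], hence a uniform limit on the
    box of difference quotients of step [1 / q n]. Starting from [q n >= 2 * B + 1] keeps the
    exponent below 1/2, as [expR_le_quad] requires. *)
Lemma multiplier_coord k : multiplier (v k).
Proof.
have [N NB] : exists N : nat, 2 * B + 1 <= N%:R.
  have h : 0 <= 2 * B + 1 by have := B0; lra.
  by exists (Num.bound (2 * B + 1)); apply/ltW/archi_boundP.
pose q n : R := (n + N)%:R.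
have qN n : 2 * B + 1 <= q n by apply: (le_trans NB); rewrite ler_nat leq_addl.
have q0 n : 0 < q n by have := qN n; have := B0; lra.
have est n x : in_box x -> `|q n * (expR ((q n)^-1 * v k x) - 1) - v k x| <= 2 * B ^+ 2 / q n.
  move=> /(_ k) bx; set y := (q n)^-1 * v k x.
  have vy : v k x = q n * y by rewrite /y mulrA mulfV ?gt_eqF// mul1r.
  have yh : y <= 2^-1.
    rewrite /y mulrC ler_pdivrMr//; have := qN n.
    by move: bx; rewrite ler_norml => /andP[_]; lra.
  have h1 := expR_ge1Dx y; have h2 := expR_le_quad yh.
  have qy : q n * y ^+ 2 <= B ^+ 2 / q n.
    rewrite ler_pdivlMr// mulrAC -expr2 -exprMn -vy -real_normK ?num_real//.
    by rewrite ler_sqr ?nnegrE.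
  rewrite vy -mulrBr normrM (gtr0_norm (q0 n)) ger0_norm; last by lra.
  apply: (@le_trans _ _ (q n * (2 * y ^+ 2))).
    by rewrite ler_pM2l//; lra.
  by rewrite mulrCA -mulrA ler_pM2l.
apply: (@multiplier_lim (fun n x => q n * (expR ((q n)^-1 * v k x) - 1)) _ (B + 2 * B ^+ 2)).
- move=> n; apply: multiplierM; first exact: multiplier_cst.
  by apply: multiplierB; [exact: multiplier_expR|exact: multiplier_cst].
- exact: mv.
- move=> n x bx; have := est n x bx; have := bx k.
  have q1 : 1 <= q n by have := qN n; have := B0; lra.
  have : 2 * B ^+ 2 / q n <= 2 * B ^+ 2.
    by rewrite ler_pdivrMr// ler_peMr// mulr_ge0// sqr_ge0.
  set a := q n * _; have := ler_normD (a - v k x) (v k x); rewrite subrK; lra.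
- move=> x bx; apply/cvgrPdist_le => e e0.
  near=> n; rewrite distrC; apply: (le_trans (est n x bx)).
  rewrite ler_pdivrMr// [leRHS]mulrC -ler_pdivrMr// /q natrD.
  apply: (@le_trans _ _ n%:R); last by rewrite lerDl.
  near: n; exact: nbhs_infty_ger.
Unshelve. all: by end_near. Qed.

(** The inverse of the Gaussian centred at 0, as a limit of partial sums of the exponential series.
    It cancels that Gaussian, which makes constants approximable; every multiplier is then
    approximable itself. *)
Lemma multiplier_gauss_inv :
  multiplier (fun x => expR (gamma * \sum_k v k x ^+ 2)).
Proof.
pose S x := gamma * \sum_k v k x ^+ 2.
have mS : multiplier S.
  apply: multiplierM; first exact: multiplier_cst.
  by apply: multiplier_sum => k; apply: multiplierX; exact: multiplier_coord.
have S0 x : 0 <= S x.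
  by rewrite mulr_ge0 ?(ltW gamma0)// sumr_ge0// => k _; exact: sqr_ge0.
have SB x : in_box x -> S x <= gamma * \sum_(k < dd) B ^+ 2.
  move=> bx; rewrite ler_pM2l//; apply: ler_sum => k _.
  by rewrite -real_normK ?num_real// ler_sqr ?nnegrE.
apply: (@multiplier_lim (fun n x => series (exp_coeff (S x)) n) _
   (expR (gamma * \sum_(k < dd) B ^+ 2))).
- move=> n; rewrite /series/=; apply: multiplier_sum => i.
  rewrite /exp_coeff; apply: multiplierM; last exact: multiplier_cst.
  exact: multiplierX.
- by apply: measurableT_comp => //; case: mS.
- move=> n x bx; rewrite ger0_norm; last first.
    by apply: sumr_ge0 => i _; apply: exp_coeff_ge0.
  apply: (@le_trans _ _ (expR (S x))); last by rewrite ler_expR SB.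
  rewrite /expR; apply: nondecreasing_cvgn_le; last exact: is_cvg_series_exp_coeff.
  by apply: nondecreasing_series => i _ _; exact: exp_coeff_ge0.
- by move=> x bx; exact: is_cvg_series_exp_coeff.
Qed.

Lemma approx_cst c : approx (cst c).
Proof.
have := approx_gcomb [:: (c, fun=> 0)].
move=> /(multiplier_gauss_inv).2; congr approx; apply/funext => x.
rewrite /gcomb /gauss_comb big_seq1/= mulrCA -expRD.
under [X in - gamma * X]eq_bigr do rewrite sub0r sqrrN.
by rewrite mulNr addrN expR0 mulr1.
Qed.

Lemma bernoulli_upper (y : R) m : 0 <= y <= 1 -> (1 - y) ^+ m * (1 + m%:R * y) <= 1.
Proof.
move=> /andP[y0 y1]; elim: m => [|m IH]; first by rewrite expr0 mul0r addr0 mulr1.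
rewrite exprS -mulrA mulrCA; apply: le_trans IH.
have p : 0 <= (1 - y) ^+ m by apply: exprn_ge0; lra.
rewrite ler_wpM2l// -natr1.
have := ler0n R m; nra.
Qed.

Lemma bernoulli_lower (y : R) m : 0 <= y <= 1 -> 1 - m%:R * y <= (1 - y) ^+ m.
Proof.
move=> /andP[y0 y1]; elim: m => [|m IH]; first by rewrite expr0 mul0r subr0.
rewrite exprS -natr1.
have y1' : 0 <= 1 - y by lra.
have := ler_wpM2l y1' IH; have := ler0n R m; nra.
Qed.

(* [(1 - x^n)^(n 2^n)] tends to [1] when [0 <= x < 1/2] and to [0] when [1/2 <= x <= 1]. *)
Lemma cvg_step_poly (x : R) : 0 <= x <= 1 ->
  (1 - x ^+ n) ^+ (n * 2 ^ n) @[n --> \oo] --> (if x < 2^-1 then 1 else 0 : R).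
Proof.
move=> /andP[x0 x1].
have xn n : 0 <= x ^+ n <= 1 by rewrite exprn_ge0//= exprn_ile1.
have mE n : (n * 2 ^ n)%:R * x ^+ n = n%:R * (2 * x) ^+ n.
  by rewrite natrM natrX exprMn mulrA.
case: ltP => hx; last first.
  apply: (@squeeze_cvgr _ _ _ _ (cst 0) (fun n => n.+1%:R^-1)).
  - apply: nearW => n; apply/andP; split.
      by apply: exprn_ge0; have /andP[] := xn n; lra.
    rewrite -[leRHS]mul1r ler_pdivlMr//.
    apply: le_trans (bernoulli_upper (n * 2 ^ n) (xn n)).
    rewrite ler_wpM2l//; first by apply: exprn_ge0; have /andP[] := xn n; lra.
    rewrite mE -natr1 addrC lerD2l ler_peMr// exprn_ege1//; lra.
  - exact: cvg_cst.
  - exact: cvg_harmonic.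
have h0 : (fun n => n%:R * (2 * x) ^+ n) @ \oo --> (0:R).
  have y0 : 0 <= 2 * x by lra.
  (* [(2 * x) ^+ n] splits into two factors [z ^+ n]: one absorbs [n], by [bernoulli_upper] at
     [1 - z], and the other tends to 0. *)
  pose z := Num.sqrt (2 * x).
  have zz : z ^+ 2 = 2 * x by rewrite sqr_sqrtr.
  have z0 : 0 <= z by exact: sqrtr_ge0.
  have z1 : z < 1 by rewrite -(@ltr_pXn2r _ 2)// ?nnegrE// zz expr1n; lra.
  have b n : n%:R * (2 * x) ^+ n <= (1 - z)^-1 * z ^+ n.
    rewrite -zz exprAC expr2 mulrA ler_wpM2r ?exprn_ge0//.
    have := @bernoulli_upper (1 - z) n; rewrite opprB addrCA subrr addr0.
    have -> : 0 <= 1 - z <= 1 by apply/andP; split; lra.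
    move=> /(_ isT) bu; rewrite -[leRHS]mul1r ler_pdivlMr; last by lra.
    have := exprn_ge0 n z0; nra.
  apply: (@squeeze_cvgr _ _ _ _ (cst 0) (fun n => (1 - z)^-1 * z ^+ n)).
  - by apply: nearW => n; rewrite b andbT mulr_ge0// exprn_ge0.
  - exact: cvg_cst.
  - rewrite -[X in _ --> X](mulr0 (1 - z)^-1); apply: cvgM; first exact: cvg_cst.
    by apply: cvg_expr; rewrite ger0_norm.
apply: (@squeeze_cvgr _ _ _ _ (fun n => 1 - n%:R * (2 * x) ^+ n) (cst 1)).
- apply: nearW => n; apply/andP; split.
    by rewrite -mE; apply: bernoulli_lower.
  by apply: exprn_ile1; have /andP[] := xn n; lra.
- by rewrite -[X in _ --> X]subr0; apply: cvgB => //; exact: cvg_cst.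
- exact: cvg_cst.
Qed.

(** An affine change of variable sends the box into [0,1] and the threshold [c] to 1/2, where the
    polynomials of [cvg_step_poly] converge to a step. *)
Lemma multiplier_halfspace k c : multiplier (\1_[set x | v k x < c]).
Proof.
pose K := B + `|c| + 1.
have K0 : 0 < K by rewrite /K ltr_wpDl// addr_ge0.
pose X x := 2^-1 + (2 * K)^-1 * (v k x - c).
have mX : multiplier X.
  apply: multiplierD; first exact: multiplier_cst.
  apply: multiplierM; first exact: multiplier_cst.
  by apply: multiplierB; [exact: multiplier_coord|exact: multiplier_cst].
have X01 x : in_box x -> 0 <= X x <= 1.
  move=> /(_ k) bx; have : `|(2 * K)^-1 * (v k x - c)| <= 2^-1.
    rewrite normrM gtr0_norm ?invr_gt0 ?mulr_gt0// mulrC ler_pdivrMr ?mulr_gt0//.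
    apply: (le_trans (ler_normB _ _)); rewrite /K; lra.
  by rewrite ler_norml /X => /andP[? ?]; apply/andP; split; lra.
have XE x : (X x < 2^-1) = (v k x < c).
  by rewrite /X gtrDl pmulr_rlt0 ?invr_gt0 ?mulr_gt0// subr_lt0.
apply: (@multiplier_lim (fun n x => (1 - X x ^+ n) ^+ (n * 2 ^ n)) _ 1).
- move=> n; apply: multiplierX; apply: multiplierB; first exact: multiplier_cst.
  exact: multiplierX.
- apply: measurable_indic; exact: measurable_lt_cst.
- move=> n x /X01/andP[x0 x1].
  have /andP[p0 p1] : 0 <= X x ^+ n <= 1 by rewrite exprn_ge0//= exprn_ile1.
  rewrite ger0_norm; last by apply: exprn_ge0; lra.
  by apply: exprn_ile1; lra.
- move=> x bx; have := cvg_step_poly (X01 _ bx).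
  rewrite XE indicE; case: (ltP (v k x) c) => h; first by rewrite mem_set.
  by rewrite memNset//= => ?; lra.
Qed.

Definition coord_halfspaces : set (set T) :=
  [set A | exists k c, A = [set x | v k x < c]].

(** The sets whose indicator is a multiplier form a sigma-algebra: a countable union is the limit of
    [1 - \prod (1 - \1_(A i))], and stability under products spares any disjointness or monotone
    class argument. *)
Lemma multiplier_indic A : <<s coord_halfspaces >> A ->
  measurable A /\ multiplier (\1_A).
Proof.
apply: (@smallest_sub _ _ coord_halfspaces
  [set A | measurable A /\ multiplier (\1_A)]); last first.
  move=> _ [k [c ->]]; split; last exact: multiplier_halfspace.
  exact: measurable_lt_cst.
move=> {A}; split.
- split=> //; rewrite indic0; exact: multiplier_cst.
- move=> A [mA hA]; rewrite setTD; split; first exact: measurableC.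
  rewrite (_ : \1_(~` A) = fun x => 1 - \1_A x); last first.
    apply/funext => x; rewrite !indicE in_setC.
    by case: (_ \in _); rewrite ?subrr ?subr0.
  by apply: multiplierB => //; exact: multiplier_cst.
- move=> A hA; have mU : measurable (\bigcup_k A k).
    by apply: bigcup_measurable => k _; case: (hA k).
  split=> //.
  apply: (@multiplier_lim (fun n x => 1 - \prod_(i < n) (1 - \1_(A i) x)) _ 1).
  + move=> n; apply: multiplierB; first exact: multiplier_cst.
    apply: multiplier_prod => i; apply: multiplierB; first exact: multiplier_cst.
    by case: (hA i).
  + exact: measurable_indic.
  + move=> n x _.
    have /andP[p0 p1] : 0 <= \prod_(i < n) (1 - \1_(A i) x : R) <= 1.
      rewrite prodr_ge0/= ?prodr_ile1// => i _; rewrite indicE; case: (_ \in _); rewrite ?subrr ?subr0 ?lexx ?ler01//.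
    by rewrite ger0_norm; lra.
  + move=> x _; rewrite indicE; case: (boolP (x \in _)) => [|xA].
      rewrite inE => -[n _ Anx]; apply: cvg_near_cst; exists n.+1 => //= m nm.
      rewrite (bigD1 (Ordinal nm))//= indicE mem_set// subrr mul0r subr0//.
    apply: cvg_near_cst; apply: nearW => n; rewrite big1 ?subrr// => i _.
    rewrite indicE memNset ?subr0// => Ax; move: xA; rewrite notin_setE; apply.
    by exists i.
Qed.

Lemma gauss_universal A : <<s coord_halfspaces >> A -> forall e, 0 < e ->
  exists l, Ex P (fun x => `|(2 * \1_A x - 1) - gcomb l x|) <= e.
Proof.
move=> /multiplier_indic[mA hA] e e0.
have [] : approx (fun x => 2 * \1_A x - 1); last by move=> _ _; exact.
have m2 : multiplier (fun x => 2 * \1_A x - 1).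
  apply: multiplierB; last exact: multiplier_cst.
  by apply: multiplierM => //; exact: multiplier_cst.
by have := m2.2 _ (approx_cst 1); under eq_fun do rewrite mulr1.
Qed.

End Universality.

(** * Finite nets for clipped scores *)

Section Clamp.
Context {R : realType}.
Implicit Types x y : R.

Definition clamp (a x : R) : R := Num.max (- a) (Num.min a x).

Lemma clamp_cases a x : 0 <= a ->
  [\/ clamp a x = a /\ a <= x, clamp a x = x /\ - a <= x <= a |
     clamp a x = - a /\ x <= - a].
Proof.
move=> a0; rewrite /clamp; case: (lerP a x) => h.
  by constructor 1; rewrite max_r//; lra.
case: (lerP (- a) x) => h'; first by constructor 2; split=> //; exact: ltW.
by constructor 3; split=> //; exact: ltW.
Qed.

Definition clip x : R := clamp 1 x.

Lemma clip_norm x : `|clip x| <= 1.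
Proof.
rewrite ler_norml /clip.
have [] := @clamp_cases 1 x ler01; move=> [-> ?]; apply/andP; split; lra.
Qed.

Lemma clip_lipschitz x y : `|clip x - clip y| <= `|x - y|.
Proof.
rewrite /clip ler_norml; case: (ler0P (x - y)) => xy;
have [] := @clamp_cases 1 x ler01; move=> [-> ?];
have [] := @clamp_cases 1 y ler01; move=> [-> ?]; apply/andP; split; lra.
Qed.

End Clamp.

(** * Truncation of the Gaussian kernel and rounding of coefficients *)

Section Taylor.
Context {R : realType}.

(** [D! * i! <= (D + i)!], a binomial coefficient being at least 1, so the factor [X ^+ D / D!]
    comes out of the whole tail. *)
Lemma exp_taylor (x X : R) (D : nat) : `|x| <= X ->
  `|expR x - series (exp_coeff x) D| <= exp_coeff X D * expR X.
Proof.
move=> xX; have X0 : 0 <= X by apply: le_trans xX.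
have h N : `|series (exp_coeff x) (D + N)%N - series (exp_coeff x) D| <=
    exp_coeff X D * expR X.
  rewrite /series/= (big_cat_nat _ (leq_addr N D))//= addrAC subrr add0r.
  apply: (le_trans (ler_norm_sum _ _ _)).
  rewrite -{1}[D]add0n big_addn addKn.
  apply: (@le_trans _ _ (\sum_(0 <= i < N) exp_coeff X D * exp_coeff X i)).
    apply: ler_sum => i _; rewrite /exp_coeff normrM normrX.
    rewrite (ger0_norm (x := _^-1)) ?invr_ge0 ?ler0n//.
    have -> : X ^+ D / D`!%:R * (X ^+ i / i`!%:R) = X ^+ (i + D) / (D`!%:R * i`!%:R).
      by rewrite exprD invfM; ring.
    apply: ler_pM => //; rewrite ?exprn_ge0 ?invr_ge0//.
      by apply: lerXn2r; rewrite ?nnegrE.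
    rewrite lef_pV2 ?posrE ?mulr_gt0 ?ltr0n ?fact_gt0// -natrM ler_nat.
    rewrite -(@bin_fact (i + D) D) ?leq_addl// addnK.
    by rewrite leq_pmull// bin_gt0 leq_addl.
  rewrite -mulr_sumr ler_wpM2l//; first exact: exp_coeff_ge0.
  rewrite /expR; apply: nondecreasing_cvgn_le; last exact: is_cvg_series_exp_coeff.
  by apply: nondecreasing_series => i _ _; exact: exp_coeff_ge0.
apply: (@cvg_norm_le _ (fun N => series (exp_coeff x) (N + D)%N - series (exp_coeff x) D)).
  apply: cvgB; last exact: cvg_cst.
  by have := is_cvg_series_exp_coeff x; rewrite -(cvg_shiftn D).
by move=> N; rewrite addnC.
Qed.

(** Telescoping, one factor replaced at a time; each term involves one factor [M] fewer, which
    [1 <= M] restores. *)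
Lemma prod_dist (I : finType) (a b : I -> R) (M r : R) : 1 <= M ->
  (forall i, `|a i| <= M) -> (forall i, `|b i| <= M) ->
  (forall i, `|a i - b i| <= r) ->
  `|\prod_i a i - \prod_i b i| <= #|I|%:R * (M ^+ #|I| * r).
Proof.
move=> M1 aM bM abr.
have E f : \prod_i f i = \prod_(i <- enum I) f i :> R by rewrite big_enum.
rewrite !E cardE.
have Mn n : 0 <= M ^+ n by apply: exprn_ge0; lra.
have bp s : `|\prod_(i <- s) b i| <= M ^+ size s.
  rewrite normr_prod; elim: s => [|i s IH]; first by rewrite big_nil.
  by rewrite big_cons exprS ler_pM ?prodr_ge0.
elim: (enum I) => [|i s IH]; first by rewrite !big_nil subrr normr0 !mul0r.
have r0 : 0 <= r by apply: le_trans (abr i).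
rewrite !big_cons [size _]/= -natr1 exprS.
have -> : a i * \prod_(j <- s) a j - b i * \prod_(j <- s) b j =
    a i * (\prod_(j <- s) a j - \prod_(j <- s) b j) + (a i - b i) * \prod_(j <- s) b j.
  ring.
apply: (le_trans (ler_normD _ _)); rewrite !normrM.
have h1 := ler_pM (normr_ge0 _) (normr_ge0 _) (aM i) IH.
have h2 := ler_pM (normr_ge0 _) (normr_ge0 _) (abr i) (bp s).
apply: (le_trans (lerD h1 h2)).
have := mulr_ge0 r0 (Mn (size s)); set q := M ^+ size s; set z := r * q => z0.
have -> : q * r = z by rewrite /z mulrC.
have : z <= M * z by rewrite ler_peMl.
set k := (size s)%:R : R => zM.
have -> : M * q * r = M * z by rewrite /z; ring.
by rewrite mulrDl mul1r mulrCA lerD2l.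
Qed.

Context (dd : nat) (gamma B : R).
Hypotheses (gamma0 : 0 < gamma) (B1 : 1 <= B).
Implicit Types c u : 'I_dd -> R.

Definition gker c u : R := expR (- gamma * \sum_k (c k - u k) ^+ 2).
Definition box u : Prop := forall k, `|u k| <= B.

(** Bounds every cross term [2 * gamma * c k * u k] on the box. *)
Let X : R := 2 * gamma * B ^+ 2.

(** Dividing by [B] keeps the features in [-1,1] on the box. The scale goes into [feature_weight],
    whose sum stays below [expR X ^+ dd] for every [D]. *)
Definition feature D (kappa : {ffun 'I_dd -> 'I_D}) u : R :=
  expR (- gamma * \sum_k u k ^+ 2) * \prod_k (u k / B) ^+ kappa k.

Definition feature_weight D (kappa : {ffun 'I_dd -> 'I_D}) : R :=
  \prod_k exp_coeff X (kappa k).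

(* The kernel with each factor [expR (2 gamma c_k u_k)] replaced by a Taylor polynomial. *)
Definition tker D c u : R :=
  \sum_(kappa : {ffun 'I_dd -> 'I_D})
    feature_weight kappa * feature kappa c * feature kappa u.

Definition tker_error D : R := dd%:R * (expR X ^+ dd * (exp_coeff X D * expR X)).

Let X0 : 0 <= X.
Proof. by apply: mulr_ge0; [apply: mulr_ge0 => //; exact: ltW|exact: sqr_ge0]. Qed.

Let eX1 : 1 <= expR X.
Proof. by apply: le_trans (expR_ge1Dx _); rewrite lerDl; exact: X0. Qed.

Lemma series_exp_le D (x : R) : 0 <= x -> series (exp_coeff x) D <= expR x.
Proof.
move=> x0.
rewrite /expR; apply: nondecreasing_cvgn_le; last exact: is_cvg_series_exp_coeff.
by apply: nondecreasing_series => i _ _; exact: exp_coeff_ge0.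
Qed.

Lemma tkerE D c u : tker D c u =
  expR (- gamma * \sum_k c k ^+ 2) * expR (- gamma * \sum_k u k ^+ 2) *
  \prod_k series (exp_coeff (2 * gamma * c k * u k)) D.
Proof.
have -> : \prod_k series (exp_coeff (2 * gamma * c k * u k)) D =
    \prod_k \sum_(j < D) exp_coeff (2 * gamma * c k * u k) j.
  by apply: eq_bigr => k _; rewrite /series/= big_mkord.
rewrite bigA_distr_bigA mulr_sumr; apply: eq_bigr => kappa _.
rewrite /feature_weight /feature.
set ec := expR _; set eu := expR _.
have -> : \prod_k exp_coeff X (kappa k) * (ec * \prod_k (c k / B) ^+ kappa k) *
   (eu * \prod_k (u k / B) ^+ kappa k) = ec * eu * (\prod_k exp_coeff X (kappa k) *
   \prod_k (c k / B) ^+ kappa k * \prod_k (u k / B) ^+ kappa k) by ring.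
congr (_ * _); rewrite -!big_split/=; apply: eq_bigr => k _.
have -> : 2 * gamma * c k * u k = X * (c k / B) * (u k / B).
  by rewrite /X; field; rewrite gt_eqF//; have := B1; lra.
have e (p a b : R) j : exp_coeff p j * a ^+ j * b ^+ j = exp_coeff (p * a * b) j.
  rewrite /exp_coeff/= !exprMn.
  by move: (p ^+ _) (a ^+ _) (b ^+ _) (_^-1) => p1 p2 p3 p4; ring.
exact: e.
Qed.

Lemma gker_factor c u : gker c u =
  expR (- gamma * \sum_k c k ^+ 2) * expR (- gamma * \sum_k u k ^+ 2) *
  \prod_k expR (2 * gamma * c k * u k).
Proof.
rewrite /gker -expR_sum -!expRD; congr expR.
rewrite !mulr_sumr -!big_split/=; apply: eq_bigr => k _; ring.
Qed.

Lemma tker_approx D c u : box c -> box u -> `|gker c u - tker D c u| <= tker_error D.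
Proof.
move=> bc bu; rewrite gker_factor tkerE -mulrBr normrM.
have e1 (v : 'I_dd -> R) : 0 <= expR (- gamma * \sum_k v k ^+ 2) <= 1.
  rewrite expR_ge0/= -[leRHS]expR0 ler_expR mulNr oppr_le0 mulr_ge0 ?(ltW gamma0)//.
  by apply: sumr_ge0 => k _; exact: sqr_ge0.
have xX k : `|2 * gamma * c k * u k| <= X.
  rewrite !normrM (ger0_norm (ltW gamma0)) ger0_norm// /X expr2 -!mulrA.
  rewrite ler_pM2l// ler_pM2l//; apply: ler_pM => //.
have /andP[a0 a1] := e1 c; have /andP[b0 b1] := e1 u.
rewrite -[leRHS]mul1r; apply: ler_pM => //.
  by rewrite ger0_norm ?mulr_ge0// mulr_ile1.
have := @prod_dist 'I_dd (fun k => expR (2 * gamma * c k * u k))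
  (fun k => series (exp_coeff (2 * gamma * c k * u k)) D) (expR X)
  (exp_coeff X D * expR X) eX1.
rewrite card_ord; apply.
- move=> k; rewrite ger0_norm ?expR_ge0// ler_expR.
  exact: le_trans (ler_norm _) (xX k).
- move=> k; apply: le_trans (series_exp_le D X0).
  apply: (le_trans (ler_norm_sum _ _ _)); apply: ler_sum => i _.
  rewrite /exp_coeff/= normrM normrX (ger0_norm (x := _^-1)) ?invr_ge0 ?ler0n//.
  by rewrite ler_wpM2r ?invr_ge0// lerXn2r ?nnegrE//; exact: X0.
- by move=> k; exact: exp_taylor.
Qed.

Lemma feature_weight_ge0 D (kappa : {ffun 'I_dd -> 'I_D}) : 0 <= feature_weight kappa.
Proof. by apply: prodr_ge0 => k _; apply: exp_coeff_ge0; exact: X0. Qed.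

Lemma sum_feature_weight D :
  \sum_(kappa : {ffun 'I_dd -> 'I_D}) feature_weight kappa <= expR X ^+ dd.
Proof.
rewrite -(bigA_distr_bigA (fun _ (j : 'I_D) => exp_coeff X j)) /= prodr_const card_ord.
have := series_exp_le D X0; rewrite /series/= big_mkord => h.
apply: lerXn2r; rewrite ?nnegrE ?expR_ge0//.
by apply: sumr_ge0 => i _; apply: exp_coeff_ge0; exact: X0.
Qed.

Lemma feature_le1 D (kappa : {ffun 'I_dd -> 'I_D}) u : box u -> `|feature kappa u| <= 1.
Proof.
move=> bu; rewrite /feature normrM ger0_norm ?expR_ge0// normr_prod.
apply: mulr_ile1; rewrite ?expR_ge0 ?prodr_ge0//.
  rewrite -[leRHS]expR0 ler_expR mulNr oppr_le0 mulr_ge0 ?(ltW gamma0)//.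
  by apply: sumr_ge0 => k _; exact: sqr_ge0.
apply: prodr_ile1 => k _; rewrite normrX exprn_ge0//=; apply: exprn_ile1 => //.
have Bp : 0 < B by have := B1; lra.
by rewrite normrM normfV (gtr0_norm Bp) ler_pdivrMr ?mul1r.
Qed.

Lemma tker_error_ge0 D : 0 <= tker_error D.
Proof.
by rewrite /tker_error !mulr_ge0 ?exprn_ge0 ?expR_ge0//; apply: exp_coeff_ge0; exact: X0.
Qed.

Lemma cvg_tker_error : tker_error D @[D --> \oo] --> (0:R).
Proof.
rewrite /tker_error -[X in _ --> X](mulr0 dd%:R).
apply: cvgM; first exact: cvg_cst.
rewrite -[X in _ --> X](mulr0 (expR X ^+ dd)).
apply: cvgM; first exact: cvg_cst.
rewrite -[X in _ --> X](mul0r (expR X)).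
by apply: cvgM; [exact: cvg_exp_coeff|exact: cvg_cst].
Qed.

Lemma gker_sym c u : gker c u = gker u c.
Proof.
rewrite /gker; congr (expR (_ * _)); apply: eq_bigr => k _.
by rewrite -sqrrN opprB.
Qed.

Lemma gker_le1 c u : 0 <= gker c u <= 1.
Proof.
rewrite expR_ge0 -[leRHS]expR0 ler_expR mulNr oppr_le0 mulr_ge0 ?(ltW gamma0)//.
by apply: sumr_ge0 => k _; exact: sqr_ge0.
Qed.

(** For a truncated kernel the quadratic form is a sum of squares with non-negative weights, and the
    truncation error tends to 0 as [D] grows. *)
Lemma gker_psd_box (I : finType) (a : I -> R) (c : I -> 'I_dd -> R) :
  (forall i, box (c i)) -> 0 <= \sum_i \sum_j a i * a j * gker (c i) (c j).
Proof.
move=> bc; set S := \sum_i _.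
pose T := \sum_(i : I) \sum_(j : I) `|a i * a j|.
have tp D : 0 <= \sum_i \sum_j a i * a j * tker D (c i) (c j).
  have -> : \sum_i \sum_j a i * a j * tker D (c i) (c j) =
      \sum_(kappa : {ffun 'I_dd -> 'I_D})
         feature_weight kappa * (\sum_i a i * feature kappa (c i)) ^+ 2.
    under [RHS]eq_bigr do rewrite expr2 mulr_suml mulr_sumr.
    rewrite [RHS]exchange_big/=; apply: eq_bigr => i _.
    under [RHS]eq_bigr do rewrite !mulr_sumr.
    rewrite [RHS]exchange_big/=; apply: eq_bigr => j _.
    by rewrite /tker mulr_sumr; apply: eq_bigr => kappa _; ring.
  by apply: sumr_ge0 => kappa _; rewrite mulr_ge0 ?sqr_ge0 ?feature_weight_ge0.
have lb D : - (T * tker_error D) <= S.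
  rewrite lerNl; apply: le_trans (_ : _ <= - S + \sum_i \sum_j a i * a j * tker D (c i) (c j)) _.
    by rewrite lerDl.
  rewrite addrC -sumrB mulr_suml; apply: ler_sum => i _.
  rewrite -sumrB mulr_suml; apply: ler_sum => j _.
  rewrite -mulrBr; apply: (le_trans (ler_norm _)); rewrite normrM.
  by rewrite ler_wpM2l// distrC tker_approx.
have T0 : 0 <= T by apply: sumr_ge0 => i _; apply: sumr_ge0.
rewrite leNgt; apply/negP => S0.
have e0 : 0 < - S / (T + 1) by rewrite divr_gt0 ?oppr_gt0// ltr_wpDl.
have /cvgrPdist_lt /(_ _ e0) [D _ /(_ D (leqnn D))] := cvg_tker_error.
rewrite sub0r normrN => /(le_lt_trans (ler_norm _)).
rewrite ltr_pdivlMr ?ltr_wpDl// => h.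
have err0 := tker_error_ge0 D; have := lb D; nra.
Qed.

(* The labelled multi-index coefficients and the offset are rounded to the grid [eta * Z]. *)
Definition net_point D m (eta : R)
    (p : {ffun {ffun 'I_dd -> 'I_D} -> 'I_(2 * m).+1} * 'I_(2 * m).+1) u : R :=
  clip (\sum_kappa eta * ((p.1 kappa)%:R - m%:R) * (feature_weight kappa * feature kappa u)
    + eta * (p.2%:R - m%:R)).

Lemma grid_round (eta th : R) m : 0 < eta -> `|th| <= eta * m%:R ->
  exists j : 'I_(2 * m).+1, `|th - eta * (j%:R - m%:R)| <= eta.
Proof.
move=> e0 thm.
pose z := (th + eta * m%:R) / eta.
have z0 : 0 <= z.
  by rewrite divr_ge0 ?(ltW e0)//; move: thm; rewrite ler_norml => /andP[? ?]; lra.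
have z2 : z <= (2 * m)%:R.
  by rewrite ler_pdivrMr// natrM; move: thm; rewrite ler_norml => /andP[? ?]; lra.
have /andP[j1 j2] := truncn_itv z0.
have jm : (Num.trunc z < (2 * m).+1)%N.
  by rewrite ltnS -(ler_nat R); apply: le_trans j1 z2.
exists (Ordinal jm) => /=.
have -> : th - eta * ((Num.trunc z)%:R - m%:R) = eta * (z - (Num.trunc z)%:R).
  by rewrite /z; field; rewrite gt_eqF.
rewrite normrM (gtr0_norm e0) ler_piMr ?(ltW e0)//.
rewrite ger0_norm ?subr_ge0// lerBlDl.
by move: j2; rewrite -natr1 => /ltW; rewrite addrC.
Qed.

(** However many centres there are, the truncated kernel leaves only [D ^ dd] coefficients, each at
    most [A] because the features are bounded by 1. The three errors are truncation,
    [A * tker_error]; rounding of coefficients, [eta] times the sum of the weights; rounding of the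
    offset, [eta]. *)
Lemma net_cover (I : finType) (a : I -> R) (c : I -> 'I_dd -> R) (b A eta : R) D m :
  (forall i, box (c i)) -> \sum_i `|a i| <= A -> 0 < eta -> A + 1 <= eta * m%:R ->
  exists p : {ffun {ffun 'I_dd -> 'I_D} -> 'I_(2 * m).+1} * 'I_(2 * m).+1,
    forall u, box u ->
    `|clip (\sum_i a i * gker (c i) u + b) - net_point eta p u| <=
    A * tker_error D + eta * (expR X ^+ dd + 1).
Proof.
move=> bc aA e0 Am.
have A0 : 0 <= A by apply: le_trans aA; apply: sumr_ge0.
pose th (kappa : {ffun 'I_dd -> 'I_D}) := \sum_i a i * feature kappa (c i).
have thA kappa : `|th kappa| <= eta * m%:R.
  apply: le_trans (_ : _ <= A) _; last by lra.
  apply: le_trans aA; apply: (le_trans (ler_norm_sum _ _ _)).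
  by apply: ler_sum => i _; rewrite normrM ler_piMr// feature_le1.
(* The kernel part is at most [A] in absolute value, so an offset beyond [A + 1] already saturates
   [clip], and truncating it leaves the clipped score unchanged. *)
pose b' := clamp (A + 1) b.
have A1 : 0 <= A + 1 by lra.
have b'A : `|b'| <= eta * m%:R.
  apply: le_trans Am; rewrite ler_norml /b'.
  have [] := clamp_cases b A1; move=> [-> ?]; apply/andP; split; lra.
have [f fP] : exists f : {ffun {ffun 'I_dd -> 'I_D} -> 'I_(2 * m).+1},
    forall kappa, `|th kappa - eta * ((f kappa)%:R - m%:R)| <= eta.
  exists [ffun kappa => projT1 (cid (grid_round e0 (thA kappa)))] => kappa.
  by rewrite ffunE; case: cid.
have [j jP] := grid_round e0 b'A.
exists (f, j) => u bu.
set F := \sum_i _.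
have FA : `|F| <= A.
  apply: le_trans aA; apply: (le_trans (ler_norm_sum _ _ _)).
  apply: ler_sum => i _; have /andP[g0 g1] := gker_le1 (c i) u.
  by rewrite normrM ler_piMr// ger0_norm.
have -> : clip (F + b) = clip (F + b').
  move: FA; rewrite ler_norml => /andP[F1 F2]; rewrite /clip /b'.
  have [] := clamp_cases b A1; move=> [-> ?];
  have [] := @clamp_cases _ 1 (F + b) ler01; move=> [-> ?] //;
  match goal with |- _ = clamp 1 ?z =>
    have [] := @clamp_cases _ 1 z ler01; move=> [-> ?] end; lra.
apply: (le_trans (clip_lipschitz _ _)).
set G := \sum_kappa _.
pose H := \sum_kappa th kappa * (feature_weight kappa * feature kappa u).
have -> : F + b' - (G + eta * ((f, j).2%:R - m%:R)) =
    (F - H) + ((H - G) + (b' - eta * (j%:R - m%:R))) by rewrite /=; ring.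
apply: (le_trans (ler_normD _ _)); apply: lerD.
  have -> : H = \sum_i a i * tker D (c i) u.
    rewrite /H /th; under eq_bigr do rewrite mulr_suml.
    rewrite exchange_big/=; apply: eq_bigr => i _; rewrite /tker mulr_sumr.
    by apply: eq_bigr => kappa _; ring.
  rewrite /F -sumrB; apply: (le_trans (ler_norm_sum _ _ _)).
  have T0 := tker_error_ge0 D.
  apply: (@le_trans _ _ (\sum_i `|a i| * tker_error D)).
    apply: ler_sum => i _; rewrite -mulrBr normrM ler_wpM2l//.
    exact: tker_approx.
  by rewrite -mulr_suml ler_wpM2r.
rewrite [leRHS]mulrDr mulr1; apply: (le_trans (ler_normD _ _)); apply: lerD => //.
rewrite /H /G -sumrB; apply: (le_trans (ler_norm_sum _ _ _)).
apply: (@le_trans _ _ (eta * \sum_(kappa : {ffun 'I_dd -> 'I_D}) feature_weight kappa)).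
  rewrite mulr_sumr; apply: ler_sum => kappa _; rewrite -mulrBl normrM.
  apply: ler_pM => //; rewrite normrM ger0_norm ?feature_weight_ge0//.
  by rewrite ler_piMr ?feature_weight_ge0// feature_le1.
by rewrite ler_wpM2l ?(ltW e0)//; exact: sum_feature_weight.
Qed.

End Taylor.

(** * Size of the net against the sample size *)

Section Rates.
Context {R : realType}.

(** [D + 1 <= 2 ^ D] trades a power of [D + 1] for a geometric factor, which the factorial still
    beats. *)
Lemma succ_expn_exp_coeff (X : R) p D : 0 <= X ->
  D.+1%:R ^+ p * exp_coeff X D <= exp_coeff (2 ^+ p * X) D.
Proof.
move=> X0; rewrite /exp_coeff/= exprMn -exprM mulnC exprM mulrA.
rewrite ler_wpM2r ?invr_ge0// ler_wpM2r ?exprn_ge0//.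
rewrite lerXn2r ?nnegrE ?exprn_ge0// -natrX ler_nat.
exact: ltn_expl.
Qed.

Lemma expn_bracket p n : (0 < p)%N -> exists D, (D ^ p <= n < D.+1 ^ p)%N.
Proof.
move=> p0.
have e0 : exists D, (D ^ p <= n)%N by exists 0%N; rewrite exp0n.
have ub D : (D ^ p <= n)%N -> (D <= n)%N.
  move=> h; apply: leq_trans h; case: D => // D; rewrite -[X in (X <= _)%N]expn1.
  exact: leq_pexp2l.
case: (ex_maxnP e0 ub) => D Dn Dmax; exists D; rewrite Dn/= ltnNge.
by apply/negP => /Dmax; rewrite ltnn.
Qed.

Lemma near_infty_exists (Q : nat -> Prop) : (exists N, forall n, (N <= n)%N -> Q n) ->
  \forall n \near \oo, Q n.
Proof. by move=> [N NQ]; exists N. Qed.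

(* With [D^(dd+2) <= n < (D+1)^(dd+2)] the net has [exp (O (D^(dd+1)))] points,
   which is negligible against [exp (n * eps)], while the Taylor error beats
   every power of [n]. *)
Lemma net_rate dd (X c eta eps delta : R) : 0 <= X -> 0 <= c -> 0 < eta ->
  0 < eps -> 0 < delta ->
  \forall n \near \oo, exists D m : nat,
    [/\ c * n%:R ^+ 2 + 1 <= eta * m%:R,
        c * n%:R ^+ 2 * exp_coeff X D <= delta &
        (2 * m).+1%:R ^+ (D ^ dd).+1 * expR (- (n%:R * eps)) <= delta].
Proof.
move=> X0 c0 eta0 eps0 delta0.
pose p := dd.+2.
(* [c'] and [q] are chosen for the chain [2 * m + 1 <= c' * (D + 1) ^ (2 * p) <= expR (q * (D +
   1))]; the 3 comes from [m] being a truncation plus 1. *)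
pose c' := 2 * (c + 1) / eta + 3.
have c'0 : 0 <= c' by rewrite addr_ge0// divr_ge0 ?(ltW eta0)// mulr_ge0// addr_ge0.
pose q := c' + (2 * p)%:R.
have q0 : 0 <= q by rewrite addr_ge0.
have taylor : (fun D => c * exp_coeff (2 ^+ (2 * p) * X) D) @ \oo --> (0:R).
  rewrite -[X in _ --> X](mulr0 c); apply: cvgM; first exact: cvg_cst.
  exact: cvg_exp_coeff.
have /cvgrPdist_le /(_ _ delta0) [N1 _ N1P] := taylor.
have {}N1P D : (N1 <= D)%N -> c * exp_coeff (2 ^+ (2 * p) * X) D <= delta.
  by move=> /N1P; rewrite sub0r normrN; apply: le_trans (ler_norm _).
(* [n * eps >= D ^ (dd + 1) * (eps * D) >= D ^ (dd + 1) * (4 * q + 1)]: the part [4 * q] pays for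
   the cardinality of the net, and the rest is at least [D], whence the factor [expR (- D)] and the
   choice of [N3]. *)
pose N2 := Num.bound ((4 * q + 1) / eps).
have N2P D : (N2 <= D)%N -> 4 * q + 1 <= eps * D%:R.
  move=> h; rewrite [leRHS]mulrC -ler_pdivrMr//.
  have : (4 * q + 1) / eps < N2%:R.
    by apply: archi_boundP; rewrite divr_ge0 ?(ltW eps0)// addr_ge0// mulr_ge0.
  by move/ltW => /le_trans; apply; rewrite ler_nat.
pose N3 := Num.bound (delta^-1).
have N3P D : (N3 <= D)%N -> expR (- D%:R) <= delta.
  move=> h; rewrite expRN -[leRHS]invrK lef_pV2 ?posrE ?invr_gt0 ?expR_gt0//.
  have : delta^-1 < N3%:R by apply: archi_boundP; rewrite invr_ge0 ltW.
  move=> /ltW /le_trans; apply; apply: (@le_trans _ _ D%:R); first by rewrite ler_nat.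
  by apply: le_trans (expR_ge1Dx _); rewrite lerDr.
pose N := (maxn (maxn N1 N2) N3).+1.
apply: near_infty_exists; exists (N ^ p)%N => n nN.
have [D /andP[Dn nD]] := @expn_bracket p n isT.
have ND : (N <= D)%N.
  rewrite -ltnS -(@ltn_exp2r _ _ p)//; exact: leq_ltn_trans nN nD.
have [D1 D2 D3] : [/\ (N1 <= D)%N, (N2 <= D)%N & (N3 <= D)%N].
  by move: ND; rewrite /N gtn_max gtn_max => /andP[/andP[? ?] ?]; split; exact: ltnW.
have D0 : (0 < D)%N by apply: leq_trans ND.
pose r := (c * n%:R ^+ 2 + 1) / eta.
have r0 : 0 <= r by rewrite divr_ge0 ?(ltW eta0)// addr_ge0// mulr_ge0// exprn_ge0.
pose m := (Num.trunc r).+1.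
have /andP[mr rm] := truncn_itv r0.
exists D, m; split.
- by rewrite [leRHS]mulrC -ler_pdivrMr//; exact: ltW.
- apply: le_trans (N1P D D1); rewrite -mulrA ler_wpM2l//.
  apply: le_trans (succ_expn_exp_coeff (2 * p) D X0).
  rewrite ler_wpM2r ?exp_coeff_ge0// mulnC exprM lerXn2r ?nnegrE ?exprn_ge0//.
  by rewrite -natrX ler_nat ltnW.
have nDp : (n%:R : R) <= D.+1%:R ^+ p by rewrite -natrX ler_nat ltnW.
have mD : (2 * m).+1%:R <= expR (q * D.+1%:R).
  have n2 : (n%:R : R) ^+ 2 <= D.+1%:R ^+ (2 * p).
    by rewrite mulnC exprM lerXn2r ?nnegrE ?exprn_ge0.
  have Dp1 : 1 <= (D.+1%:R : R) ^+ (2 * p) by rewrite exprn_ege1// ler1n.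
  apply: (@le_trans _ _ (c' * D.+1%:R ^+ (2 * p))).
    have rle : r <= (c + 1) / eta * D.+1%:R ^+ (2 * p).
      rewrite /r mulrAC ler_pM2r ?invr_gt0// mulrDl mul1r lerD//.
      by rewrite ler_wpM2l.
    have -> : (2 * m).+1%:R = 2 * (Num.trunc r)%:R + 3 :> R.
      by rewrite -natr1 natrM /m -(natr1 (Num.trunc r)); ring.
    by rewrite /c'; lra.
  have -> : q * D.+1%:R = c' * D.+1%:R + (2 * p)%:R * D.+1%:R by exact: mulrDl.
  rewrite expRD; apply: ler_pM => //.
    apply: (@le_trans _ _ (expR c')); last by rewrite ler_expR ler_peMr// ler1n.
    by apply: le_trans (expR_ge1Dx _); rewrite lerDr.
  rewrite mulrC expRM_natr lerXn2r ?nnegrE ?expR_ge0//.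
  by apply: le_trans (expR_ge1Dx _); rewrite lerDr.
apply: le_trans (N3P D D3).
apply: (@le_trans _ _ (expR (q * D.+1%:R) ^+ (D ^ dd).+1 * expR (- (n%:R * eps)))).
  by rewrite ler_wpM2r ?expR_ge0// lerXn2r ?nnegrE ?expR_ge0.
rewrite -expRM_natr -expRD ler_expR.
have DR : 1 <= (D%:R : R) by rewrite ler1n.
have Dd1 : 1 <= (D%:R : R) ^+ dd by rewrite exprn_ege1.
have h1 : ((D ^ dd).+1%:R : R) <= 2 * D%:R ^+ dd by rewrite -natr1 natrX; lra.
have h2 : (D.+1%:R : R) <= 2 * D%:R by rewrite -natr1; lra.
have h3 : D%:R ^+ p <= (n%:R : R) by rewrite -natrX ler_nat.
have h4 : q * D.+1%:R * (D ^ dd).+1%:R <= q * (4 * D%:R ^+ dd.+1).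
  rewrite -mulrA ler_wpM2l//.
  apply: (@le_trans _ _ ((2 * D%:R) * (2 * D%:R ^+ dd))); first exact: ler_pM.
  by rewrite exprS le_eqVlt; apply/orP; left; apply/eqP; ring.
have h5 : (D%:R : R) <= D%:R ^+ dd.+1 by rewrite exprS ler_peMr//; lra.
have h6 := ler_wpM2r (ltW eps0) h3.
have h7 := ler_wpM2l (exprn_ge0 dd.+1 (le_trans ler01 DR)) (N2P D D2).
have h8 : D%:R ^+ p * eps = D%:R ^+ dd.+1 * (eps * D%:R) by rewrite /p !exprS; ring.
move: h4 h6 h7; rewrite h8; lra.
Qed.

End Rates.

(** Serves to recover a value from the number of grid thresholds below it, up to one grid step, in
    [margin_le_best]. *)
Lemma count_le_real (R : realType) N (z : R) : 0 <= z ->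
  Num.min N%:R z <= \sum_(j < N) ((j%:R <= z)%R%:R : R) <= z + 1.
Proof.
move=> z0; have cN n : \sum_(j < n) ((j%:R <= z)%R%:R : R) <= n%:R.
  rewrite -[leRHS]mulr1 -[n in leRHS]card_ord mulr_natl -sumr_const.
  by apply: ler_sum => j _; case: (j%:R <= z)%R; rewrite ?lexx ?ler01.
elim: N => [|N /andP[IH1 IH2]].
  by rewrite big_ord0 ge_min lexx/= addr_ge0.
rewrite big_ord_recr/= -natr1; have := cN N.
move: IH1 IH2; set S := \sum_(j < N) _.
case: (lerP N%:R z) => Nz /= IH1 IH2 SN; rewrite ?addr0 ge_min; apply/andP; split.
- by apply/orP; left; lra.
- lra.
- by apply/orP; right; lra.
- lra.
Qed.

(** * Best error over a sub-sigma-algebra *)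

Section Margin.
Context d (E : measurableType d) (R : realType) (Q : probability E R).
Context (lab : E -> R) (G : set (set E)).
Hypothesis mlab : measurable_fun setT lab.
Hypothesis hlab : forall e, is_label (lab e).
Hypothesis Gm : G `<=` measurable.

(** For a classifier the error is [(1 - margin) / 2]. The margin is linear in [g] and makes sense
    for real scores too. *)
Definition margin (g : E -> R) : R := Ex Q (fun e => lab e * g e).

Definition sgset (A : set E) (e : E) : R := 2 * \1_A e - 1.

Definition best_margin : R := sup [set margin (sgset A) | A in <<s G >>].

Lemma sigma_measurable A : <<s G >> A -> measurable A.
Proof. by apply: smallest_sub => //; exact: sigma_algebra_measurable. Qed.

Lemma normr_lab e : `|lab e| = 1.
Proof. by case: (hlab e) => ->; rewrite ?normrN normr1. Qed.

Lemma sgset_norm A e : `|sgset A e| <= 1.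
Proof. by rewrite /sgset indicE; case: (_ \in _) => /=; rewrite ler_norml; apply/andP; split; lra. Qed.

Lemma measurable_sgset A : measurable A -> measurable_fun setT (sgset A).
Proof. by move=> mA; apply: measurable_funB => //; exact: measurable_funM. Qed.

Lemma lab_bounded (g : E -> R) (M : R) : measurable_fun setT g -> (forall e, `|g e| <= M) ->
  ae_bounded Q (fun e => lab e * g e).
Proof.
move=> mg gM; apply: (@bounded_ae _ _ _ _ M); first exact: measurable_funM.
by move=> e; rewrite normrM normr_lab mul1r.
Qed.

Lemma margin_le (g h : E -> R) (r : R) : ae_bounded Q (fun e => lab e * g e) ->
  ae_bounded Q (fun e => lab e * h e) ->
  {ae Q, forall e, `|g e - h e| <= r} -> margin g <= margin h + r.
Proof.
move=> bg bh gh; rewrite -[r](Ex_cst Q) /margin -ExD//; last exact: ae_bounded_cst.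
apply: Ex_le => //; first by apply: ae_boundedD => //; exact: ae_bounded_cst.
apply: filterS gh => e /=; rewrite ler_norml => /andP[? ?].
by case: (hlab e) => ->; lra.
Qed.

Lemma margin_norm (g : E -> R) (M : R) : measurable_fun setT g -> (forall e, `|g e| <= M) ->
  `|margin g| <= M.
Proof.
move=> mg gM; have bg := lab_bounded mg gM.
apply: (le_trans (Ex_norm bg)); rewrite -[leRHS](Ex_cst Q).
apply: Ex_le; [exact: ae_bounded_norm|exact: ae_bounded_cst|].
by apply: aeW => e; rewrite normrM normr_lab mul1r.
Qed.

Lemma has_sup_margin : has_sup [set margin (sgset A) | A in <<s G >>].
Proof.
split; first by exists (margin (sgset set0)); exists set0 => //; exact: sigma_algebra0.
exists 1 => _ [A /sigma_measurable mA <-].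
by apply: le_trans (ler_norm _) (margin_norm (measurable_sgset mA) (sgset_norm A)).
Qed.

Lemma margin_sgset_le A : <<s G >> A -> margin (sgset A) <= best_margin.
Proof. by move=> GA; apply: ub_le_sup; [case: has_sup_margin|exists A]. Qed.

Lemma best_margin_le1 : best_margin <= 1.
Proof.
apply: sup_le_ub; first by case: has_sup_margin.
move=> _ [A /sigma_measurable mA <-].
by apply: le_trans (ler_norm _) (margin_norm (measurable_sgset mA) (sgset_norm A)).
Qed.

Lemma best_margin_adherent eps : 0 < eps ->
  exists2 A, <<s G >> A & best_margin - eps < margin (sgset A).
Proof.
by move=> e0; have [_ [A GA <-] h] := sup_adherent e0 has_sup_margin; exists A.
Qed.

(* A function with values in [-1,1] is an average of the signs of [f - theta]
   over thresholds [theta], each of which defines a classifier. *)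
Lemma margin_le_best (f : E -> R) :
  (forall c, <<s G >> [set e | c <= f e]) -> measurable_fun setT f ->
  (forall e, `|f e| <= 1) -> margin f <= best_margin.
Proof.
move=> Gf mf f1; apply/ler_addgt0Pl => eps eps0.
pose N := (Num.bound (2 / eps)).+1.
have N0 : 0 < N%:R :> R by rewrite ltr0n.
have Neps : 2 / N%:R <= eps.
  rewrite ler_pdivrMr// mulrC -ler_pdivrMr//.
  have h : 2 / eps < (Num.bound (2 / eps))%:R by apply: archi_boundP; rewrite divr_ge0 ?ltW.
  by apply: (le_trans (ltW h)); rewrite ler_nat.
pose A j := [set e | -1 + 2 * j%:R / N%:R <= f e].
pose g e := N%:R^-1 * \sum_(j < N) sgset (A j) e.
have mA j : measurable (A j) by apply: sigma_measurable; exact: Gf.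
have mg : measurable_fun setT g.
  apply: measurable_funM => //; apply: measurable_sum => j; exact: measurable_sgset.
have g1 e : `|g e| <= 1.
  rewrite normrM ger0_norm ?invr_ge0// mulrC ler_pdivrMr// mul1r.
  apply: (le_trans (ler_norm_sum _ _ _)).
  rewrite -[leRHS]mulr1 -[N in leRHS]card_ord mulr_natl -sumr_const.
  by apply: ler_sum => j _; exact: sgset_norm.
have fg e : `|f e - g e| <= 2 / N%:R.
  have := f1 e; rewrite ler_norml => /andP[fl fu].
  pose z := N%:R * (f e + 1) / 2.
  have z0 : 0 <= z by rewrite divr_ge0// mulr_ge0//; lra.
  have zN : z <= N%:R by rewrite /z ler_pdivrMr// ler_pM2l//; lra.
  have := count_le_real N z0; rewrite min_r//.
  have -> : \sum_(j < N) ((j%:R <= z)%R%:R : R) = \sum_(j < N) \1_(A j) e.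
    apply: eq_bigr => j _; rewrite indicE; congr ((_ : bool)%:R).
    apply/idP/idP; rewrite inE /A/= /z ler_pdivlMr// -lerBrDl ler_pdivrMr//; lra.
  set S := \sum_(j < N) _ => /andP[S1 S2].
  have -> : g e = N%:R^-1 * (2 * S - N%:R).
    congr (_ * _); rewrite /sgset sumrB -mulr_sumr; congr (_ - _).
    by rewrite sumr_const card_ord.
  have -> : f e = N%:R^-1 * (2 * z - N%:R) by rewrite /z; field; rewrite gt_eqF.
  rewrite -mulrBr normrM ger0_norm ?invr_ge0// mulrC ler_pM2r ?invr_gt0//.
  by rewrite ler_norml; apply/andP; split; lra.
have h := margin_le (lab_bounded mf f1) (lab_bounded mg g1) (aeW _ fg).
apply: (le_trans h); rewrite addrC; apply: lerD => //.
rewrite /margin /g.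
have -> : (fun e => lab e * (N%:R^-1 * \sum_(j < N) sgset (A j) e)) =
    (fun e => N%:R^-1 * \sum_(j < N) lab e * sgset (A j) e).
  by apply/funext => e; rewrite mulrCA mulr_sumr.
have bA j : ae_bounded Q (fun e => lab e * sgset (A j) e).
  exact: lab_bounded (measurable_sgset (mA j)) (sgset_norm (A j)).
rewrite ExZ; last exact: ae_bounded_sum.
rewrite Ex_sum// mulrC ler_pdivrMr// mulr_natr -[N in leRHS]card_ord -sumr_const.
apply: ler_sum => j _; apply: margin_sgset_le; exact: Gf.
Qed.

Definition error_of (s : E -> R) : R := fine (Q [set e | s e <> lab e]).

Lemma measurable_error_set (s : E -> R) : measurable_fun setT s -> measurable [set e | s e <> lab e].
Proof.
move=> ms; rewrite (_ : [set e | s e <> lab e] = ~` [set e | s e = lab e])//.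
apply: measurableC.
rewrite (_ : [set e | s e = lab e] = [set e | s e == lab e]).
  rewrite -[X in measurable X]setTI.
  exact: (measurable_fun_eqr ms mlab measurableT (Y := [set true])).
by apply/seteqP; split=> e /= /eqP.
Qed.

Lemma error_of_margin (s : E -> R) : measurable_fun setT s -> (forall e, is_label (s e)) ->
  error_of s = (1 - margin s) / 2.
Proof.
move=> ms ls; have mS := measurable_error_set ms.
have s1 e : `|s e| <= 1 by case: (ls e) => ->; rewrite ?normrN normr1.
rewrite /error_of -Ex_indic//.
have -> : margin s = 1 - 2 * Ex Q \1_[set e | s e <> lab e].
  have bi := ae_bounded_indic Q mS.
  rewrite -ExZ// -[X in X - _](Ex_cst Q) -ExB; last 2 first.
  - exact: ae_bounded_cst.
  - exact: ae_boundedZ.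
  rewrite /margin; congr Ex; apply/funext => e; rewrite indicE.
  case: (boolP (e \in _)); rewrite ?inE ?notin_setE /=.
    by case: (hlab e) (ls e) => -> [] -> //; rewrite ?mulr1; lra.
  by move=> /contrapT ->; case: (hlab e) => ->; lra.
lra.
Qed.

Definition best_error : R := (1 - best_margin) / 2.

Lemma best_error_ge0 : 0 <= best_error.
Proof. by rewrite divr_ge0// subr_ge0 best_margin_le1. Qed.

Lemma sgn1_label r : is_label (sgn1 r : R).
Proof. by rewrite /sgn1; case: ifP; [right|left]. Qed.

Lemma best_error_le (f : E -> R) : (forall c, <<s G >> [set e | c <= f e]) ->
  measurable_fun setT (fun e => sgn1 (f e)) -> best_error <= error_of (fun e => sgn1 (f e)).
Proof.
move=> Gf ms; rewrite error_of_margin//; last by move=> e; exact: sgn1_label.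
rewrite /best_error ler_pM2r ?invr_gt0// lerD2l lerN2.
have -> : (fun e => sgn1 (f e)) = sgset [set e | 0 <= f e].
  apply/funext => e; rewrite /sgn1 /sgset indicE; case: ifPn => fe.
    by rewrite mem_set//=; lra.
  by rewrite memNset//=; [lra|exact/negP].
exact: margin_sgset_le.
Qed.

(* Calibration of the hinge loss: [2 clip f - sgn1 f] takes values in [-1,1]. *)
Lemma error_of_sgn1_le (f : E -> R) : measurable_fun setT f ->
  (forall (F : R -> R) c, measurable_fun setT F -> <<s G >> [set e | c <= F (f e)]) ->
  error_of (fun e => sgn1 (f e)) <= 1 - margin (fun e => clip (f e)) - best_error.
Proof.
move=> mf Gf.
have msgn : measurable_fun setT (@sgn1 R).
  rewrite /sgn1; apply: measurable_fun_ifT => //.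
  exact: (@measurable_fun_ler _ _ _ setT (cst 0) id).
have mclip : measurable_fun setT (@clip R).
  by apply: measurable_maxr => //; apply: measurable_minr.
have ms : measurable_fun setT (fun e => sgn1 (f e)) by exact: measurableT_comp.
have mc : measurable_fun setT (fun e => clip (f e)) by exact: measurableT_comp.
rewrite error_of_margin//; last by move=> e; exact: sgn1_label.
(* By linearity the margin of the sign is at least [2 * margin (clip f) - best_margin], which is the
   claim once converted into an error. *)
have h : margin (fun e => 2 * clip (f e) - sgn1 (f e)) <= best_margin.
  apply: margin_le_best.
  - move=> c; apply: (Gf (fun r => 2 * clip r - sgn1 r)).
    by apply: measurable_funB => //; exact: measurable_funM.
  - by apply: measurable_funB => //; exact: measurable_funM.
  - move=> e; rewrite ler_norml /clip /sgn1.
    by have [] := @clamp_cases _ 1 (f e) ler01; move=> [-> ?]; case: ifPn => ?;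
       apply/andP; split; lra.
have s1 e : `|sgn1 (f e) : R| <= 1.
  by case: (sgn1_label (f e)) => ->; rewrite ?normrN normr1.
have c1 e : `|clip (f e)| <= 1 := clip_norm (f e).
have bs := lab_bounded ms s1; have bc := lab_bounded mc c1.
move: h; rewrite /margin.
have -> : (fun e => lab e * (2 * clip (f e) - sgn1 (f e))) =
   (fun e => 2 * (lab e * clip (f e)) - lab e * sgn1 (f e)).
  by apply/funext => e; ring.
rewrite ExB//; last exact: ae_boundedZ.
by rewrite ExZ// /best_error; lra.
Qed.

End Margin.

Lemma gker_psd (R : realType) dd (gamma : R) (I : finType) (a : I -> R)
    (c : I -> 'I_dd -> R) : 0 < gamma ->
  0 <= \sum_i \sum_j a i * a j * gker gamma (c i) (c j).
Proof.
move=> g0; pose B := 1 + \sum_i \sum_k `|c i k|.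
have S0 : 0 <= \sum_i \sum_k `|c i k| by apply: sumr_ge0 => i _; apply: sumr_ge0.
apply: (@gker_psd_box _ _ _ B) => //; first by rewrite /B lerDl.
move=> i k; rewrite /B (bigD1 i)//= (bigD1 k)//=.
have : 0 <= \sum_(j < dd | j != k) `|c i j| by apply: sumr_ge0.
have : 0 <= \sum_(j | j != i) \sum_k `|c j k| by apply: sumr_ge0 => j _; apply: sumr_ge0.
lra.
Qed.

Lemma measurable_fun_lt_sets d (T : measurableType d) (R : realType) (f : T -> R) :
  (forall c, measurable [set x | f x < c]) -> measurable_fun setT f.
Proof.
move=> mf; apply: (measurability _ (RGenInftyO.measurableE R)).
move=> _ [_ [c ->] <-]; rewrite setTI.
by rewrite (_ : f @^-1` _ = [set x | f x < c]).
Qed.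

(** * Consistency in fixed dimension *)

Section FixedDim.
Context {d d' : measure_display} {Om : measurableType d} {E : measurableType d'}
  {R : realType} (P : probability Om R) (Z : option nat -> Om -> E).
Context (dd : nat) (v : 'I_dd -> E -> R) (lab : E -> R) (gamma B : R)
  (C : nat -> R) (sel : svm_rule R).
Hypothesis mZ : forall i, measurable_fun setT (Z i).
Hypothesis indZ : mutually_independent P Z.
Hypothesis idZ : identically_distributed P Z.
Hypothesis mv : forall k, measurable_fun setT (v k).
Hypothesis mlab : measurable_fun setT lab.
Hypothesis hlab : forall e, is_label (lab e).
Hypothesis gamma0 : 0 < gamma.
Hypothesis B1 : 1 <= B.
Hypothesis vB : {ae P, forall w, forall k, `|v k (Z None w)| <= B}.
Hypothesis C0 : forall n, 0 < C n.
Hypothesis msel : forall n : nat, measurable_fun setT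
  (fun z : (n.-tuple (n.-tuple R) * n.-tuple R * R)%type =>
     sel z.1.1 z.1.2 z.2 : (n.-tuple R * R)%type).

Definition svm_gram n (s : n.-tuple E) : n.-tuple (n.-tuple R) :=
  [tuple [tuple gker gamma (v ^~ (tnth s i)) (v ^~ (tnth s j)) | j < n] | i < n].

Definition svm_labels n (s : n.-tuple E) : n.-tuple R := [tuple lab (tnth s i) | i < n].

Definition svm_sel n (s : n.-tuple E) : n.-tuple R * R :=
  sel (svm_gram s) (svm_labels s) (C n).

Definition svm_score n (s : n.-tuple E) (e : E) : R :=
  2 * \sum_(i < n) tnth (svm_sel s).1 i * lab (tnth s i) *
        gker gamma (v ^~ (tnth s i)) (v ^~ e) + (svm_sel s).2.

Hypothesis sel_ok : forall n (s : n.-tuple E),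
  svm_dual_solution (C n) (svm_gram s) (svm_labels s) (svm_sel s).1 /\
  svm_bias (svm_gram s) (svm_labels s) (svm_sel s).1 (svm_sel s).2.

Definition law0 : probability E R := distribution P (mfun_Sub (mem_set (mZ None))).
Local Notation Q := law0.
Local Notation halfspaces := (coord_halfspaces v).
Local Notation ell := (best_error Q lab halfspaces).

Lemma halfspaces_measurable : halfspaces `<=` measurable.
Proof. by move=> _ [k [c ->]]; exact: measurable_lt_cst. Qed.

Lemma Ex_law0 (f : E -> R) (M : R) : measurable_fun setT f -> (forall e, `|f e| <= M) ->
  Ex Q f = Ex P (f \o Z None).
Proof.
move=> mf fM; rewrite /Ex /Rintegral; congr fine.
apply: integral_distribution; first exact/measurable_EFinP.
apply: ae_bounded_integrable; apply: (@bounded_ae _ _ _ _ M).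
  exact: measurableT_comp.
by move=> w; exact: fM.
Qed.

Lemma measurable_in_box : measurable [set e | in_box v B e].
Proof.
rewrite (_ : [set e | in_box v B e] =
    \bigcap_(k in [set: 'I_dd]) ~` [set e | - `|v k e| < - B]).
  apply: fin_bigcap_measurable => [|k _]; first exact: finite_finset.
  apply: measurableC; apply: measurable_lt_cst.
  by apply: measurableT_comp => //; exact: measurableT_comp.
apply/seteqP; split=> e /=.
  by move=> h k _ /=; apply/negP; rewrite -leNgt lerN2; exact: h.
by move=> h k; have := h k I => /= /negP; rewrite -leNgt lerN2.
Qed.

Lemma ae_box_law0 : {ae Q, forall e, in_box v B e}.
Proof.
have mc : measurable (~` [set e | in_box v B e]).
  by apply: measurableC; exact: measurable_in_box.
exists (~` [set e | in_box v B e]); split=> //.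
rewrite /Q /= /distribution /pushforward /=.
have [N [mN N0 sN]] := vB; apply/eqP; rewrite -measure_le0 -N0.
apply: le_measure; rewrite ?inE//.
by rewrite -[X in measurable X]setTI; exact: (mZ None).
Qed.

Lemma ae_box_sample n : {ae P, forall w, forall i : 'I_n, in_box v B (Z (Some (i : nat)) w)}.
Proof.
suff h i : {ae P, forall w, in_box v B (Z (Some i) w)}.
  by apply: filterS (ae_foralln h) => w hw i; exact: hw.
have mc : measurable (~` [set e | in_box v B e]).
  by apply: measurableC; exact: measurable_in_box.
exists (Z (Some i) @^-1` (~` [set e | in_box v B e])); split=> //.
  by rewrite -[X in measurable X]setTI; exact: mZ.
rewrite (idZ (Some i) None mc).
have [N [mN N0 sN]] := vB; apply/eqP; rewrite -measure_le0 -N0.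
apply: le_measure; rewrite ?inE//.
by rewrite -[X in measurable X]setTI; exact: (mZ None).
Qed.

Definition training n : n.-tuple (option nat) := [tuple Some (i : nat) | i < n].

Lemma training_uniq n : uniq (None :: training n).
Proof.
rewrite /= map_inj_uniq ?val_enum_uniq ?enum_uniq; last first.
  by move=> i j [] /val_inj.
by rewrite andbT; apply/mapP => -[].
Qed.

Local Notation S n w := (sample Z (training n) w).

Lemma tnth_sample n w i : tnth (S n w) i = Z (Some (i : nat)) w.
Proof. by rewrite !tnth_mktuple. Qed.

Lemma measurable_gker d1 (T : measurableType d1) (f g : T -> E) :
  measurable_fun setT f -> measurable_fun setT g ->
  measurable_fun setT (fun x => gker gamma (v ^~ (f x)) (v ^~ (g x))).
Proof.
move=> mf mg; apply: measurableT_comp => //; apply: measurable_funM => //.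
apply: measurable_sum => k; apply: measurable_funX.
by apply: measurable_funB; exact: measurableT_comp.
Qed.

Lemma measurable_svm_sel n : measurable_fun setT (@svm_sel n).
Proof.
have mt i := @measurable_tnth _ E n i.
pose f (s : n.-tuple E) := (svm_gram s, svm_labels s, C n).
suff mf : measurable_fun setT f by have h := (measurableT_comp (@msel n) mf); exact: h.
apply: measurable_fun_pair; last exact: measurable_cst.
apply: measurable_fun_pair.
  apply/measurable_fun_tnthP => i; apply/measurable_fun_tnthP => j.
  rewrite (_ : _ \o _ = fun s => gker gamma (v ^~ (tnth s i)) (v ^~ (tnth s j))).
    exact: measurable_gker.
  by apply/funext => s /=; rewrite !tnth_mktuple.
apply/measurable_fun_tnthP => i.
rewrite (_ : _ \o _ = fun s => lab (tnth s i)); first exact: measurableT_comp.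
by apply/funext => s /=; rewrite tnth_mktuple.
Qed.

Lemma measurable_svm_score n :
  measurable_fun setT (fun z : n.-tuple E * E => svm_score z.1 z.2).
Proof.
have ms : measurable_fun setT (fun z : n.-tuple E * E => svm_sel z.1).
  exact: (measurableT_comp (@measurable_svm_sel n) measurable_fst).
have mt i : measurable_fun setT (fun z : n.-tuple E * E => tnth z.1 i).
  exact: (measurableT_comp (measurable_tnth i) measurable_fst).
apply: measurable_funD; last exact: (measurableT_comp measurable_snd ms).
apply: measurable_funM => //; apply: measurable_sum => i.
apply: measurable_funM; last exact: measurable_gker.
apply: measurable_funM; last exact: measurableT_comp.
apply: (measurableT_comp (measurable_tnth i)).
exact: (measurableT_comp measurable_fst ms).
Qed.

Lemma svm_score_sigma n (s : n.-tuple E) (F : R -> R) c : measurable_fun setT F ->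
  <<s halfspaces >> [set e | c <= F (svm_score s e)].
Proof.
move=> mF.
(* The same space under the smaller sigma-algebra generated by the coordinates: measurability there
   is membership in [<<s halfspaces >>]. *)
pose T := g_sigma_algebraType halfspaces.
have mvT k : measurable_fun setT (v k : T -> R).
  apply: measurable_fun_lt_sets => a; apply: sub_sigma_algebra.
  by exists k, a.
have mT : measurable_fun setT (svm_score s : T -> R).
  apply: measurable_funD => //; apply: measurable_funM => //.
  apply: measurable_sum => i; apply: measurable_funM => //.
  apply: measurableT_comp => //; apply: measurable_funM => //.
  apply: measurable_sum => k; apply: measurable_funX.
  exact: measurable_funB.
have : measurable ([set: T] `&` [set e : T | c <= F (svm_score s e)]).
  exact: (measurable_fun_ler (measurable_cst c) (measurableT_comp mF mT)
    measurableT (Y := [set true])).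
by rewrite setTI.
Qed.

Lemma measurable_svm_score1 n (s : n.-tuple E) : measurable_fun setT (svm_score s).
Proof.
exact: (measurableT_comp (@measurable_svm_score n) (measurable_pair1 s)).
Qed.

Definition cond_error n (s : n.-tuple E) : R :=
  error_of Q lab (fun e => sgn1 (svm_score s e)).

Lemma measurable_sgn1 : measurable_fun setT (@sgn1 R).
Proof.
rewrite /sgn1; apply: measurable_fun_ifT => //.
exact: (@measurable_fun_ler _ _ _ setT (cst 0) id).
Qed.

Lemma cond_error_ge n (s : n.-tuple E) : ell <= cond_error s.
Proof.
apply: best_error_le => //; first exact: halfspaces_measurable.
  by move=> c; exact: (@svm_score_sigma _ s id).
by apply: measurableT_comp; [exact: measurable_sgn1|exact: measurable_svm_score1].
Qed.

Lemma cond_error_le n (s : n.-tuple E) :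
  cond_error s <= 1 - margin Q lab (fun e => clip (svm_score s e)) - ell.
Proof.
apply: error_of_sgn1_le => //; first exact: halfspaces_measurable.
  exact: measurable_svm_score1.
by move=> F c; exact: svm_score_sigma.
Qed.

Definition svm_failure n : set Om :=
  [set w | sgn1 (svm_score (S n w) (Z None w)) <> lab (Z None w)].

Lemma failure_set_measurable n :
  measurable [set z : n.-tuple E * E | sgn1 (svm_score z.1 z.2) <> lab z.2].
Proof.
have m1 : measurable_fun setT (fun z : n.-tuple E * E => sgn1 (svm_score z.1 z.2)).
  exact: (measurableT_comp measurable_sgn1 (@measurable_svm_score n)).
have m2 : measurable_fun setT (fun z : n.-tuple E * E => lab z.2).
  exact: (measurableT_comp mlab measurable_snd).
rewrite (_ : [set z | _] = ~` [set z | sgn1 (svm_score z.1 z.2) == lab z.2]).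
  apply: measurableC; rewrite -[X in measurable X]setTI.
  exact: (measurable_fun_eqr m1 m2 measurableT (Y := [set true])).
by apply/seteqP; split=> z /= h /eqP.
Qed.

Let F n (z : n.-tuple E * E) : \bar R :=
  (\1_[set z : n.-tuple E * E | sgn1 (svm_score z.1 z.2) <> lab z.2] z)%:E.

Let mF n : measurable_fun setT (@F n).
Proof. by apply/measurable_EFinP; apply: measurable_indic; exact: failure_set_measurable. Qed.

Let F0 n z : (0 <= @F n z)%E.
Proof. by rewrite lee_fin. Qed.

Lemma cond_error_integral n (s : n.-tuple E) :
  (cond_error s)%:E = (\int[Q]_e F (s, e))%E.
Proof.
have ms : measurable [set e | sgn1 (svm_score s e) <> lab e].
  apply: measurable_error_set => //.
  by apply: measurableT_comp; [exact: measurable_sgn1|exact: measurable_svm_score1].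
rewrite /cond_error /error_of fineK ?fin_num_measure//.
by rewrite -[X in Q X]setIT -integral_indic.
Qed.

Lemma cond_error_ge0 n (s : n.-tuple E) : 0 <= cond_error s.
Proof. exact: fine_ge0. Qed.

Lemma cond_error_le1 n (s : n.-tuple E) : cond_error s <= 1.
Proof.
have ms : measurable [set e | sgn1 (svm_score s e) <> lab e].
  apply: measurable_error_set => //.
  by apply: measurableT_comp; [exact: measurable_sgn1|exact: measurable_svm_score1].
rewrite -lee_fin /cond_error /error_of fineK ?fin_num_measure//.
exact: probability_le1.
Qed.

Lemma cond_error_bounded n : ae_bounded P (fun w => cond_error (S n w)).
Proof.
apply: (@bounded_ae _ _ _ _ 1); last first.
  by move=> w; rewrite ger0_norm ?cond_error_ge0 ?cond_error_le1.
apply: (measurableT_comp _ (measurable_sample mZ (training n))).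
rewrite (_ : @cond_error n = fine \o (fun s => \int[Q]_e F (s, e))%E); last first.
  by apply/funext => s /=; rewrite -cond_error_integral.
apply: measurableT_comp; first exact: fine_measurable.
exact: (measurable_fun_fubini_tonelli_F (m2 := Q) (@F n) (@mF n) (@F0 n)).
Qed.

(** The test pair is independent of the sample, so by Tonelli the error over both is the mean of the
    error conditional on the sample. *)
Lemma svm_failure_cond n :
  P (svm_failure n) = (Ex P (fun w => cond_error (S n w)))%:E.
Proof.
have mf : measurable (svm_failure n).
  rewrite -[X in measurable X]setTI.
  have mp : measurable_fun setT (fun w => (S n w, Z None w)).
    by apply/measurable_fun_pairP; split; [exact: measurable_sample|exact: mZ].
  exact: (mp measurableT _ (@failure_set_measurable n)).
transitivity (\int[P]_w F (S n w, Z None w))%E.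
  by rewrite -[X in P X]setIT -integral_indic.
rewrite (sample_fubini mZ indZ (training_uniq n) (@mF n) (@F0 n)).
rewrite EFin_Ex; last exact: cond_error_bounded.
apply: eq_integral => w _; rewrite cond_error_integral.
rewrite ge0_integral_distribution//.
by apply: (measurableT_comp (@mF n)); exact: measurable_pair1.
Qed.

Lemma svm_failure_ge n : (ell%:E <= P (svm_failure n))%E.
Proof.
rewrite svm_failure_cond lee_fin -[leLHS](Ex_cst P); apply: Ex_le.
- exact: ae_bounded_cst.
- exact: cond_error_bounded.
- by apply: aeW => w; exact: cond_error_ge.
Qed.

Definition hinge (x : R) : R := Num.max 0 (1 - x).

(** Carries a bound on the hinge loss of the score over to its clipped version, which is bounded and
    so accessible to deviation inequalities. *)
Lemma clip_hinge x : 1 - clip x <= hinge x.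
Proof.
rewrite /hinge /clip; rewrite le_max; have [] := @clamp_cases _ 1 x ler01; move=> [-> ?]; apply/orP.
- by left; lra.
- by right; lra.
- by right; lra.
Qed.

Lemma clip_opp (x : R) : clip (- x) = - clip x.
Proof.
rewrite /clip; have [] := @clamp_cases _ 1 x ler01; move=> [-> ?];
have [] := @clamp_cases _ 1 (- x) ler01; move=> [-> ?]; lra.
Qed.

Lemma lab_clip e x : lab e * clip x = clip (lab e * x).
Proof. by case: (hlab e) => ->; rewrite ?mulN1r ?mul1r ?clip_opp. Qed.

(** The competitor is a Gaussian combination with arbitrary centres, unrelated to the data, and no
    intercept; the double sum is its squared norm. *)
Lemma svm_score_oracle n (s : n.-tuple E) (l : seq (R * ('I_dd -> R))) :
  C n * \sum_(i < n) hinge (lab (tnth s i) * svm_score s (tnth s i)) <=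
  (\sum_(p <- l) \sum_(q <- l) p.1 * q.1 * gker gamma p.2 q.2) / 4 +
  C n * \sum_(i < n) hinge (lab (tnth s i) * gcomb v gamma l (tnth s i)).
Proof.
have [sol bias] := sel_ok s.
set N := \sum_(p <- l) _.
pose f i := gcomb v gamma l (tnth s i).
have GE i j : tnth (tnth (svm_gram s) i) j = gker gamma (v ^~ (tnth s i)) (v ^~ (tnth s j)).
  by rewrite !tnth_mktuple.
have yE i : tnth (svm_labels s) i = lab (tnth s i) by rewrite tnth_mktuple.
have := @svm_primal_optimal _ _ _ _ _ _ _ f N (C0 n) _ _ sol bias.
have ylab i : is_label (tnth (svm_labels s) i) by rewrite yE.
have Gs i j : tnth (tnth (svm_gram s) i) j = tnth (tnth (svm_gram s) j) i.
  by rewrite !GE gker_sym.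
move=> /(_ ylab Gs) /=.
pose a i := tnth (svm_sel s).1 i * lab (tnth s i).
have qE : \sum_(i < n) \sum_(j < n) tnth (svm_sel s).1 i * tnth (svm_labels s) i *
   (tnth (svm_sel s).1 j * tnth (svm_labels s) j) * tnth (tnth (svm_gram s) i) j =
   \sum_i \sum_j a i * a j * gker gamma (v ^~ (tnth s i)) (v ^~ (tnth s j)).
  by apply: eq_bigr => i _; apply: eq_bigr => j _; rewrite GE !yE.
rewrite qE.
have psd1 := gker_psd a (fun i => v ^~ (tnth s i)) gamma0.
set q := \sum_i \sum_j _ in psd1 *.
move=> /(_ psd1).
have aF : \sum_(i < n) tnth (svm_sel s).1 i * tnth (svm_labels s) i * f i = \sum_i a i * f i.
  by apply: eq_bigr => i _; rewrite yE.
rewrite aF.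
(* Positivity of the kernel on the disjoint union of the competitor's centres and the data, with
   coefficients [p.1] and [- 2 * a i]: the square of the distance between competitor and score. *)
have psd2 : 0 <= N - 4 * \sum_i a i * f i + 4 * q.
  pose pt (i : 'I_(size l)) := tnth (in_tuple l) i.
  pose a' (i : 'I_(size l) + 'I_n) := match i with inl i => (pt i).1 | inr i => - 2 * a i end.
  pose c' (i : 'I_(size l) + 'I_n) := match i with
    inl i => (pt i).2 | inr i => v ^~ (tnth s i) end.
  have := gker_psd a' c' gamma0.
  have fE i : f i = \sum_j (pt j).1 * gker gamma (pt j).2 (v ^~ (tnth s i)).
    by rewrite /f /gcomb /gauss_comb big_tnth.
  have NE : N = \sum_i \sum_j (pt i).1 * (pt j).1 * gker gamma (pt i).2 (pt j).2.
    by rewrite /N big_tnth; apply: eq_bigr => i _; rewrite big_tnth.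
  have -> : \sum_i \sum_j a' i * a' j * gker gamma (c' i) (c' j) =
      N - 4 * (\sum_i a i * f i) + 4 * q; last by [].
  rewrite big_sumType /=.
  under eq_bigr do rewrite big_sumType /=.
  rewrite big_split/= -NE -!addrA; congr (_ + _).
  under [X in _ + X = _]eq_bigr do rewrite big_sumType /=.
  rewrite [X in _ + X]big_split/=.
  have e1 : \sum_i \sum_j (pt i).1 * (- 2 * a j) * gker gamma (pt i).2 (v ^~ (tnth s j)) =
      - 2 * \sum_i a i * f i.
    rewrite exchange_big/= mulr_sumr; apply: eq_bigr => i _.
    by rewrite fE !mulr_sumr; apply: eq_bigr => j _; ring.
  have e2 : \sum_i \sum_j - 2 * a i * (pt j).1 * gker gamma (v ^~ (tnth s i)) (pt j).2 =
      - 2 * \sum_i a i * f i.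
    rewrite mulr_sumr; apply: eq_bigr => i _.
    by rewrite fE !mulr_sumr; apply: eq_bigr => j _; rewrite gker_sym; ring.
  have e3 : \sum_i \sum_j - 2 * a i * (- 2 * a j) * gker gamma (v ^~ (tnth s i)) (v ^~ (tnth s j)) =
      4 * q.
    rewrite mulr_sumr; apply: eq_bigr => i _; rewrite mulr_sumr.
    by apply: eq_bigr => j _; ring.
  by rewrite e1 e2 e3; ring.
move=> /(_ psd2).
have -> : \sum_(i < n) Num.max 0 (1 - tnth (svm_labels s) i *
    (svm_value (svm_gram s) (svm_labels s) (svm_sel s).1 i + (svm_sel s).2)) =
    \sum_(i < n) hinge (lab (tnth s i) * svm_score s (tnth s i)).
  apply: eq_bigr => i _; rewrite yE /hinge /svm_score /svm_value.
  congr (Num.max 0 (1 - _ * (2 * _ + _))); apply: eq_bigr => j _.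
  by rewrite GE yE.
move=> h; apply: (le_trans h); rewrite lerD2l ler_pM2l//.
by apply: ler_sum => i _; rewrite yE.
Qed.

Lemma sum_svm_coef n (s : n.-tuple E) :
  \sum_(i < n) `|2 * (tnth (svm_sel s).1 i * lab (tnth s i))| <= 2 * (n%:R * C n).
Proof.
have [[[_ aC] _] _] := sel_ok s.
have -> : 2 * (n%:R * C n) = \sum_(i < n) 2 * C n.
  by rewrite sumr_const card_ord -[RHS]mulr_natl mulrCA.
apply: ler_sum => i _; rewrite !normrM (normr_lab hlab) mulr1 ger0_norm//.
by have /andP[a0 a1] := aC i; rewrite ger0_norm// ler_pM2l.
Qed.

Lemma measurable_net_point D m (eta : R)
    (p : {ffun {ffun 'I_dd -> 'I_D} -> 'I_(2 * m).+1} * 'I_(2 * m).+1) :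
  measurable_fun setT (fun e => net_point gamma B eta p (v ^~ e)).
Proof.
have mclip : measurable_fun setT (@clip R).
  by apply: measurable_maxr => //; apply: measurable_minr.
apply: (measurableT_comp mclip); apply: measurable_funD => //.
apply: measurable_sum => kappa; apply: measurable_funM => //.
apply: measurable_funM => //; apply: measurable_funM.
  apply: measurableT_comp => //; apply: measurable_funM => //.
  by apply: measurable_sum => k; exact: measurable_funX.
apply: measurable_prod => k _; apply: measurable_funX.
exact: measurable_funM.
Qed.

(** The deterministic core: chance enters only through the last two hypotheses. The 7 [del] are 1
    for the penalty, 1 for the empirical risk of the competitor, 2 for passing to the net on the
    sample, 1 for the deviation at the net point, and 2 for returning to the score under the law. *)
Lemma cond_error_good n (s : n.-tuple E) (l : seq (R * ('I_dd -> R)))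
    (H A eta del : R) D m : (0 < n)%N -> (forall i, in_box v B (tnth s i)) ->
  \sum_(p <- l) \sum_(q <- l) p.1 * q.1 * gker gamma p.2 q.2 <= 4 * del * (n%:R * C n) ->
  2 * (n%:R * C n) <= A -> 0 < eta -> A + 1 <= eta * m%:R ->
  A * tker_error dd gamma B D + eta * (expR (2 * gamma * B ^+ 2) ^+ dd + 1) <= 2 * del ->
  \sum_(i < n) hinge (lab (tnth s i) * gcomb v gamma l (tnth s i)) <= n%:R * (H + del) ->
  (forall p : {ffun {ffun 'I_dd -> 'I_D} -> 'I_(2 * m).+1} * 'I_(2 * m).+1,
    \sum_(i < n) lab (tnth s i) * net_point gamma B eta p (v ^~ (tnth s i)) <=
    n%:R * (margin Q lab (fun e => net_point gamma B eta p (v ^~ e)) + del)) ->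
  cond_error s <= H + 7 * del - ell.
Proof.
move=> n0 sbox Nle CA eta0 Am err emp0 empN.
apply: (le_trans (cond_error_le s)); rewrite lerD2r.
have nR : 0 < n%:R :> R by rewrite ltr0n.
have [p hp] := net_cover gamma0 B1 (svm_sel s).2 D sbox
  (le_trans (sum_svm_coef s) CA) eta0 Am.
have {}hp e : in_box v B e -> `|clip (svm_score s e) - net_point gamma B eta p (v ^~ e)| <= 2 * del.
  move=> be; apply: le_trans err; apply: le_trans (hp _ be).
  rewrite le_eqVlt; apply/orP; left; apply/eqP; congr (`|clip (_ + _) - _|).
  by rewrite mulr_sumr; apply: eq_bigr => i _; rewrite mulrA.
set g := fun e => clip (svm_score s e).
set h := fun e => net_point gamma B eta p (v ^~ e).
have mg : measurable_fun setT g.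
  have mclip : measurable_fun setT (@clip R).
    by apply: measurable_maxr => //; apply: measurable_minr.
  exact: (measurableT_comp mclip (measurable_svm_score1 s)).
have mh : measurable_fun setT h by exact: measurable_net_point.
have hg : margin Q lab h <= margin Q lab g + 2 * del.
  apply: margin_le => //.
  - by apply: (@lab_bounded _ _ _ _ _ _ _ _ 1) => // e; exact: clip_norm.
  - by apply: (@lab_bounded _ _ _ _ _ _ _ _ 1) => // e; exact: clip_norm.
  - by apply: filterS ae_box_law0 => e /hp; rewrite distrC.
have hs : \sum_(i < n) hinge (lab (tnth s i) * svm_score s (tnth s i)) <= n%:R * (H + 2 * del).
  rewrite -(ler_pM2l (C0 n)); apply: (le_trans (svm_score_oracle s l)).
  have := ler_wpM2l (ltW (C0 n)) emp0; lra.
have cg : n%:R - \sum_(i < n) lab (tnth s i) * g (tnth s i) <=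
    \sum_(i < n) hinge (lab (tnth s i) * svm_score s (tnth s i)).
  rewrite -[n in n%:R]card_ord -[X in X - _]mulr1 mulr_natl -sumr_const -sumrB.
  by apply: ler_sum => i _; rewrite /g lab_clip; exact: clip_hinge.
have gh : \sum_(i < n) lab (tnth s i) * g (tnth s i) <=
    \sum_(i < n) lab (tnth s i) * h (tnth s i) + n%:R * (2 * del).
  rewrite -[n in n%:R]card_ord mulr_natl -sumr_const -big_split/=.
  apply: ler_sum => i _; have := hp _ (sbox i); rewrite -/(g _) -/(h _) ler_norml.
  by case: (hlab (tnth s i)) => -> /andP[? ?]; lra.
have := empN p; rewrite -/h => eN.
suff : n%:R * 1 <= n%:R * (H + 7 * del + margin Q lab g) by rewrite ler_pM2l//; lra.
have := ler_wpM2l (ltW nR) hg; lra.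
Qed.

Hypothesis nC_infty : (fun n => n%:R * C n) @ \oo --> +oo%R.
Context (c : R) (N0 : nat).
Hypothesis C_linear : forall n, (N0 <= n)%N -> C n <= c * n%:R.

Lemma hinge_lipschitz x y : hinge x <= hinge y + `|y - x|.
Proof.
rewrite /hinge ge_max; apply/andP; split.
  by rewrite addr_ge0// le_max lexx.
have : 1 - y <= Num.max 0 (1 - y) by rewrite le_max lexx orbT.
by have := ler_norm (y - x); lra.
Qed.

Lemma expR_decay (r del : R) : 0 < r -> 0 < del ->
  \forall n \near \oo, expR (- (n%:R * r)) <= del.
Proof.
move=> r0 d0; near=> n.
rewrite expRN -[leRHS]invrK lef_pV2 ?posrE ?invr_gt0 ?expR_gt0//.
apply: (@le_trans _ _ (n%:R * r)).
  by rewrite -ler_pdivrMr//; near: n; exact: nbhs_infty_ger.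
by apply: le_trans (expR_ge1Dx _); rewrite lerDr.
Unshelve. all: by end_near. Qed.

Lemma svm_failure_le eps : 0 < eps ->
  \forall n \near \oo, (P (svm_failure n) <= (ell + eps)%:E)%E.
Proof.
(* 2 [del] are lost in [HE], 7 in [cond_error_good] and 2 on bad samples. The cap at 1 puts the
   deviations in the range of [sample_deviation]. *)
move=> eps0; pose del := Num.min 1 (eps / 12).
have del0 : 0 < del by rewrite lt_min ltr01 divr_gt0.
have del1 : del <= 1 by rewrite ge_min lexx.
have deleps : 12 * del <= eps by rewrite mulrC -ler_pdivlMr// ge_min lexx orbT.
have B0 : 0 <= B by apply: le_trans B1.
have [A GA hA] := best_margin_adherent Q mlab hlab halfspaces_measurable del0.
have [l hl] := gauss_universal mv gamma0 B0 ae_box_law0 GA del0.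
pose f := gcomb v gamma l.
have mf : measurable_fun setT f by exact: measurable_gcomb.
(* A bound for the competitor's hinge loss, which is divided by [K] to meet the bound 1 of
   [sample_deviation]. *)
pose K := 1 + \sum_(p <- l) `|p.1|.
have K1 : 1 <= K by rewrite lerDl; apply: sumr_ge0.
have K0 : 0 < K by exact: lt_le_trans K1.
have mhin (g : E -> R) : measurable_fun setT g -> measurable_fun setT (fun e => hinge (lab e * g e)).
  move=> mg; apply: measurable_maxr => //; apply: measurable_funB => //.
  exact: measurable_funM.
have hin0 x : 0 <= hinge x by rewrite le_max lexx.
have hfK e : hinge (lab e * f e) <= K.
  rewrite /hinge ge_max (ltW K0)/= /K lerD2l.
  apply: le_trans (ler_norm _) _; rewrite normrN normrM normr_lab// mul1r.
  exact: gcomb_bounded.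
pose H := Ex Q (fun e => hinge (lab e * f e)).
(* The hinge risk of a classifier is twice its error, so the bound is [2 * ell + 2 * del]; the term
   [- ell] of [cond_error_good] removes the doubling. *)
have HE : H <= 1 - best_margin Q lab halfspaces + 2 * del.
  have mA : measurable A by apply: sigma_measurable GA; exact: halfspaces_measurable.
  have msA := measurable_sgset (R := R) mA.
  have bsA : ae_bounded Q (fun e => lab e * sgset R A e).
    exact: (lab_bounded Q mlab hlab msA (sgset_norm R A)).
  have bd : ae_bounded Q (fun e => `|sgset R A e - f e|).
    apply: ae_bounded_norm; apply: ae_boundedB; last exact: gcomb_ae_bounded.
    exact: (bounded_ae Q msA (sgset_norm R A)).
  apply: (@le_trans _ _ (Ex Q (fun e => 1 - lab e * sgset R A e + `|sgset R A e - f e|))).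
    apply: Ex_le.
    - apply: (@bounded_ae _ _ _ _ K); first exact: mhin.
      by move=> e; rewrite ger0_norm.
    - apply: ae_boundedD => //; apply: ae_boundedB => //; exact: ae_bounded_cst.
    - apply: aeW => e; apply: (le_trans (hinge_lipschitz _ (lab e * sgset R A e))).
      rewrite -mulrBr normrM normr_lab// mul1r lerD2r /hinge.
      rewrite ge_max lexx andbT subr_ge0.
      have := sgset_norm R A e; rewrite ler_norml => /andP[? ?].
      by case: (hlab e) => ->; lra.
  rewrite ExD//; last by apply: ae_boundedB => //; exact: ae_bounded_cst.
  rewrite ExB//; last exact: ae_bounded_cst.
  rewrite Ex_cst; move: hl hA; rewrite /margin /sgset /f; lra.
pose X := 2 * gamma * B ^+ 2.
have X0 : 0 <= X by rewrite mulr_ge0 ?sqr_ge0// mulr_ge0// ltW.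
pose eX := expR X ^+ dd.
have eX0 : 0 <= eX by rewrite exprn_ge0 ?expR_ge0.
(* Makes the whole rounding error of [net_cover] equal to [del]. *)
pose eta := del / (eX + 1).
have eta0 : 0 < eta by rewrite divr_gt0// ltr_wpDl.
pose W := dd%:R * (eX * expR X).
have W0 : 0 <= W by rewrite !mulr_ge0 ?expR_ge0.
(* One constant for two needs of [net_rate]: the 1 covers the size of the coefficients, and [W] the
   factor in front of [exp_coeff X D] in [tker_error]. *)
pose c4 := 2 * `|c| * (1 + W).
have c40 : 0 <= c4 by rewrite !mulr_ge0// addr_ge0.
have r0 : 0 < del ^+ 2 / 32 by rewrite divr_gt0// exprn_gt0.
have r1 : 0 < (del / K) ^+ 2 / 32 by rewrite divr_gt0// exprn_gt0// divr_gt0.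
near=> n.
have n0 : (0 < n)%N by near: n; exact: nbhs_infty_gt.
have [D [m [Dm1 Dm2 Dm3]]] : exists D m : nat,
    [/\ c4 * n%:R ^+ 2 + 1 <= eta * m%:R,
        c4 * n%:R ^+ 2 * exp_coeff X D <= del &
        (2 * m).+1%:R ^+ (D ^ dd).+1 * expR (- (n%:R * (del ^+ 2 / 32))) <= del].
  by near: n; exact: net_rate.
have dev0 : expR (- (n%:R * ((del / K) ^+ 2 / 32))) <= del by near: n; exact: expR_decay.
have Nle : \sum_(p <- l) \sum_(q <- l) p.1 * q.1 * gker gamma p.2 q.2 <= 4 * del * (n%:R * C n).
  rewrite mulrC -ler_pdivrMr ?mulr_gt0//.
  by near: n; move/cvgryPge : nC_infty; apply.
have nN0 : (N0 <= n)%N by near: n; exact: nbhs_infty_ge.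
pose An := 2 * `|c| * n%:R ^+ 2.
have n2 : 0 <= n%:R ^+ 2 :> R by exact: sqr_ge0.
have c20 : 0 <= 2 * `|c| by rewrite mulr_ge0.
have An0 : 0 <= An by rewrite mulr_ge0.
have AnC : 2 * (n%:R * C n) <= An.
  have : C n <= `|c| * n%:R.
    by apply: (le_trans (C_linear nN0)); rewrite ler_wpM2r// ler_norm.
  move=> /(ler_wpM2l (ler0n R n)); rewrite /An expr2; lra.
have Anc4 : An <= c4 * n%:R ^+ 2.
  by rewrite /An /c4 ler_wpM2r// ler_peMr// lerDl.
have Am : An + 1 <= eta * m%:R by lra.
have errD : An * tker_error dd gamma B D + eta * (eX + 1) <= 2 * del.
  have -> : eta * (eX + 1) = del.
    by rewrite /eta -mulrA mulVf ?mulr1// gt_eqF// ltr_wpDl.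
  have : An * tker_error dd gamma B D <= del; last by lra.
  apply: le_trans Dm2.
  have -> : An * tker_error dd gamma B D = 2 * `|c| * W * n%:R ^+ 2 * exp_coeff X D.
    by rewrite /An /tker_error /W /eX -/X; ring.
  rewrite ler_wpM2r ?exp_coeff_ge0// ler_wpM2r// /c4 ler_wpM2l//.
  by rewrite lerDr.
pose T := ({ffun {ffun 'I_dd -> 'I_D} -> 'I_(2 * m).+1} * 'I_(2 * m).+1)%type.
pose h0 e := hinge (lab e * f e) / K.
pose hN (p : T) e := lab e * net_point gamma B eta p (v ^~ e).
have mh0 : measurable_fun setT h0 by apply: measurable_funM => //; exact: mhin.
have h01 e : `|h0 e| <= 1.
  by rewrite /h0 ger0_norm ?divr_ge0 ?(ltW K0)// ler_pdivrMr// mul1r.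
have mhN p : measurable_fun setT (hN p).
  by apply: measurable_funM => //; exact: measurable_net_point.
have hN1 p e : `|hN p e| <= 1.
  by rewrite /hN normrM normr_lab// mul1r; exact: clip_norm.
have us : uniq (training n) by have /= /andP[] := training_uniq n.
pose bad0 := [set w | n%:R * (Ex P (h0 \o Z None) + del / K) <=
                   \sum_(i < n) h0 (tnth (S n w) i)].
pose badN p := [set w | n%:R * (Ex P (hN p \o Z None) + del) <=
                   \sum_(i < n) hN p (tnth (S n w) i)].
have P0 : fine (P bad0) <= del.
  have dK : 0 <= del / K <= 4.
    rewrite divr_ge0 ?(ltW K0) ?(ltW del0)//= ler_pdivrMr//; lra.
  apply: (le_trans (sample_deviation mZ indZ idZ None us mh0 h01 dK)).
  by rewrite -mulrA.
have PN p : fine (P (badN p)) <= expR (- (n%:R * (del ^+ 2 / 32))).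
  have dK : 0 <= del <= 4 by rewrite ltW//=; lra.
  apply: (le_trans (sample_deviation mZ indZ idZ None us (mhN p) (hN1 p) dK)).
  by rewrite -mulrA.
have cardT : #|{: T}| = ((2 * m).+1 ^ (D ^ dd).+1)%N.
  by rewrite card_prod card_ffun card_ffun !card_ord expnSr.
have mbad (h : E -> R) a : measurable_fun setT h ->
    measurable [set w | a <= \sum_(i < n) h (tnth (S n w) i)].
  move=> mh; rewrite -[X in measurable X]setTI.
  have ms : measurable_fun setT (fun w => \sum_(i < n) h (tnth (S n w) i)).
    apply: measurable_sum => i; apply: (measurableT_comp mh).
    exact: (measurableT_comp (measurable_tnth i) (measurable_sample mZ (training n))).
  exact: (measurable_fun_ler (measurable_cst a) ms measurableT (Y := [set true])).
have mb0 : measurable bad0 by exact: mbad.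
have mbN p : measurable (badN p) by exact: mbad.
(* On a bad sample the conditional error is at most 1, which one of the indicators supplies. The
   expectation of [G] is the union bound. *)
pose G w := (ell + 9 * del) + (\1_bad0 w + \sum_(p : T) \1_(badN p) w).
have bG : ae_bounded P G.
  apply: ae_boundedD; first exact: ae_bounded_cst.
  apply: ae_boundedD; first exact: ae_bounded_indic.
  by apply: ae_bounded_sum => p; exact: ae_bounded_indic.
have ell0 : 0 <= ell.
  by apply: best_error_ge0 => //; exact: halfspaces_measurable.
rewrite svm_failure_cond lee_fin.
apply: (@le_trans _ _ (Ex P G)).
  apply: Ex_le => //; first exact: cond_error_bounded.
  apply: filterS (ae_box_sample n) => w wbox.
  have sum0 : 0 <= \sum_(p : T) \1_(badN p) w :> R by apply: sumr_ge0.
  have [w0|w0] := pselect (bad0 w).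
    apply: (le_trans (cond_error_le1 _)).
    have : \1_bad0 w = 1 :> R by rewrite indicE mem_set.
    rewrite /G; lra.
  have [[p wp]|wN] := pselect (exists p, badN p w).
    apply: (le_trans (cond_error_le1 _)).
    have h1 : \1_(badN p) w = 1 :> R by rewrite indicE mem_set.
    have h2 : 0 <= \1_bad0 w :> R by [].
    have h3 : 1 <= \sum_(p : T) \1_(badN p) w :> R.
      by rewrite (bigD1 p)//= h1 lerDl; apply: sumr_ge0.
    rewrite /G; lra.
  have h2 : 0 <= \1_bad0 w :> R by [].
  have key : cond_error (S n w) <= H + 7 * del - ell; last first.
    apply: (le_trans key); rewrite /G; move: HE; rewrite /best_error; lra.
  apply: (@cond_error_good n (S n w) l H An eta del D m) => //.
  - by move=> i; rewrite tnth_sample; exact: wbox.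
  - move/negP : w0; rewrite -ltNge => /ltW.
    rewrite /h0 -mulr_suml ler_pdivrMr// => h; apply: (le_trans h).
    rewrite -mulrA ler_pM2l ?ltr0n// mulrDl divfK ?gt_eqF// lerD2r.
    rewrite (_ : Ex P _ = K^-1 * H); first by rewrite mulrAC mulVf ?mul1r ?gt_eqF.
    rewrite /H -(Ex_law0 mh0 h01) -ExZ.
      by congr Ex; apply/funext => e; rewrite mulrC.
    apply: (@bounded_ae _ _ _ _ K); first exact: mhin.
    by move=> e; rewrite ger0_norm.
  - move=> p; have wp : ~ badN p w by move=> wp; apply: wN; exists p.
    move/negP : wp; rewrite -ltNge => /ltW.
    by rewrite -(Ex_law0 (mhN p) (hN1 p)).
have b0 : ae_bounded P \1_bad0 by exact: ae_bounded_indic.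
have bS : ae_bounded P (fun w => \sum_(p : T) \1_(badN p) w).
  by apply: ae_bounded_sum => p; exact: ae_bounded_indic.
have EG : Ex P G = ell + 9 * del + (fine (P bad0) + \sum_(p : T) Ex P \1_(badN p)).
  rewrite /G (ExD (ae_bounded_cst P (ell + 9 * del)) (ae_boundedD b0 bS)) (ExD b0 bS).
  rewrite Ex_cst Ex_indic// (Ex_sum _ (f := fun p => \1_(badN p)))// => p.
  exact: ae_bounded_indic.
have hS : \sum_(p : T) Ex P \1_(badN p) <= del.
  apply: le_trans Dm3; rewrite -natrX -cardT mulr_natl -sumr_const.
  by apply: ler_sum => p _; rewrite Ex_indic.
rewrite EG; lra.
Unshelve. all: by end_near. Qed.

Lemma svm_failure_cvg :
  (fun n => P (svm_failure n)) @ \oo --> ell%:E.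
Proof.
rewrite (_ : (fun n => P (svm_failure n)) =
    EFin \o (fun n => Ex P (fun w => cond_error (S n w)))); last first.
  by apply/funext => n; rewrite svm_failure_cond.
apply: cvg_EFin; first exact: nearW.
apply/cvgrPdist_le => eps eps0; near=> n.
have h1 := svm_failure_ge n.
have h2 : (P (svm_failure n) <= (ell + eps)%:E)%E by near: n; exact: svm_failure_le.
move: h1 h2; rewrite svm_failure_cond !lee_fin distrC => h1 h2.
by rewrite ger0_norm ?subr_ge0// lerBlDl.
Unshelve. all: by end_near. Qed.

End FixedDim.

(** * L-splines as orthogonal projections *)

Section Projection.
Context {R : realType} (H : set (R -> R)) (ip : (R -> R) -> (R -> R) -> R)
  (K : R -> R -> R) (t : nat -> R).
Hypothesis hK : is_rkhs H ip K.
Hypothesis ht : forall k, I01 (t k).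
Implicit Types v w x y : R -> R.

Lemma rkhs0 : H (fun=> 0). Proof. by case: hK. Qed.

Lemma rkhs_lin c u v : H u -> H v -> H (fun s => c * u s + v s).
Proof. by case: hK => _ [h _]; exact: h. Qed.

Lemma ipC u v : H u -> H v -> ip u v = ip v u.
Proof. by case: hK => _ [_ [h _]]; exact: h. Qed.

Lemma ip_linl c u v w : H u -> H v -> H w ->
  ip (fun s => c * u s + v s) w = c * ip u w + ip v w.
Proof. by case: hK => _ [_ [_ [h _]]]; exact: h. Qed.

Lemma ip_ge0 u : H u -> 0 <= ip u u.
Proof. by case: hK => _ [_ [_ [_ [h _]]]]; exact: h. Qed.

Lemma ip_eq0 u : H u -> ip u u = 0 -> u = (fun=> 0).
Proof. by case: hK => _ [_ [_ [_ [_ [h _]]]]]; exact: h. Qed.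

Lemma rkhs_kernel k : H (K (t k)).
Proof. by case: hK => _ [_ [_ [_ [_ [_ [_ h]]]]]]; exact: (h _ (ht k)).1. Qed.

Lemma rkhs_eval u k : H u -> u (t k) = ip u (K (t k)).
Proof. by case: hK => _ [_ [_ [_ [_ [_ [_ h]]]]]]; exact: (h _ (ht k)).2. Qed.

Lemma ip_linr c u v w : H u -> H v -> H w ->
  ip w (fun s => c * u s + v s) = c * ip w u + ip w v.
Proof.
move=> hu hv hw; rewrite ipC//; last exact: rkhs_lin.
by rewrite ip_linl// (ipC hu hw) (ipC hv hw).
Qed.

Lemma ip0l w : H w -> ip (fun=> 0) w = 0.
Proof.
move=> hw; have := ip_linl 1 rkhs0 rkhs0 hw.
under [X in ip X w]eq_fun do rewrite mulr0 addr0.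
lra.
Qed.

Lemma rkhs_scale c u : H u -> H (fun s => c * u s).
Proof.
by move=> hu; have := rkhs_lin c hu rkhs0; under eq_fun do rewrite addr0.
Qed.

Lemma ip_scalel c u w : H u -> H w -> ip (fun s => c * u s) w = c * ip u w.
Proof.
move=> hu hw; have := ip_linl c hu rkhs0 hw.
by under [X in ip X w]eq_fun do rewrite addr0; rewrite ip0l// addr0.
Qed.

Lemma rkhs_sub u v : H u -> H v -> H (fun s => u s - v s).
Proof.
move=> hu hv; have := rkhs_lin (-1) hv hu.
by under eq_fun do rewrite mulN1r addrC.
Qed.

Lemma ip_subl u v w : H u -> H v -> H w ->
  ip (fun s => u s - v s) w = ip u w - ip v w.
Proof.
move=> hu hv hw; have := ip_linl (-1) hv hu hw.
under [X in ip X w]eq_fun do rewrite mulN1r addrC.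
by rewrite mulN1r addrC.
Qed.

Lemma ip_subr u v w : H u -> H v -> H w ->
  ip w (fun s => u s - v s) = ip w u - ip w v.
Proof.
move=> hu hv hw; rewrite ipC//; last exact: rkhs_sub.
by rewrite ip_subl// (ipC hu hw) (ipC hv hw).
Qed.

Lemma rkhs_sum n (c : 'I_n -> R) (e : 'I_n -> R -> R) : (forall i, H (e i)) ->
  H (fun s => \sum_i c i * e i s).
Proof.
elim: n c e => [|n IH] c e he.
  by under eq_fun do rewrite big_ord0; exact: rkhs0.
under eq_fun do rewrite big_ord_recl.
by apply: rkhs_lin => //; apply: (IH (c \o lift ord0) (e \o lift ord0)) => i; exact: he.
Qed.

Lemma ip_suml n (c : 'I_n -> R) (e : 'I_n -> R -> R) w : (forall i, H (e i)) -> H w ->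
  ip (fun s => \sum_i c i * e i s) w = \sum_i c i * ip (e i) w.
Proof.
move=> he hw; elim: n c e he => [|n IH] c e he.
  by rewrite big_ord0; under [X in ip X w]eq_fun do rewrite big_ord0; exact: ip0l.
under [X in ip X w]eq_fun do rewrite big_ord_recl.
have hs := @rkhs_sum n (c \o lift ord0) (e \o lift ord0) (fun i => he _).
rewrite (ip_linl _ _ hs)// big_ord_recl; congr (_ + _).
by have /= -> := IH (c \o lift ord0) (e \o lift ord0) (fun i => he _).
Qed.

Lemma ip_sumr n (c : 'I_n -> R) (e : 'I_n -> R -> R) w : (forall i, H (e i)) -> H w ->
  ip w (fun s => \sum_i c i * e i s) = \sum_i c i * ip w (e i).
Proof.
move=> he hw; rewrite ipC//; last exact: rkhs_sum.
rewrite ip_suml//; apply: eq_bigr => i _; by rewrite ipC.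
Qed.

Lemma ip_normB u v : H u -> H v ->
  ip (fun s => u s - v s) (fun s => u s - v s) = ip u u - 2 * ip u v + ip v v.
Proof.
move=> hu hv; rewrite ip_subl//; last exact: rkhs_sub.
by rewrite !ip_subr// (ipC hv hu); ring.
Qed.

(* Gram-Schmidt on the kernels [K (t n)]; when the residual vanishes, [0^-1 = 0]
   makes the corresponding vector [0] and nothing below needs independence. *)
Definition gs_residual (l : seq (R -> R)) (k : R -> R) : R -> R :=
  fun s => k s - \sum_(i < size l) ip k (nth (fun=> 0) l i) * nth (fun=> 0) l i s.

Definition gs_next (l : seq (R -> R)) (k : R -> R) : R -> R :=
  fun s => (Num.sqrt (ip (gs_residual l k) (gs_residual l k)))^-1 * gs_residual l k s.

Fixpoint gs_list (n : nat) : seq (R -> R) :=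
  if n is n'.+1 then rcons (gs_list n') (gs_next (gs_list n') (K (t n'))) else [::].

Definition gs (n : nat) : R -> R := gs_next (gs_list n) (K (t n)).

Lemma gs_listE n : gs_list n = mkseq gs n.
Proof. by elim: n => // n IH; rewrite /= mkseqS -IH. Qed.

Definition gs_res (n : nat) : R -> R :=
  fun s => K (t n) s - \sum_(i < n) ip (K (t n)) (gs i) * gs i s.

Lemma gs_residualE n : gs_residual (gs_list n) (K (t n)) = gs_res n.
Proof.
apply/funext => s; rewrite /gs_residual /gs_res gs_listE size_mkseq.
by congr (_ - _); apply: eq_bigr => i _; rewrite nth_mkseq.
Qed.

Lemma gsE n : gs n = fun s => (Num.sqrt (ip (gs_res n) (gs_res n)))^-1 * gs_res n s.
Proof. by rewrite /gs /gs_next gs_residualE. Qed.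

Lemma rkhs_gs n : H (gs n).
Proof.
elim/ltn_ind: n => n IH; rewrite gsE; apply: rkhs_scale; apply: rkhs_sub.
  exact: rkhs_kernel.
by apply: rkhs_sum => i; exact: IH.
Qed.

Lemma rkhs_gs_res n : H (gs_res n).
Proof.
apply: rkhs_sub; first exact: rkhs_kernel.
by apply: rkhs_sum => i; exact: rkhs_gs.
Qed.

Lemma gs_self n : ip (gs n) (gs n) = 1 \/ gs n = (fun=> 0).
Proof.
set r := gs_res n; have hr : H r := rkhs_gs_res n.
have hs c := rkhs_scale c hr.
have [r0|r0] := eqVneq (ip r r) 0.
  by right; rewrite gsE -/r (ip_eq0 hr r0); apply/funext => s; rewrite mulr0.
left; rewrite gsE -/r ip_scalel// ipC// ip_scalel//.
have rp : 0 < ip r r by rewrite lt_neqAle eq_sym r0 ip_ge0.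
rewrite mulrA -invfM -expr2 sqr_sqrtr ?ip_ge0// mulVf//.
Qed.

(** Covers both cases of [gs_self] at once: a unit vector, or the zero vector with both sides 0. *)
Lemma gs_self_mul n w : H w -> ip w (gs n) * ip (gs n) (gs n) = ip w (gs n).
Proof.
move=> hw; have [->|->] := gs_self n; first by rewrite mulr1.
by rewrite (ipC hw rkhs0) ip0l// mul0r.
Qed.

Lemma gs_orth n i : (i < n)%N -> ip (gs n) (gs i) = 0.
Proof.
elim/ltn_ind: n i => n IH i ni.
have hg := rkhs_gs; have hk := rkhs_kernel n.
have hs : H (fun s => \sum_(j < n) ip (K (t n)) (gs j) * gs j s) by exact: rkhs_sum.
rewrite gsE ip_scalel//; last exact: rkhs_gs_res.
suff -> : ip (gs_res n) (gs i) = 0 by rewrite mulr0.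
rewrite /gs_res ip_subl// ip_suml//.
rewrite (bigD1 (Ordinal ni))//= gs_self_mul; last exact: rkhs_kernel.
rewrite big1 ?addr0 ?subrr// => j ji.
have ij : (j : nat) != i by rewrite -val_eqE in ji.
have -> : ip (gs j) (gs i) = 0; last by rewrite mulr0.
have [ltji|ltij] := ltnP j i.
  rewrite ipC; [|exact: rkhs_gs|exact: rkhs_gs].
  exact: IH.
apply: IH => //; rewrite ltn_neqAle eq_sym ij//.
Qed.

Lemma gs_orth_neq i j : i != j -> ip (gs i) (gs j) = 0.
Proof.
rewrite neq_ltn => /orP[ij|ji]; last exact: gs_orth.
by rewrite ipC; [exact: gs_orth|exact: rkhs_gs|exact: rkhs_gs].
Qed.

(** Inverts Gram-Schmidt; where the normalising inverse is [0^-1], the residual itself vanishes and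
    the formula persists. *)
Lemma kernel_gs n : K (t n) = fun s =>
  Num.sqrt (ip (gs_res n) (gs_res n)) * gs n s + \sum_(i < n) ip (K (t n)) (gs i) * gs i s.
Proof.
apply/funext => s; rewrite [in gs n s]gsE mulrA.
suff -> : Num.sqrt (ip (gs_res n) (gs_res n)) / Num.sqrt (ip (gs_res n) (gs_res n)) *
  gs_res n s = gs_res n s by rewrite /gs_res subrK.
have [r0|r0] := eqVneq (ip (gs_res n) (gs_res n)) 0.
  by rewrite (ip_eq0 (rkhs_gs_res n) r0) mulr0.
rewrite divff ?mul1r// sqrtr_eq0 -ltNge lt_neqAle eq_sym r0 ip_ge0//.
exact: rkhs_gs_res.
Qed.

Definition gs_coord (k : nat) (x : R -> R) : R := ip x (gs k).

(** The change of basis is triangular: with [kernel_coord], knowing the values at the first points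
    amounts to knowing the first coordinates. *)
Lemma coord_kernel x y n : H x -> H y -> (forall i, (i <= n)%N -> gs_coord i x = gs_coord i y) ->
  ip x (K (t n)) = ip y (K (t n)).
Proof.
move=> hx hy xy; rewrite kernel_gs.
have hs := @rkhs_sum n (fun i => ip (K (t n)) (gs i)) (fun i => gs i) (fun i => rkhs_gs i).
have hg := rkhs_gs.
rewrite !ip_linr// !ip_sumr//; congr (_ * _ + _); first exact: xy.
by apply: eq_bigr => i _; congr (_ * _); apply: xy; exact: ltnW.
Qed.

Lemma kernel_coord x y n : H x -> H y ->
  (forall i, (i <= n)%N -> ip x (K (t i)) = ip y (K (t i))) -> gs_coord n x = gs_coord n y.
Proof.
move=> hx hy; elim/ltn_ind: n => n IH xy; rewrite /gs_coord gsE.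
have hr := rkhs_gs_res n; have hg := rkhs_gs.
have hk := rkhs_kernel n.
have hs := @rkhs_sum n (fun i => ip (K (t n)) (gs i)) (fun i => gs i) (fun i => rkhs_gs i).
have hS c := rkhs_scale c hr.
rewrite (ipC hx (hS _)) (ipC hy (hS _)) !ip_scalel// (ipC hr hx) (ipC hr hy).
congr (_ * _); rewrite /gs_res !ip_subr// !ip_sumr//; congr (_ - _); first exact: xy.
apply: eq_bigr => i _; congr (_ * _); apply: IH => // j ji.
by apply: xy; apply: leq_trans ji (ltnW _).
Qed.

Definition gs_proj (d : nat) (x : R -> R) : R -> R := fun s => \sum_(k < d) gs_coord k x * gs k s.

Lemma rkhs_proj d x : H (gs_proj d x).
Proof. by apply: rkhs_sum => i; exact: rkhs_gs. Qed.

Lemma coord_proj d x k : H x -> (k < d)%N -> gs_coord k (gs_proj d x) = gs_coord k x.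
Proof.
move=> hx kd; have hg := rkhs_gs.
rewrite {1}/gs_coord /gs_proj ip_suml// (bigD1 (Ordinal kd))//= gs_self_mul//.
rewrite big1 ?addr0// => j jk; rewrite gs_orth_neq ?mulr0//.
Qed.

Lemma ip_proj d x y : H x -> H y ->
  ip (gs_proj d x) y = \sum_(k < d) gs_coord k x * gs_coord k y.
Proof.
move=> hx hy; have hg := rkhs_gs; rewrite /gs_proj ip_suml//.
by apply: eq_bigr => k _; rewrite /gs_coord (ipC (hg k) hy).
Qed.

Lemma ip_proj2 d x y : H x -> H y ->
  ip (gs_proj d x) (gs_proj d y) = \sum_(k < d) gs_coord k x * gs_coord k y.
Proof.
move=> hx hy; rewrite ip_proj//; last exact: rkhs_proj.
by apply: eq_bigr => k _; rewrite coord_proj.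
Qed.

Lemma ip_dist_proj d x y : H x -> H y ->
  ip (fun s => gs_proj d x s - gs_proj d y s) (fun s => gs_proj d x s - gs_proj d y s) =
  \sum_(k < d) (gs_coord k x - gs_coord k y) ^+ 2.
Proof.
move=> hx hy; rewrite ip_normB; [|exact: rkhs_proj|exact: rkhs_proj].
rewrite !ip_proj2// mulr_sumr -sumrB -big_split/=.
by apply: eq_bigr => k _; ring.
Qed.

Lemma proj_pythagoras d x : H x ->
  ip x x = ip (gs_proj d x) (gs_proj d x) + ip (fun s => x s - gs_proj d x s) (fun s => x s - gs_proj d x s).
Proof.
move=> hx; have hp := rkhs_proj d x.
have E1 := ip_proj d hx hx; have E2 := ip_proj2 d hx hx.
rewrite ip_normB// (ipC hx hp) E1 E2; ring.
Qed.

(** Every interpolant of [x] has the same first [d] coordinates, hence the same projection; by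
    Pythagoras its norm is minimal exactly when nothing is left outside the projection. *)
Lemma Lspline_proj d x : H x -> Lspline H ip t d x = gs_proj d x.
Proof.
move=> hx; have hp := rkhs_proj d x.
have same g : interpolates H t d x g -> forall k, (k < d)%N -> gs_coord k g = gs_coord k x.
  move=> [hg gx] k kd; apply: kernel_coord => // i ik.
  by rewrite -!rkhs_eval// gx//; exact: leq_ltn_trans kd.
have ipj : interpolates H t d x (gs_proj d x).
  split=> // k kd; rewrite !rkhs_eval//; apply: coord_kernel => // i ik.
  by apply: coord_proj => //; exact: leq_ltn_trans kd.
have pg g : interpolates H t d x g -> gs_proj d g = gs_proj d x.
  by move=> gx; apply/funext => s; apply: eq_bigr => k _; rewrite (same _ gx).
have pyth g : interpolates H t d x g -> ip g g = ip (gs_proj d x) (gs_proj d x) +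
    ip (fun s => g s - gs_proj d x s) (fun s => g s - gs_proj d x s).
  by move=> gx; have [hg _] := gx; rewrite (proj_pythagoras d hg) (pg _ gx).
apply: xget_unique.
  split=> // g gx; rewrite /ip_norm ler_sqrt ?ip_ge0//; last by case: gx.
  rewrite (pyth _ gx) lerDl ip_ge0//; apply: rkhs_sub => //; by case: gx.
move=> h [hx' hmin]; have [hh _] := hx'.
have := hmin _ ipj; rewrite /ip_norm ler_sqrt ?ip_ge0// (pyth _ hx') gerDl => h0.
have hs := rkhs_sub hh hp.
have := ip_eq0 hs (le_anti (andb_true_intro (conj h0 (ip_ge0 hs)))).
move=> /(congr1 (fun f => f _)) E; apply/funext => s.
by apply/eqP; rewrite -subr_eq0; apply/eqP; exact: (E s).
Qed.

Lemma proj_best d x (c : 'I_d -> R) : H x ->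
  ip (fun s => x s - gs_proj d x s) (fun s => x s - gs_proj d x s) <=
  ip (fun s => x s - \sum_i c i * gs i s) (fun s => x s - \sum_i c i * gs i s).
Proof.
move=> hx; have hg := rkhs_gs; have hp := rkhs_proj d x.
pose v s := \sum_i c i * gs i s.
change (ip (fun s => x s - gs_proj d x s) (fun s => x s - gs_proj d x s) <=
  ip (fun s => x s - v s) (fun s => x s - v s)).
have hv : H v by apply: rkhs_sum.
have hxp := rkhs_sub hx hp; have hpv := rkhs_sub hp hv.
rewrite !ip_normB//.
have -> : ip x v = ip (gs_proj d x) v.
  rewrite !ip_sumr//; apply: eq_bigr => i _; congr (_ * _).
  by have := coord_proj hx (ltn_ord i); rewrite /gs_coord => ->.
have := ip_ge0 hpv; rewrite ip_normB//.
have E1 := ip_proj d hx hx; have E2 := ip_proj2 d hx hx.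
rewrite (ipC hx hp) E1 E2; lra.
Qed.

(** An approximating kernel combination uses finitely many points, so it lies in the span of the
    first [D] vectors, where the projection is at least as close to [x]. *)
Lemma cvg_proj x : dense_in H ip
    (kernel_span K (\bigcup_(d in [set d | (1 <= d)%N]) tau t d)) -> H x ->
  forall e, 0 < e -> exists D, forall d, (D <= d)%N -> ip_dist ip x (gs_proj d x) < e.
Proof.
move=> dns hx e e0; have [v [[n [c [s [sT vE]]]] xv]] := dns x hx e e0.
have hg := rkhs_gs.
have [k kE] : exists k : 'I_n -> nat, forall i, s i = t (k i).
  have h i : exists k, s i = t k by have [d _ [k _ <-]] := sT i; exists k.
  by exists (fun i => projT1 (cid (h i))) => i; case: cid.
exists (\max_i (k i).+1)%N => d Dd.
have [b vb] : exists b : 'I_d -> R, v = (fun z : R => \sum_i b i * gs i z).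
  have hk i : exists b : 'I_d -> R, K (s i) = (fun z : R => \sum_j b j * gs j z).
    have kd : (k i < d)%N by apply: leq_trans Dd; exact: (leq_bigmax i).
    exists (fun j => if (j : nat) == k i then Num.sqrt (ip (gs_res (k i)) (gs_res (k i)))
      else if (j < k i)%N then ip (K (t (k i))) (gs j) else 0).
    rewrite kE [LHS]kernel_gs; apply/funext => u.
    rewrite [RHS](bigD1 (Ordinal kd))//= eqxx; congr (_ + _).
    rewrite (big_ord_widen_cond d xpredT (fun j => ip (K (t (k i))) (gs j) * gs j u) (ltnW kd)).
    rewrite big_mkcond [RHS]big_mkcond; apply: eq_bigr => j _ /=.
    rewrite -val_eqE/=; have [->|jk] := eqVneq (j : nat) (k i); first by rewrite ltnn.
    by case: ifP => //; rewrite mul0r.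
  have [B BE] : exists B : 'I_n -> 'I_d -> R, forall i, K (s i) = (fun z : R => \sum_j B i j * gs j z).
    by exists (fun i => projT1 (cid (hk i))) => i; case: cid.
  exists (fun j => \sum_i c i * B i j); rewrite vE; apply/funext => u.
  under eq_bigr do rewrite BE mulr_sumr.
  rewrite exchange_big/=; apply: eq_bigr => j _.
  by rewrite mulr_suml; apply: eq_bigr => i _; rewrite mulrA.
apply: le_lt_trans xv; rewrite /ip_dist /ip_norm ler_sqrt.
  by rewrite vb; exact: proj_best.
apply: ip_ge0; apply: rkhs_sub => //; rewrite vb; exact: rkhs_sum.
Qed.

End Projection.

(** * The Gaussian kernel on images under the differential operator *)

Section L2.
Context {R : realType}.
Local Notation mu := (@lebesgue_measure R).
Implicit Types f g : R -> R.

Lemma L2_mul_integrable f g : L2 f -> L2 g ->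
  mu.-integrable I01 (fun t => (f t * g t)%:E).
Proof.
move=> [mf f2] [mg g2].
apply: (le_integrable _ _ _ (integrableD _ f2 g2)); try exact: measurable_itv.
- by apply/measurable_EFinP; exact: measurable_funM.
- move=> t _ /=; rewrite lee_fin [leRHS]ger0_norm ?addr_ge0 ?sqr_ge0// ler_norml.
  by apply/andP; split; nra.
Qed.

Lemma L2_dist f g : L2 f -> L2 g ->
  (\int[mu]_(t in I01) ((f t - g t) ^+ 2) = \int[mu]_(t in I01) (f t * f t) -
    2 * \int[mu]_(t in I01) (f t * g t) + \int[mu]_(t in I01) (g t * g t))%R.
Proof.
move=> Lf Lg; have iff := L2_mul_integrable Lf Lf.
have ifg := L2_mul_integrable Lf Lg; have igg := L2_mul_integrable Lg Lg.
have mI : measurable (I01 : set R) by exact: measurable_itv.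
have mI' : measurable (I01 : set (g_sigma_algebraType R.-ocitv.-measurable)).
  exact: measurable_itv.
have i2 : mu.-integrable I01 (EFin \o (fun t => 2 * (f t * g t))).
  have := integrableZl mI' 2 ifg; apply: eq_integrable => // t _ /=.
rewrite -RintegralZl// -RintegralB// -RintegralD//.
  by apply: eq_Rintegral => t _; ring.
by have := integrableB mI' iff i2; apply: eq_integrable => // t _ /=.
Qed.

End L2.

Section DifferentialOperator.
Context {R : realType} (m : nat) (a : 'I_m -> R -> R) (b0 b1 : 'M[R]_m) (K : R -> R -> R).
Hypothesis hL : Lspline_setting a b0 b1.
Hypothesis hK : is_rkhs (H1_space b0 b1) (ip1 a) K.
Local Notation mu := (@lebesgue_measure R).
Implicit Types u v h : R -> R.

Lemma L2_wderiv h j : sobolev m h -> (j <= m)%N -> L2 (wderiv j h).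
Proof.
move=> [_ [_ [h2 hd]]] jm; suff /xgetPex : exists g, is_weak_deriv j h g.
  by move=> /(_ (fun=> 0)) [].
case: j jm => [_|j jm]; last exact: hd.
by exists h; split=> // psi _; rewrite mul1r.
Qed.

Lemma measurable_diff_op h : sobolev m h -> measurable_fun I01 (diff_op a h).
Proof.
move=> hm; apply: measurable_funD; first exact: (L2_wderiv hm (leqnn m)).1.
apply: measurable_sum => j; apply: measurable_funM; first by case: hL => h1 _; exact: (h1 j).1.
exact: (L2_wderiv hm (ltnW (ltn_ord j))).1.
Qed.

(* [fine +oo = 0], so if [diff_op a u] were not square integrable then [u] would have
   norm [0], that is [u = 0], and [0] lies in the kernel of the operator. *)
Lemma L2_diff_op u : H1_space b0 b1 u -> L2 (diff_op a u).
Proof.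
move=> Hu; have mL := measurable_diff_op Hu.1; split=> //.
have mI : measurable (I01 : set R) by exact: measurable_itv.
have mL2 : measurable_fun I01 (fun t => (diff_op a u t ^+ 2)%:E).
  by apply/measurable_EFinP; exact: measurable_funX.
have [|] := ltP (\int[mu]_(t in I01) (diff_op a u t ^+ 2)%:E)%E +oo%E.
  move=> fin; apply/integrableP; split=> //.
  by under eq_integral do rewrite gee0_abs ?lee_fin ?sqr_ge0//.
rewrite leye_eq => /eqP inf.
have u0 : u = (fun=> 0).
  by apply: (ip_eq0 hK Hu); rewrite /ip1 /Rintegral; under eq_integral do rewrite -expr2; rewrite inf.
have : ker_op a u.
  case: hL => _ [_ [_ [_ [V01 _]]]].
  by have : ((ker_op a) `&` (H1_space b0 b1)) (fun=> 0); [rewrite V01|rewrite u0; case].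
move=> [_ Lu0].
have E : (\int[mu]_(t in I01) (diff_op a u t ^+ 2)%:E)%E = (\int[mu]_(t in I01) (cst 0 t))%E.
  apply: ae_eq_integral => //.
  case: Lu0 => N [mN N0 sub]; exists N; split=> // t tN; apply: sub => h.
  by apply: tN => tt; rewrite h// expr0n.
by move: inf; rewrite E integral0.
Qed.

(** With chosen representatives of weak derivatives, [diff_op] is additive only almost everywhere.
    This is bypassed by expanding both squares: [L2_dist] on one side, bilinearity of [ip1] on the
    other. *)
Lemma gauss_diff_op gamma u v : H1_space b0 b1 u -> H1_space b0 b1 v ->
  gauss gamma (diff_op a u) (diff_op a v) =
  expR (- gamma * ip1 a (fun t => u t - v t) (fun t => u t - v t)).
Proof.
move=> Hu Hv; rewrite /gauss (L2_dist (L2_diff_op Hu) (L2_diff_op Hv)).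
by rewrite (ip_normB hK Hu Hv).
Qed.

End DifferentialOperator.

(** * Limit in the number of discretization points *)

Section Approximation.
Context d (E : measurableType d) (R : realType) (Q : probability E R).
Context (S : nat -> set (set E)).
Hypothesis sigmaS : forall k, sigma_algebra setT (S k).
Hypothesis measS : forall k, S k `<=` measurable.
Hypothesis homoS : forall k l, (k <= l)%N -> S k `<=` S l.

Definition approximable : set (set E) := [set A | measurable A /\
  forall e : R, 0 < e -> exists k B, S k B /\ (Q (A `+` B) < e%:E)%E].

Lemma measurable_setY (A B : set E) : measurable A -> measurable B -> measurable (A `+` B).
Proof. by move=> mA mB; rewrite setY_def; apply: measurableU; exact: measurableD. Qed.

Lemma approximable_incl k A : S k A -> approximable A.
Proof.
move=> SA; split; first exact: measS SA.
by move=> e e0; exists k, A; rewrite setYK measure0 lte_fin.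
Qed.

Lemma approximableC A : approximable A -> approximable (~` A).
Proof.
move=> [mA hA]; split; first exact: measurableC.
move=> e e0; have [k [B [SB h]]] := hA e e0; exists k, (~` B); split.
  by have [_ SC _] := sigmaS k; rewrite -setTD; exact: SC.
by rewrite !setY_def !setDE !setCK setUC ![~` _ `&` _]setIC -!setDE -setY_def.
Qed.

Lemma approximableU A B : approximable A -> approximable B -> approximable (A `|` B).
Proof.
move=> [mA hA] [mB hB]; split; first exact: measurableU.
move=> e e0; have e2 : 0 < e / 2 by lra.
have [k [C [SC hC]]] := hA _ e2; have [l [D [SD hD]]] := hB _ e2.
exists (maxn k l), (C `|` D); split.
  have Sk := homoS (leq_maxl k l) SC; have Sl := homoS (leq_maxr k l) SD.
  have [S0 _ SU] := sigmaS (maxn k l).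
  rewrite -bigcup2E; apply: SU => -[|[|n]] //=.
have mC := measS SC; have mD := measS SD.
apply: (@le_lt_trans _ _ (Q ((A `+` C) `|` (B `+` D)))).
  apply: le_measure; rewrite ?inE.
  - by apply: measurable_setY; exact: measurableU.
  - by apply: measurableU; exact: measurable_setY.
  - by rewrite !setY_def => x /=; tauto.
apply: (@le_lt_trans _ _ (Q (A `+` C) + Q (B `+` D))%E).
  by apply: measureU2; exact: measurable_setY.
by rewrite [e]splitr EFinD; exact: lteD.
Qed.

Lemma approximable_near A B : measurable A -> approximable B -> Q (A `+` B) = 0%E ->
  approximable A.
Proof.
move=> mA [mB hB] AB; split=> // e e0; have [k [C [SC h]]] := hB e e0.
exists k, C; split=> //; apply: le_lt_trans h; have mC := measS SC.
apply: (@le_trans _ _ (Q ((A `+` B) `|` (B `+` C)))).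
  apply: le_measure; rewrite ?inE.
  - exact: measurable_setY.
  - by apply: measurableU; exact: measurable_setY.
  - by rewrite !setY_def => x /=; have [] := pselect (B x); tauto.
apply: (@le_trans _ _ (Q (A `+` B) + Q (B `+` C))%E).
  by apply: measureU2; exact: measurable_setY.
by rewrite AB add0e.
Qed.

(** A countable union is close to a finite one by continuity from below, and a finite union is
    approximated inside the largest of the finitely many [S k] involved. *)
Lemma approximable_sigma : sigma_algebra setT approximable.
Proof.
split.
- by apply: (@approximable_incl 0%N); case: (sigmaS 0%N).
- by move=> A hA; rewrite setTD; exact: approximableC.
- move=> F hF; pose G n := \big[setU/set0]_(i < n.+1) F i.
  have hG n : approximable (G n).
    rewrite /G; elim: n.+1 => [|n' IH].
      by rewrite big_ord0; apply: (@approximable_incl 0%N); case: (sigmaS 0%N).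
    by rewrite big_ord_recr; exact: approximableU.
  have mG n : measurable (G n) by case: (hG n).
  have GU : \bigcup_n F n = \bigcup_n G n by rewrite -bigcup_bigsetU_bigcup.
  have mF : measurable (\bigcup_n F n) by apply: bigcupT_measurable => n; case: (hF n).
  split=> // e e0; have e2 : 0 < e / 2 by lra.
  have cG : (Q \o G) n @[n --> \oo] --> Q (\bigcup_n G n).
    apply: nondecreasing_cvg_mu => //; first by rewrite -GU.
    move=> a b ab; apply/subsetPset => x; rewrite /G -!bigcup_mkord.
    by move=> [i /= ia Fi]; exists i => //=; apply: leq_trans ia _.
  have [n hn] : exists n, (Q ((\bigcup_n F n) `\` G n) < (e / 2)%:E)%E.
    have mU : measurable (\bigcup_n G n) by rewrite -GU.
    move: cG; rewrite -(fineK (fin_num_measure Q _ mU)) => /fine_cvgP[_ /cvgrPdist_lt /(_ _ e2)[n _ /(_ n (leqnn n))/= h]].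
    exists n; rewrite measureD// ?setIidr; last 2 first.
    - by rewrite GU; exact: bigcup_sup.
    - by rewrite -ge0_fin_numE// fin_num_measure.
    rewrite GU -(fineK (fin_num_measure Q _ mU)) -(fineK (fin_num_measure Q _ (mG n))).
    by rewrite -EFinB lte_fin; apply: le_lt_trans (ler_norm _) _.
  have [k [B [SB hB]]] := (hG n).2 _ e2.
  exists k, B; split=> //; have mB := measS SB.
  apply: (@le_lt_trans _ _ (Q (((\bigcup_n F n) `\` G n) `|` (G n `+` B)))).
    have Gsub : G n `<=` \bigcup_n F n by rewrite GU; exact: bigcup_sup.
    apply: le_measure; rewrite ?inE.
    - exact: measurable_setY.
    - by apply: measurableU; [exact: measurableD|exact: measurable_setY].
    - by rewrite !setY_def => x /=; have := Gsub x; have [] := pselect (G n x); tauto.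
  apply: (@le_lt_trans _ _ (Q ((\bigcup_n F n) `\` G n) + Q (G n `+` B))%E).
    by apply: measureU2; [exact: measurableD|exact: measurable_setY].
  by rewrite [e]splitr EFinD; exact: lteD.
Qed.

End Approximation.

(** * Borel sets of the Hilbert space in terms of coordinates *)

Section BorelCoordinates.
Context {R : realType} (H : set (R -> R)) (ip : (R -> R) -> (R -> R) -> R)
  (K : R -> R -> R) (t : nat -> R).
Hypothesis hK : is_rkhs H ip K.
Hypothesis ht : forall k, I01 (t k).
Hypothesis dns : dense_in H ip
  (kernel_span K (\bigcup_(d in [set d | (1 <= d)%N]) tau t d)).
Implicit Types u v w x y : R -> R.
Local Notation TH := (g_sigma_algebraType (ip_open H ip)).
Local Notation gvec := (gs ip K t).
Local Notation coef := (gs_coord ip K t).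
Local Notation gproj := (gs_proj ip K t).

Lemma sum_coord_le d x : H x -> \sum_(k < d) coef k x ^+ 2 <= ip x x.
Proof.
move=> hx; have hp := rkhs_proj hK ht d x.
rewrite (proj_pythagoras hK ht d hx) (ip_proj2 hK ht d hx hx).
under eq_bigr do rewrite expr2.
by rewrite lerDl; apply: (ip_ge0 hK); exact: (rkhs_sub hK).
Qed.

Lemma coord_norm k x : H x -> `|coef k x| <= ip_norm ip x.
Proof.
move=> hx; rewrite -sqrtr_sqr; apply: ler_wsqrtr; apply: le_trans (sum_coord_le k.+1 hx).
by rewrite big_ord_recr/= lerDr; apply: sumr_ge0 => i _; exact: sqr_ge0.
Qed.

Lemma coordB k x y : H x -> H y ->
  coef k (fun s => x s - y s) = coef k x - coef k y.
Proof. by move=> hx hy; rewrite /gs_coord (ip_subl hK)//; exact: rkhs_gs. Qed.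

Lemma ip_dist_le u v r : H u -> H v -> 0 <= r ->
  (ip_dist ip u v <= r) = (ip (fun s => u s - v s) (fun s => u s - v s) <= r ^+ 2).
Proof.
move=> hu hv r0; have h := ip_ge0 hK (rkhs_sub hK hu hv).
by rewrite /ip_dist /ip_norm -[in RHS](sqr_sqrtr h) ler_pXn2r// nnegrE sqrtr_ge0.
Qed.

Lemma ip_dist_lt u v r : H u -> H v -> 0 <= r ->
  (ip_dist ip u v < r) = (ip (fun s => u s - v s) (fun s => u s - v s) < r ^+ 2).
Proof.
move=> hu hv r0; have h := ip_ge0 hK (rkhs_sub hK hu hv).
by rewrite /ip_dist /ip_norm -[in RHS](sqr_sqrtr h) ltr_pXn2r// nnegrE sqrtr_ge0.
Qed.

(** With [a = u - v] and [b = w - v], this is [|a + b|^2 >= 0] rewritten as a bound on [|a - b|^2];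
    neither Cauchy-Schwarz nor square roots intervene. *)
Lemma ip_sub_triangle u v w : H u -> H v -> H w ->
  ip (fun s => u s - w s) (fun s => u s - w s) <=
  2 * ip (fun s => u s - v s) (fun s => u s - v s) +
  2 * ip (fun s => v s - w s) (fun s => v s - w s).
Proof.
move=> hu hv hw; have ha := rkhs_sub hK hu hv; have hb := rkhs_sub hK hw hv.
have := ip_ge0 hK (rkhs_lin hK 1 ha hb).
rewrite (ip_linl hK)//; last exact: (rkhs_lin hK).
rewrite !(ip_linr hK)// (ipC hK hb ha).
have -> : ip (fun s => u s - w s) (fun s => u s - w s) =
   ip (fun s => (u s - v s) - (w s - v s)) (fun s => (u s - v s) - (w s - v s)).
  by congr ip; apply/funext => s; ring.
rewrite (ip_normB hK ha hb) (ip_normB hK hv hw) (ip_normB hK hw hv) (ipC hK hw hv).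
lra.
Qed.

(** A dense family indexed by the countable type [nat * seq rat], giving centres for countably many
    balls. *)
Definition rat_point (D : nat) (q : seq rat) : R -> R :=
  fun s => \sum_(k < D) ratr (nth 0 q k) * gvec k s.

Lemma rkhs_rat_point D q : H (rat_point D q).
Proof. by apply: (rkhs_sum hK) => i; exact: rkhs_gs. Qed.

Lemma rat_point_dense u e : H u -> 0 < e -> exists D q, ip_dist ip u (rat_point D q) < e.
Proof.
move=> hu e0; have e2 : 0 < e / 2 by lra.
have [D /(_ D (leqnn D))] := cvg_proj hK ht dns hu e2.
have hp := rkhs_proj hK ht D u; have hg := rkhs_gs hK ht.
rewrite ip_dist_lt//; last exact: ltW.
(* The [D] squared coordinate errors then sum to at most [e ^+ 2 / 16], and
   [2 * (1/4) + 2 * (1/16) < 1] in [ip_sub_triangle]. *)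
move=> h1; pose del := e / (4 * D.+1%:R).
have del0 : 0 < del by rewrite divr_gt0// mulr_gt0.
have hq (k : nat) : exists q : rat, `|coef k u - ratr q| < del.
  have := @rat_in_itvoo R (coef k u - del) (coef k u + del).
  move=> /(_ ltac:(lra))[q]; rewrite in_itv/= => /andP[qa qb].
  by exists q; rewrite ltr_norml; apply/andP; split; lra.
pose q k := projT1 (cid (hq k)).
have qE k : `|coef k u - ratr (q k)| < del by rewrite /q; case: cid.
exists D, (mkseq q D); have hr := rkhs_rat_point D (mkseq q D).
rewrite ip_dist_lt//; last exact: ltW.
apply: (le_lt_trans (ip_sub_triangle hu hp hr)).
pose c (k : 'I_D) := coef k u - ratr (q k).
have -> : (fun s => gproj D u s - rat_point D (mkseq q D) s) = fun s => \sum_k c k * gvec k s.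
  apply/funext => s; rewrite /gs_proj /rat_point -sumrB; apply: eq_bigr => k _.
  by rewrite nth_mkseq// -mulrBl.
rewrite (ip_suml hK)//; last exact: (rkhs_sum hK).
have h2 : \sum_k c k * ip (gvec k) (fun s => \sum_j c j * gvec j s) <= \sum_(k < D) del ^+ 2.
  apply: ler_sum => k _; rewrite (ip_sumr hK)// (bigD1 k)//= big1 ?addr0; last first.
    by move=> j jk; rewrite (gs_orth_neq hK ht) ?mulr0// eq_sym.
  have : ip (gvec k) (gvec k) <= 1.
    have [->//|->] := gs_self hK ht k; rewrite (ip0l hK)//; exact: rkhs0 hK.
  have := ip_ge0 hK (hg k); have := sqr_ge0 (c k).
  have : c k ^+ 2 <= del ^+ 2 by rewrite -real_normK ?num_real// ler_pXn2r ?nnegrE// ltW// qE.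
  by rewrite mulrA -expr2; nra.
rewrite sumr_const card_ord -mulr_natl in h2.
have h3 : D%:R * del ^+ 2 <= e ^+ 2 / 16.
  rewrite /del -[D.+1%:R]natr1; have : (0 : R) <= D%:R by [].
  move: (D%:R : R) => x x0.
  have -> : x * (e / (4 * (x + 1))) ^+ 2 = e ^+ 2 / 16 * (x / (x + 1) ^+ 2) by field; lra.
  have : x / (x + 1) ^+ 2 <= 1 by rewrite ler_pdivrMr ?mul1r; [nra|apply: exprn_gt0; lra].
  have : 0 <= e ^+ 2 / 16 by apply: divr_ge0 => //; exact: sqr_ge0.
  nra.
have : 0 < e ^+ 2 by exact: exprn_gt0.
move: h1; rewrite expr_div_n; lra.
Qed.

(** By density the squared norm is the supremum of the partial sums of squared coordinates, so a
    closed ball is a countable intersection of conditions on finitely many coordinates. *)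
Lemma ip_dist_coord u p r : H u -> H p -> 0 <= r ->
  ip_dist ip u p <= r <->
  forall d, \sum_(k < d) (coef k u - coef k p) ^+ 2 <= r ^+ 2.
Proof.
move=> hu hp r0; rewrite ip_dist_le//; have hx := rkhs_sub hK hu hp.
set x := (fun s => u s - p s) in hx *.
have sumE d : \sum_(k < d) (coef k u - coef k p) ^+ 2 = \sum_(k < d) coef k x ^+ 2.
  by apply: eq_bigr => k _; rewrite coordB.
split=> [h d|h]; first by rewrite sumE; apply: le_trans h; exact: sum_coord_le.
rewrite leNgt; apply/negP => rx.
(* A projection closer than this to [x] has squared norm above [r ^+ 2], by Pythagoras. *)
have e0 : 0 < Num.sqrt (ip x x - r ^+ 2) by rewrite sqrtr_gt0 subr_gt0.
have [D /(_ D (leqnn D))] := cvg_proj hK ht dns hx e0.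
rewrite (ip_dist_lt hx (rkhs_proj hK ht D x) (ltW e0)) sqr_sqrtr; last by rewrite subr_ge0 ltW.
have := h D; rewrite sumE.
have := proj_pythagoras hK ht D hx; rewrite (ip_proj2 hK ht D hx hx).
under [X in X + _]eq_bigr do rewrite -expr2.
lra.
Qed.

(* Coordinates are set to [0] off [H], so that they are total Borel functions. *)
Definition rkhs_coord (k : nat) (u : TH) : R := if `[< H u >] then coef k u else 0.

Lemma rkhs_coordE k u : H u -> rkhs_coord k u = coef k u.
Proof. by move=> hu; rewrite /rkhs_coord asboolT. Qed.

Lemma measurable_rkhs : measurable (H : set TH).
Proof. by apply: sub_sigma_algebra; split=> // u hu; exists 1; split. Qed.

Lemma measurable_rkhs_coord k : measurable_fun setT (rkhs_coord k).
Proof.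
apply: measurable_fun_lt_sets => c.
have mo : measurable ([set u | H u /\ coef k u < c] : set TH).
  apply: sub_sigma_algebra; split; first by move=> u [].
  move=> u [hu uc]; exists (c - coef k u); split; first lra.
  move=> v hv vu; split=> //.
  have := coord_norm k (rkhs_sub hK hv hu); rewrite coordB//.
  have -> : ip_norm ip (fun s => v s - u s) = ip_dist ip u v.
    by rewrite /ip_dist /ip_norm (ip_normB hK)// (ip_normB hK)// (ipC hK hv hu); congr Num.sqrt; ring.
  by move=> /ler_normlP[_ h]; lra.
(* The value off [H] is 0, so the complement of [H] belongs to the sublevel set exactly when
   [0 < c]. *)
have [c0|c0] := ltP 0 c.
  rewrite (_ : [set x | _] = [set u | H u /\ coef k u < c] `|` ~` H).
    by apply: measurableU => //; apply: measurableC; exact: measurable_rkhs.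
  apply/seteqP; split=> u /=; rewrite /rkhs_coord; case: asboolP => hu; tauto.
rewrite (_ : [set x | _] = [set u | H u /\ coef k u < c])//.
apply/seteqP; split=> u /=; rewrite /rkhs_coord; case: asboolP => hu; try tauto.
by move=> h; move: c0; rewrite leNgt h.
Qed.

Definition coord_sets : set (set TH) :=
  [set B | exists k c, B = [set u | rkhs_coord k u < c]].

Lemma coord_sets_ball (p : R -> R) r :
  <<s coord_sets >> [set u | forall d, \sum_(k < d) (rkhs_coord k u - coef k p) ^+ 2 <= r].
Proof.
pose T := g_sigma_algebraType coord_sets.
have mc k : measurable_fun setT (rkhs_coord k : T -> R).
  by apply: measurable_fun_lt_sets => c; apply: sub_sigma_algebra; exists k, c.
have mS d : measurable ([set u : T | \sum_(k < d) (rkhs_coord k u - coef k p) ^+ 2 <= r]).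
  have mf : measurable_fun setT (fun u : T => \sum_(k < d) (rkhs_coord k u - coef k p) ^+ 2).
    apply: measurable_sum => k; apply: measurable_funX; apply: measurable_funB => //; exact: mc.
  have := measurable_fun_ler mf (measurable_cst r) measurableT (Y := [set true]).
  by rewrite setTI; exact.
rewrite (_ : [set u | _] =
  \bigcap_d [set u : T | \sum_(k < d) (rkhs_coord k u - coef k p) ^+ 2 <= r]).
  exact: (bigcapT_measurable mS).
by apply/seteqP; split=> u h d => [_|]; exact: h.
Qed.

(** An open set is, within [H], the union of the countably many balls around rational points whose
    trace on [H] it contains. Agreement is asked on [H] only, since coordinates do not distinguish
    points off [H]. *)
Lemma open_coord_sets (U : set (R -> R)) : ip_open H ip U ->
  exists2 W : set TH, <<s coord_sets >> W & forall u, H u -> (W u <-> U u).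
Proof.
move=> [UH Uo]; pose rad (j : nat) : R := j.+1%:R^-1.
pose ball D q j : set TH :=
  [set u | forall d, \sum_(k < d) (rkhs_coord k u - coef k (rat_point D q)) ^+ 2 <= rad j ^+ 2].
have ballE D q j u : H u -> ball D q j u <-> ip_dist ip u (rat_point D q) <= rad j.
  move=> hu; have r0 : 0 <= rad j by rewrite /rad.
  rewrite ip_dist_coord//; last exact: rkhs_rat_point.
  by split=> /= h d; move: (h d); congr (_ <= _); apply: eq_bigr => k _; rewrite rkhs_coordE.
pose F (i : nat * seq rat * nat) : set TH :=
  if `[< ball i.1.1 i.1.2 i.2 `&` H `<=` U >] then ball i.1.1 i.1.2 i.2 else set0.
exists (\bigcup_i F i).
  pose T := g_sigma_algebraType coord_sets.
  have mF i : measurable (F i : set T).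
    rewrite /F; case: asboolP => _; last exact: measurable0.
    exact: coord_sets_ball.
  exact: (countable_bigcupT_measurable _ mF).
move=> u hu; split.
  by move=> [[[D q] j] _]; rewrite /F/=; case: asboolP => // h ub; apply: h.
move=> Uu; have [r [r0 hr]] := Uo _ Uu.
(* A ball of radius [rad j] that contains [u] has all its points in [H] within [2 * rad j] of
   [u]. *)
have [j jr] : exists j, 2 * rad j < r.
  exists (Num.bound (2 / r)); rewrite /rad.
  have := archi_boundP (ltW (divr_gt0 (ltr0n R 2) r0)).
  by rewrite !ltr_pdivrMr// -natr1; move: (_%:R) => x; nra.
have j0 : 0 < rad j by rewrite /rad.
have [D [q uq]] := rat_point_dense hu j0.
exists ((D, q), j) => //; rewrite /F/= asboolT; first by apply/ballE => //; exact: ltW.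
move=> v [bv hv]; apply: hr => //; have hp := rkhs_rat_point D q.
apply: le_lt_trans jr; rewrite ip_dist_le//; last by rewrite mulr_ge0// ltW.
apply: (le_trans (ip_sub_triangle hu hp hv)).
move: uq; rewrite ip_dist_lt//; last exact: ltW.
move: bv; rewrite ballE// ip_dist_le//; last exact: ltW.
rewrite (ip_normB hK hv hp) (ip_normB hK hp hv) (ipC hK hv hp) exprMn; lra.
Qed.

Lemma borel_coord_sets (A : set TH) : measurable A ->
  exists2 W : set TH, <<s coord_sets >> W & forall u, H u -> (W u <-> A u).
Proof.
pose M := [set A : set TH |
  exists2 W : set TH, <<s coord_sets >> W & forall u, H u -> (W u <-> A u)].
apply: (@smallest_sub _ _ _ M); last exact: open_coord_sets.
have [S0 SC SU] := smallest_sigma_algebra setT coord_sets.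
split.
- by exists set0.
- move=> B [W SW hW]; exists (setT `\` W); first exact: SC.
  by move=> u hu; split=> -[_ h]; split=> // h'; apply: h; apply/hW.
- move=> F hF; pose W n := projT1 (cid2 (hF n)).
  have hW n : <<s coord_sets >> (W n) /\ forall u, H u -> (W n u <-> F n u).
    by rewrite /W; case: cid2.
  exists (\bigcup_n W n); first by apply: SU => n; exact: (hW n).1.
  by move=> u hu; split=> -[n _ h]; exists n => //; apply/(hW n).2.
Qed.

End BorelCoordinates.

Lemma sgn1_id (R : realType) (y : R) : is_label y -> sgn1 y = y.
Proof. by case=> ->; rewrite /sgn1 ?ler01// lerNr oppr0 ler10. Qed.

Lemma sgset_label d (T : measurableType d) (R : realType) (A : set T) e : is_label (sgset R A e).
Proof. by rewrite /sgset indicE; case: (e \in A) => /=; [right|left]; ring. Qed.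

(** * From the best error in finitely many coordinates to the Bayes error *)

Section BayesLimit.
Context {R : realType} (H : set (R -> R)) (ip : (R -> R) -> (R -> R) -> R)
  (K : R -> R -> R) (t : nat -> R).
Hypothesis hK : is_rkhs H ip K.
Hypothesis ht : forall k, I01 (t k).
Hypothesis dns : dense_in H ip
  (kernel_span K (\bigcup_(d in [set d | (1 <= d)%N]) tau t d)).
Local Notation TH := (g_sigma_algebraType (ip_open H ip)).
Local Notation E := (TH * R)%type.
Context {disp : measure_display} {Om : measurableType disp} (P : probability Om R).
Context (X : Om -> R -> R) (Y : Om -> R) (Z : option nat -> Om -> E).
Hypothesis HX : forall w, H (X w).
Hypothesis lY : forall w, is_label (Y w).
Hypothesis mZ : forall i, measurable_fun setT (Z i).
Hypothesis Z0 : forall w, Z None w = (X w, Y w).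
Local Notation Q := (law0 P mZ).

Definition pair_coord d (k : 'I_d) (e : E) : R := rkhs_coord K t k e.1.
(** The sign makes this a label at every point of the space, not only at the values taken by the
    pair. *)
Definition pair_label (e : E) : R := sgn1 e.2.

Local Notation v := pair_coord.
Local Notation lab := pair_label.
Local Notation half d := (coord_halfspaces (@v d)).
Local Notation bayes := (bayes_error P H ip X Y).

Lemma measurable_pair_coord d k : measurable_fun setT (@v d k).
Proof.
exact: (measurableT_comp (measurable_rkhs_coord hK ht k) measurable_fst).
Qed.

Lemma measurable_pair_label : measurable_fun setT lab.
Proof. exact: (measurableT_comp (@measurable_sgn1 R) measurable_snd). Qed.

Lemma pair_labelP e : is_label (lab e). Proof. exact: sgn1_label. Qed.

Lemma pair_label0 w : lab (Z None w) = Y w.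
Proof. by rewrite Z0 /pair_label/= (sgn1_id (lY w)). Qed.

Lemma half_measurable d : half d `<=` measurable.
Proof. by apply: halfspaces_measurable => k; exact: measurable_pair_coord. Qed.

Lemma half_homo d d' : (d <= d')%N -> <<s half d >> `<=` <<s half d' >>.
Proof.
move=> dd; apply: smallest_sub; first exact: smallest_sigma_algebra.
move=> _ [k [c ->]]; apply: sub_sigma_algebra.
by exists (widen_ord dd k), c.
Qed.

(** Turns a set defined by coordinates of the pair into a Borel set of functions, hence into a
    classifier competing in the Bayes error. *)
Lemma half_fst d A : <<s half d >> A ->
  exists2 A' : set TH, measurable A' & A = fst @^-1` A'.
Proof.
pose M := [set A : set E | exists2 A' : set TH, measurable A' & A = fst @^-1` A'].
apply: (@smallest_sub _ _ _ M).
  split.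
  - by exists set0.
  - by move=> _ [A' mA ->]; exists (~` A'); [exact: measurableC|rewrite setTD preimage_setC].
  - move=> F hF; pose G n := projT1 (cid2 (hF n)).
    have hG n : measurable (G n) /\ F n = fst @^-1` (G n) by rewrite /G; case: cid2.
    exists (\bigcup_n G n); first by apply: bigcupT_measurable => n; exact: (hG n).1.
    by rewrite preimage_bigcup; apply: eq_bigcupr => n _; exact: (hG n).2.
move=> _ [k [c ->]]; exists [set u | rkhs_coord K t k u < c] => //.
by apply: measurable_lt_cst; exact: measurable_rkhs_coord.
Qed.

Lemma law_pair (A : set E) : measurable A -> Q A = P [set w | A (X w, Y w)].
Proof.
by move=> mA; rewrite /law0/= /pushforward; congr (P _); apply/seteqP; split=> w /=; rewrite Z0.
Qed.

Lemma error_pair (s : E -> R) : measurable_fun setT s ->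
  (error_of Q lab s)%:E = P [set w | s (X w, Y w) <> Y w].
Proof.
move=> ms; have mS := measurable_error_set measurable_pair_label ms.
rewrite /error_of fineK ?fin_num_measure// law_pair//; congr (P _).
by apply/seteqP; split=> w /=; rewrite /pair_label/= (sgn1_id (lY w)).
Qed.

Lemma bayes_error_le (phi : (R -> R) -> R) :
  measurable_fun (H : set TH) phi -> (forall x, H x -> is_label (phi x)) ->
  (bayes <= P [set w | phi (X w) <> Y w])%E.
Proof. by move=> mphi lphi; apply: ereal_inf_lbound; exists phi. Qed.

Lemma bayes_error_fin : bayes \is a fin_num.
Proof.
rewrite ge0_fin_numE; last by apply: le_ereal_inf_tmp => _ [phi _ <-]; exact: measure_ge0.
have := @bayes_error_le (cst 1) (measurable_cst _) (fun _ _ => or_intror erefl).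
move=> /le_lt_trans; apply; apply: le_lt_trans (ltey 1).
apply: probability_le1.
rewrite (_ : [set w | _] = Z None @^-1` [set e | cst 1 e <> lab e]); last first.
  by apply/seteqP; split=> w /=; rewrite pair_label0.
rewrite -[X in measurable X]setTI; apply: (mZ None) => //.
exact: (measurable_error_set measurable_pair_label (measurable_cst _)).
Qed.

Lemma bayes_le_best d : (bayes <= (best_error Q lab (half d))%:E)%E.
Proof.
apply/lee_addgt0Pr => e e0; have e2 : 0 < 2 * e by lra.
have hm := @half_measurable d.
have [A SA hA] := best_margin_adherent Q measurable_pair_label pair_labelP hm e2.
have [A' mA' AE] := half_fst SA; have mA := sigma_measurable hm SA.
have mg := measurable_sgset (R := R) mA.
apply: (@le_trans _ _ (error_of Q lab (sgset R A))%:E).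
  rewrite error_pair//.
  have := @bayes_error_le (sgset R A') (measurable_funTS (measurable_sgset (R := R) mA'))
    (fun x _ => sgset_label R A' x).
  move=> /le_trans; apply; rewrite (_ : [set w | sgset R A' (X w) <> Y w] =
    [set w | sgset R A (X w, Y w) <> Y w])//.
  by rewrite AE; apply/seteqP; split=> w; rewrite /sgset /= !indicE.
rewrite -EFinD lee_fin error_of_margin//.
- by rewrite /best_error; lra.
- exact: measurable_pair_label.
- exact: pair_labelP.
- by move=> x; exact: sgset_label.
Qed.

(** On [H] the set agrees with some [W] generated by all coordinates, and [X] takes its values in
    [H], so the two preimages differ by a null set. For such [W] the claim follows from the
    generators, each of which involves one coordinate. *)
Lemma approximable_borel (A' : set TH) : measurable A' ->
  approximable Q (fun d => <<s half d >>) (fst @^-1` A').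
Proof.
move=> mA'.
have sigmaS d : sigma_algebra setT <<s half d >> by exact: smallest_sigma_algebra.
have measS d : <<s half d >> `<=` measurable by apply: sigma_measurable; exact: half_measurable.
have homoS := half_homo.
have [W SW hW] := borel_coord_sets hK ht dns mA'.
have mfst : measurable_fun setT (fst : E -> TH) := measurable_fst.
have hapx : approximable Q (fun d => <<s half d >>) (fst @^-1` W).
  have [S0 SC SU] := approximable_sigma Q sigmaS measS homoS.
  pose M := [set W : set TH | approximable Q (fun d => <<s half d >>) (fst @^-1` W)].
  move: W SW {hW}; apply: (@smallest_sub _ _ _ M).
    split.
    - by rewrite /M/= preimage_set0.
    - by move=> B hB; rewrite /M/= setTD preimage_setC -setTD; exact: SC.
    - by move=> F hF; rewrite /M/= preimage_bigcup; exact: SU.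
  move=> _ [k [c ->]]; apply: (@approximable_incl _ _ _ _ _ measS k.+1).
  by apply: sub_sigma_algebra; exists ord_max, c.
apply: (approximable_near measS _ hapx).
  by rewrite -[X in measurable X]setTI; exact: mfst.
have mW : measurable (fst @^-1` W : set E) by case: hapx.
rewrite law_pair; last first.
  by apply: measurable_setY => //; rewrite -[X in measurable X]setTI; exact: mfst.
rewrite (_ : [set w | _] = set0) ?measure0//; apply/seteqP; split=> // w /=.
by case=> -[h1 h2]; apply: h2; apply/(hW _ (HX w)).
Qed.

(** Replace [{phi = 1}] by a nearby set in finitely many coordinates: the two classifiers disagree
    only on the symmetric difference. Monotonicity in [d] then covers every larger [d]. *)
Lemma best_error_near (phi : (R -> R) -> R) (e : R) :
  measurable_fun (H : set TH) phi -> (forall x, H x -> is_label (phi x)) -> 0 < e ->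
  exists D, forall d, (D <= d)%N ->
    ((best_error Q lab (half d))%:E <= P [set w | phi (X w) <> Y w] + e%:E)%E.
Proof.
move=> mphi lphi e0.
pose A' : set TH := [set u | H u /\ phi u = 1].
have mA' : measurable A' by have := mphi (@measurable_rkhs R H ip) [set 1] (measurable_set1 1); exact.
have [mA /(_ e e0)[D [B [SB AB]]]] := approximable_borel mA'.
set A := fst @^-1` A' in mA AB; exists D => d Dd.
have SBd := half_homo Dd SB; have hm := @half_measurable d.
have mB := sigma_measurable hm SBd.
have mgA := measurable_sgset (R := R) mA; have mgB := measurable_sgset (R := R) mB.
have mEA := measurable_error_set measurable_pair_label mgA.
have mEB := measurable_error_set measurable_pair_label mgB.
apply: (@le_trans _ _ (error_of Q lab (sgset R B))%:E).
  rewrite lee_fin error_of_margin//; last 3 first.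
  - exact: measurable_pair_label.
  - exact: pair_labelP.
  - by move=> x; exact: sgset_label.
  have := margin_sgset_le Q measurable_pair_label pair_labelP hm SBd.
  by rewrite /best_error; lra.
have -> : P [set w | phi (X w) <> Y w] = (error_of Q lab (sgset R A))%:E.
  rewrite error_pair//; congr (P _).
  suff h w : sgset R A (X w, Y w) = phi (X w) by apply/seteqP; split=> w /=; rewrite h.
  rewrite /sgset indicE; have [|] := boolP (_ \in A).
    by rewrite inE => -[/= _ ->] /=; ring.
  move=> /negP; rewrite inE /A /A'/= => h; case: (lphi _ (HX w)) => [->|h1] /=; first ring.
  by exfalso; apply: h; split.
rewrite /error_of !fineK ?fin_num_measure//.
apply: (@le_trans _ _ (Q ([set x | sgset R A x <> lab x] `|` (A `+` B)))).
  apply: le_measure; rewrite ?inE//; first by apply: measurableU => //; exact: measurable_setY.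
  move=> x /=; rewrite /sgset !indicE => h.
  have [xA|xA] := pselect (A x); have [xB|xB] := pselect (B x).
  - by left; move: h; rewrite !mem_set.
  - by right; left.
  - by right; right.
  - by left; move: h; rewrite !memNset.
apply: (le_trans (measureU2 _ _ _)) => //; first exact: measurable_setY.
by apply: leeD => //; exact: ltW.
Qed.

Lemma best_error_cvg : (best_error Q lab (half d))%:E @[d --> \oo] --> bayes.
Proof.
rewrite -(fineK bayes_error_fin); apply: cvg_EFin; first exact: nearW.
apply/cvgrPdist_le => e e0; have e2 : 0 < e / 2 by lra.
have [_ [phi [mphi lphi] <-] hphi] := lb_ereal_inf_adherent e2 bayes_error_fin.
have [D hD] := best_error_near mphi lphi e2.
exists D => // d /= Dd; have h1 := bayes_le_best d.
have h2 : ((best_error Q lab (half d))%:E <= bayes + e%:E)%E.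
  apply: (le_trans (hD d Dd)); rewrite [in leRHS](splitr e) EFinD addeA.
  by apply: leeD => //; exact: ltW.
move: h1 h2; rewrite -(fineK bayes_error_fin) -EFinD !lee_fin => h1 h2.
by rewrite distrC ger0_norm ?subr_ge0// lerBlDl.
Qed.

End BayesLimit.

(** * The classifier expressed in coordinates *)

Section SplineKernel.
Context {R : realType} (m : nat) (a : 'I_m -> R -> R) (b0 b1 : 'M[R]_m) (K : R -> R -> R).
Hypothesis hL : Lspline_setting a b0 b1.
Hypothesis hK : is_rkhs (H1_space b0 b1) (ip1 a) K.
Context (t : nat -> R).
Hypothesis ht : forall k, I01 (t k).
Local Notation H := (H1_space b0 b1).
Local Notation ip := (ip1 a).
Local Notation Ls d x := (diff_op a (Lspline H ip t d x)).
Local Notation E := ((g_sigma_algebraType (ip_open H ip)) * R)%type.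

Lemma L2_spline d x : H x -> L2 (Ls d x).
Proof.
by move=> hx; rewrite (Lspline_proj hK ht d hx); apply: (L2_diff_op hL hK); exact: rkhs_proj.
Qed.

(** Splines are projections, so their distance is that of the first [d] coordinates. The points [e],
    [f] are tied to [x], [y] by coordinates only, so that the lemma also applies to points off
    [H]. *)
Lemma gauss_spline gamma d (x y : R -> R) (e f : E) : H x -> H y ->
  (forall k, rkhs_coord K t k e.1 = gs_coord ip K t k x) ->
  (forall k, rkhs_coord K t k f.1 = gs_coord ip K t k y) ->
  gauss gamma (Ls d x) (Ls d y) =
  gker gamma ((@pair_coord R H ip K t d) ^~ e) ((@pair_coord R H ip K t d) ^~ f).
Proof.
move=> hx hy ex fy; rewrite (Lspline_proj hK ht d hx) (Lspline_proj hK ht d hy).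
rewrite (gauss_diff_op hL hK)//; [|exact: rkhs_proj|exact: rkhs_proj].
rewrite (ip_dist_proj hK ht d hx hy) /gker; congr (expR (_ * _)).
by apply: eq_bigr => k _; rewrite /pair_coord ex fy.
Qed.

(** The fixed-dimension result quantifies over all tuples of points, while the selection rule is
    valid on Gram matrices of square integrable functions. Points off [H], whose coordinates are 0,
    are represented by the zero function. *)
Definition rkhs_part (e : E) : R -> R := if `[< H e.1 >] then e.1 else fun=> 0.

Lemma rkhs_partP e : H (rkhs_part e).
Proof. by rewrite /rkhs_part; case: asboolP => // _; exact: rkhs0 hK. Qed.

Lemma rkhs_part_coord e k : rkhs_coord K t k e.1 = gs_coord ip K t k (rkhs_part e).
Proof.
rewrite /rkhs_coord /rkhs_part; case: asboolP => // _.
by rewrite /gs_coord (ip0l hK)//; exact: rkhs_gs.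
Qed.

Lemma svm_rule_pair gamma (sel : svm_rule R) d n (s : n.-tuple E) (C : R) :
  svm_rule_ok gamma sel -> 0 < C ->
  let G := svm_gram (@pair_coord R H ip K t d) gamma s in
  let y := svm_labels (@pair_label R H ip) s in
  svm_dual_solution C G y (sel n G y C).1 /\ svm_bias G y (sel n G y C).1 (sel n G y C).2.
Proof.
move=> [_ hsel] C0 G y; pose u : n.-tuple (R -> R) := [tuple Ls d (rkhs_part (tnth s i)) | i < n].
have -> : G = gram gamma u.
  apply: eq_from_tnth => i; apply: eq_from_tnth => j.
  rewrite /G /svm_gram /gram !tnth_mktuple; apply/esym; apply: gauss_spline.
  - exact: rkhs_partP.
  - exact: rkhs_partP.
  - by move=> k; exact: rkhs_part_coord.
  - by move=> k; exact: rkhs_part_coord.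
apply: hsel => // i; first by rewrite tnth_mktuple; apply: L2_spline; exact: rkhs_partP.
by rewrite tnth_mktuple; exact: pair_labelP.
Qed.

End SplineKernel.

(** [n ^ (1 - beta) <= n] for [n >= 1], where powers increase with the exponent; hence the maximum
    with 1 in the threshold. *)
Lemma bigO_powR_linear (R : realType) (C : nat -> R) :
  (exists beta : R, 0 < beta /\ (C : nat -> R^o) =O_\oo (fun n => n%:R `^ (1 - beta) : R^o)) ->
  exists c N, forall n, (N <= n)%N -> C n <= c * n%:R.
Proof.
move=> [beta [b0 /eqO_exP[c [c0 [N _ hN]]]]]; exists c, (maxn N 1) => n nN.
have /hN/= h : (N <= n)%N by apply: leq_trans nN; exact: leq_maxl.
have n1 : 1 <= n%:R :> R by rewrite ler1n; apply: leq_trans nN; exact: leq_maxr.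
apply: (le_trans (ler_norm _)); apply: (le_trans h); rewrite ler_pM2l//.
rewrite ger0_norm ?powR_ge0// -[leRHS]powRr1; last exact: le_trans n1.
by apply: ler_powR => //; lra.
Qed.

Theorem theorem3 (R : realType)
    (m : nat) (hm : (1 <= m)%N) (a : 'I_m -> R -> R) (b0 b1 : 'M[R]_m)
    (hL : Lspline_setting a b0 b1)
    (K : R -> R -> R) (hK : is_rkhs (H1_space b0 b1) (ip1 a) K)
    (gamma : R) (hgamma : 0 < gamma)
    (disp : measure_display) (Omega : measurableType disp)
    (P : probability Omega R)
    (X : Omega -> R -> R) (Y : Omega -> R)
    (xs : nat -> Omega -> R -> R) (ys : nat -> Omega -> R)
    (hX : H_valued_rv (H1_space b0 b1) (ip1 a) X)
    (hY : label_rv Y)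
    (hxs : forall i, H_valued_rv (H1_space b0 b1) (ip1 a) (xs i))
    (hys : forall i, label_rv (ys i))
    (hindep : mutually_independent P
       (pair_and_sample (H1_space b0 b1) (ip1 a) X Y xs ys))
    (hident : identically_distributed P
       (pair_and_sample (H1_space b0 b1) (ip1 a) X Y xs ys))
    (A1 : exists M : R, {ae P, forall w, ip_norm (ip1 a) (X w) <= M})
    (t : nat -> R) (ht : forall k, I01 (t k))
    (A2_posdef : forall d, (1 <= d)%N -> pos_def (kernel_mx K t d))
    (A2_dense : dense_in (H1_space b0 b1) (ip1 a)
       (kernel_span K (\bigcup_(d in [set d | (1 <= d)%N]) tau t d)))
    (C : nat -> nat -> R) (hC : forall d, (1 <= d)%N -> forall n, 0 < C d n)
    (A3 : forall d, (1 <= d)%N ->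
       exists beta : R, 0 < beta < 1 / d%:R /\
         (C d : nat -> R^o) =O_\oo (fun n => n%:R `^ (1 - beta) : R^o))
    (A3_lower : forall d, (1 <= d)%N ->
       (fun n => n%:R * C d n) @ \oo --> +oo%R)
    (sel : svm_rule R) (hsel : svm_rule_ok gamma sel) :
  exists ell : nat -> \bar R,
    (forall d, (1 <= d)%N ->
       (fun n => svm_error P (H1_space b0 b1) (ip1 a) (diff_op a) gamma sel t
                   X Y xs ys d n (C d n)) @ \oo --> ell d) /\
    ell @ \oo --> bayes_error P (H1_space b0 b1) (ip1 a) X Y.
Proof.
set H := H1_space b0 b1; set ip := ip1 a.
pose Z := pair_and_sample H ip X Y xs ys.
have mZ i : measurable_fun setT (Z i).
  case: i => [i|]; apply: measurable_fun_pair.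
  - exact: (hxs i).1.
  - exact: (hys i).1.
  - exact: hX.1.
  - exact: hY.1.
pose v d := @pair_coord R H ip K t d; pose lab := @pair_label R H ip.
exists (fun d => (best_error (law0 P mZ) lab (coord_halfspaces (v d)))%:E); split; last first.
  by apply: (best_error_cvg hK ht A2_dense hX.2 hY.2).
move=> d d1; have [beta [/andP[beta0 _] Obeta]] := A3 d d1.
have [c [N0 hc]] := bigO_powR_linear (ex_intro _ beta (conj beta0 Obeta)).
have [M AM] := A1.
(* A coordinate is bounded by the norm, so [M] gives the almost sure box; the maximum meets the
   normalisation [1 <= B]. *)
have B1 : 1 <= Num.max 1 M by rewrite le_max lexx.
have vB : {ae P, forall w, forall k, `|v d k (Z None w)| <= Num.max 1 M}.
  apply: filterS AM => w XM k; rewrite /v /pair_coord rkhs_coordE/=; last exact: hX.2.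
  by rewrite (le_trans (coord_norm hK ht k (hX.2 w)))// le_max XM orbT.
rewrite (_ : (fun n => svm_error _ _ _ _ _ _ _ _ _ _ _ _ _ _) =
    (fun n => P (svm_failure Z (v d) lab gamma (C d) sel n))).
  exact: (svm_failure_cvg (mZ := mZ) hindep hident
    (@measurable_pair_coord _ _ _ _ _ hK ht d) (@measurable_pair_label _ _ _)
    (@pair_labelP _ _ _) hgamma B1 vB (hC d d1) hsel.1
    (fun n s => svm_rule_pair hL hK ht d s hsel (hC d d1 n)) (A3_lower d d1) hc).
apply/funext => n; rewrite /svm_error; congr (P _).
have zE i w : Z (Some i) w = (xs i w, ys i w) by [].
have coordE (x : R -> R) k : H x -> @rkhs_coord R H ip K t k x = gs_coord ip K t k x.
  by move=> hx; rewrite rkhs_coordE.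
(* An identity for every [w], because the variables are valued in [H], and the labels in {-1,1},
   everywhere. *)
suff scoreE w : svm_classifier H ip (diff_op a) gamma sel t d (C d n)
    [tuple xs i w | i < n] [tuple ys i w | i < n] (X w) =
    sgn1 (svm_score (v d) lab gamma (C d) sel (sample Z (training n) w) (Z None w)).
  by apply/seteqP; split=> w /=; rewrite scoreE /svm_failure/= /lab /pair_label/= (sgn1_id (hY.2 w)).
have HX := hX.2 w; have Hxs i := (hxs i).2 w.
have gE : gram gamma [tuple diff_op a (Lspline H ip t d (tnth [tuple xs i w | i < n] i)) | i < n]
    = svm_gram (v d) gamma (sample Z (training n) w).
  apply: eq_from_tnth => i; apply: eq_from_tnth => j.
  rewrite /gram /svm_gram !tnth_mktuple.
  by apply: (gauss_spline hL hK ht) => // k; exact: (coordE _ _ (Hxs _)).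
have yE : [tuple ys i w | i < n] = svm_labels lab (sample Z (training n) w).
  apply: eq_from_tnth => i; rewrite /svm_labels !tnth_mktuple /lab /pair_label zE/=.
  by rewrite (sgn1_id ((hys i).2 w)).
rewrite /svm_classifier /svm_score /svm_sel gE yE; congr (sgn1 (2 * _ + _)).
apply: eq_bigr => i _; rewrite /svm_labels !tnth_mktuple; congr (_ * _).
apply: (gauss_spline hL hK ht) => // k; last exact: (coordE _ _ HX).
exact: (coordE _ _ (Hxs _)).
Qed.
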